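(* A countably infinite group $\Gamma$ is non-amenable if and only if there exists a free measure preserving action of $\Gamma$ that is not weakly equivalent to any ergodic measure preserving action of $\Gamma$.
   Context: A measure preserving action $\bm{a}=\Gamma\curvearrowright^a(X,\mu)$ of a countable group $\Gamma$ is a Borel action $a$ of $\Gamma$ on a standard Borel space $X$ preserving a Borel probability measure $\mu$ on $X$. It is free if $\mu$-almost every point has trivial stabilizer. Weak containment: for $\bm{a}$ on $(X,\mu)$ and $\bm{b}$ on $(Y,\nu)$, $\bm{a}\prec\bm{b}$ means that for every finite Borel partition $A_0,\dots,A_{k-1}$ of $X$, every finite $F\subseteq\Gamma$, and every $\epsilon>0$ there is a Borel partition $B_0,\dots,B_{k-1}$ of $Y$ with $|\mu(\gamma^aA_i\cap A_j)-\nu(\gamma^bB_i\cap B_j)|<\epsilon$ for all $\gamma\in F$ and $i,j<k$. Weak equivalence means $\bm{a}\prec\bm{b}$ and $\bm{b}\prec\bm{a}$. *)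

(* Defs.v *)
From mathcomp Require Export all_boot all_order all_algebra.
From mathcomp Require Export all_classical all_reals all_analysis.

Set Implicit Arguments.
Unset Strict Implicit.
Unset Printing Implicit Defensive.

Import Order.TTheory GRing.Theory Num.Theory.
Local Open Scope classical_set_scope.
Local Open Scope ring_scope.

(* [T] is Borel isomorphic to a Polish space. Separability is expressed as
   second countability, which is the same for metric spaces, and completeness
   as convergence of Cauchy filters. *)
Definition standard_borel (R : realType) (d : measure_display)
    (T : measurableType d) : Prop :=
  exists (M : metricType R) (f : T -> M),
    [/\ forall F : set_system M, ProperFilter F -> cauchy F ->
          exists x : M, F --> x,
        @second_countable M,
        bijective f
      & forall B : set M,
          <<s [set U : set M | open U] >> B <-> measurable (f @^-1` B)].

(* Since [G] is meant to be countable and discrete, the action map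
   [G * X -> X] is Borel as soon as each [act g] is. *)
Record mp_action (R : realType) (G : groupType) := MPAction {
  act_disp : measure_display;
  act_space : measurableType act_disp;
  act_space_borel : standard_borel R act_space;
  act_measure : probability act_space R;
  act : G -> act_space -> act_space;
  act_one : forall x, act 1%g x = x;
  act_mul : forall (g h : G) x, act (g * h)%g x = act g (act h x);
  act_measurable : forall g, measurable_fun setT (act g);
  act_preserving : forall (g : G) (A : set act_space), measurable A ->
    act_measure (act g @^-1` A) = act_measure A }.

Arguments act_disp {R G} a : rename.
Arguments act_space {R G} a : rename.
Arguments act_measure {R G} a : rename.
Arguments act {R G} a g x : rename.

Definition free_action (R : realType) (G : groupType) (a : mp_action R G) :
    Prop :=
  {ae act_measure a, forall x, forall g : G, act a g x = x -> g = 1%g}.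

Definition ergodic (R : realType) (G : groupType) (a : mp_action R G) : Prop :=
  forall A : set (act_space a), measurable A ->
    (forall g : G, act a g @^-1` A = A) ->
    act_measure a A = 0%E \/ act_measure a A = 1%E.

(* Pieces may be empty, unlike with [classical_sets.partition]. *)
Definition borel_partition (d : measure_display) (T : measurableType d)
    (k : nat) (A : 'I_k -> set T) : Prop :=
  [/\ forall i, measurable (A i), trivIset setT A & cover setT A = setT].

Definition weakly_contained (R : realType) (G : groupType)
    (a b : mp_action R G) : Prop :=
  forall (k : nat) (A : 'I_k -> set (act_space a)), borel_partition A ->
  forall (F : set G), finite_set F ->
  forall eps : R, 0 < eps ->
  exists2 B : 'I_k -> set (act_space b), borel_partition B &
    forall g, F g -> forall i j : 'I_k,
      (`|act_measure a ((act a g @` A i) `&` A j)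
         - act_measure b ((act b g @` B i) `&` B j)| < eps%:E)%E.

Definition weakly_equivalent (R : realType) (G : groupType)
    (a b : mp_action R G) : Prop :=
  weakly_contained a b /\ weakly_contained b a.

(* Amenability of a discrete group: a left-invariant finitely additive
   probability measure on all subsets. *)
Definition amenable (R : realType) (G : groupType) : Prop :=
  exists m : set G -> R,
    [/\ forall A, 0 <= m A,
        m setT = 1,
        forall A B, A `&` B = set0 -> m (A `|` B) = m A + m B
      & forall (g : G) A, m [set (g * x)%g | x in A] = m A].

(* Main.v *)
(* Non-amenable case: let [G] act on the coin tosses indexed by [option G], that
   is, on the Bernoulli shift times a fair coin fixed by [G]. In the Walsh
   basis an almost invariant set that is not close to a function of the fixed
   coin has squared coefficients that push forward, by choosing a uniform
   element of each finite set, to almost invariant means on [G]; so if [G] is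
   not amenable, all almost invariant sets are close to the empty set, to the
   whole space, or to one of the two faces of the fixed coin. If [b] were
   weakly equivalent to this action, then copies in [b] of the event "heads"
   would be ever more invariant, and, by copying pairs of them back, would be
   almost equal to each other up to complement. They converge to an invariant
   set of measure 1/2, so [b] is not ergodic.

   Amenable case: every action is weakly contained in every free one, so
   every free action is weakly equivalent to the Bernoulli shift. Folner sets
   exist, since otherwise Hall's theorem turns the growth of finite sets into
   a paradoxical decomposition of [G]. Given a Folner set [T], one tiles the
   free space greedily by translates of subsets of [T]: the part of [T x] not
   yet covered has, for at least about half of the uncovered mass, relatively
   few points on the boundary of [T], and boundary is the only loss, because
   a tile meets later tiles only where it was exposed. Inside the tiles the
   colouring is copied with exact statistics, by splitting the base of the
   tile in the proportions of the words of the given partition. *)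

From HB Require Import structures.
From mathcomp Require Import ring lra zify.
From mathcomp Require Import measurable_realfun finmap.
Require Import Defs.

Set Implicit Arguments.
Unset Strict Implicit.
Unset Printing Implicit Defensive.

Import Order.TTheory GRing.Theory Num.Theory.
Import numFieldNormedType.Exports.

Local Open Scope classical_set_scope.
Local Open Scope card_scope.
Local Open Scope ring_scope.

(** * The space of coin tosses *)

(** Weak containment gives finite statistics up to an error, never a limit object, and this shapes
    both halves. In the non-amenable half, copies in [b] made for different accuracies are a priori
    unrelated. They can be compared only by sending pairs of them back to the coin space, where the
    almost invariant sets are known; the accuracies decay geometrically, so that closeness of
    neighbours gives a limit set.

    In the amenable half the number of tiling steps depends on data chosen late, so a step may not
    lose a fixed amount of accuracy. Hence statistics inside tiles are copied exactly, which
    requires subsets of every prescribed measure; nonatomicity comes from freeness and the infinity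
    of the group. All remaining losses are charged to the boundary of newly covered mass, so they
    stay proportional to the mass. The gain of a step is bounded below independently of the earlier
    steps, so finitely many steps suffice and no maximal tiling is needed.

    The doubling behind the paradoxical decomposition comes from iterating a growth factor larger
    than 1, which the failure of the Folner condition provides for one finite set. *)

(** [R] is a phantom parameter: the metric takes values in [R], and its canonical instance is found
    from the type. *)
Definition coins (R : realType) : Type := nat -> bool.

HB.instance Definition _ (R : realType) := Pointed.copy (coins R) (nat -> bool).

Section coin_metric.
Variable R : realType.
Implicit Types x y z : coins R.

Lemma ex_diff x y : x <> y -> exists n, x n != y n.
Proof.
move=> xy; apply: contrapT => H; apply: xy; apply/funext => n.
by apply/eqP/negPn/negP => xyn; apply: H; exists n.
Qed.

Definition coin_dist x y : R :=
  if pselect (exists n, x n != y n) is left e then 2^-1 ^+ ex_minn e else 0.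

Lemma coin_dist_ge n x y : x n != y n -> 2^-1 ^+ n <= coin_dist x y.
Proof.
move=> xyn; rewrite /coin_dist; case: pselect => [e|[]]; last by exists n.
case: ex_minnP => m _ /(_ _ xyn) mn.
by rewrite ler_wiXn2l// ?invr_ge0// invf_le1// ler1n.
Qed.

Lemma coin_dist_ge0 x y : 0 <= coin_dist x y.
Proof. by rewrite /coin_dist; case: pselect => // e; rewrite exprn_ge0// invr_ge0. Qed.

Lemma coin_dist_lt n x y : (forall i, (i <= n)%N -> x i = y i) ->
  coin_dist x y < 2^-1 ^+ n.
Proof.
move=> xy; rewrite /coin_dist; case: pselect => [e|_]; last by rewrite exprn_gt0// invr_gt0.
case: ex_minnP => m /eqP xym _; rewrite ltr_iXn2l// ?invr_gt0 ?invf_lt1 ?ltr1n//.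
by rewrite ltnNge; apply/negP => /xy.
Qed.

Lemma coin_dist_ltP n x y :
  coin_dist x y < 2^-1 ^+ n <-> (forall i, (i <= n)%N -> x i = y i).
Proof.
split; last exact: coin_dist_lt.
move=> d i ilen; apply/eqP/negP => /negP /coin_dist_ge.
move=> /le_lt_trans - /(_ _ d); rewrite ltr_iXn2l ?invr_gt0 ?invf_lt1 ?ltr1n//.
by rewrite ltnNge ilen.
Qed.

Lemma coin_distxx x : coin_dist x x = 0.
Proof. by rewrite /coin_dist; case: pselect => // e; exfalso; case: e => n; rewrite eqxx. Qed.

Lemma coin_dist_eq0 x y : coin_dist x y = 0 -> x = y.
Proof.
move=> d; apply: contrapT => /ex_diff[n /coin_dist_ge].
by rewrite d leNgt exprn_gt0// invr_gt0.
Qed.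

Lemma coin_dist_sym x y : coin_dist x y = coin_dist y x.
Proof.
wlog suff : x y / coin_dist x y <= coin_dist y x.
  by move=> H; apply/eqP; rewrite eq_le !H.
rewrite {1}/coin_dist; case: pselect => [e|_]; last exact: coin_dist_ge0.
by case: ex_minnP => m xym _; apply: coin_dist_ge; rewrite eq_sym.
Qed.

Lemma coin_dist_triangle y x z :
  coin_dist x z <= coin_dist x y + coin_dist y z.
Proof.
rewrite {1}/coin_dist; case: pselect => [e|_]; last by rewrite addr_ge0// coin_dist_ge0.
case: ex_minnP => m xzm _; have [xym|/coin_dist_ge xym] := eqVneq (x m) (y m).
- by rewrite ler_wpDl ?coin_dist_ge0// coin_dist_ge// -xym.
- by rewrite ler_wpDr ?coin_dist_ge0.
Qed.

End coin_metric.

HB.instance Definition _ (R : realType) := @isMetric.Build R (coins R)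
  (@coin_dist R) (@coin_distxx R) (@coin_dist_eq0 R) (@coin_dist_sym R)
  (@coin_dist_triangle R).

Section coin_space.
Variable R : realType.
Implicit Types x y z : coins R.

Lemma coin_complete (F : set_system (coins R)) : ProperFilter F -> cauchy F ->
  exists x, F --> x.
Proof.
move=> PF /cauchyP Fc.
have /choice[c Fc'] n : exists x, F (ball x (2^-1 ^+ n)).
  by apply: Fc; rewrite exprn_gt0// invr_gt0.
(* The ball of radius [2^-1 ^+ n] around [c n] fixes the coordinates up to [n], so the limit is the
   diagonal of the centres. *)
pose z n := c n n; exists z => A /nbhs_ballP[e /= e0 zA].
have [N Ne] : exists N, 2^-1 ^+ N < e :> R.
  have /cvgrPdist_lt /(_ e e0)[N _ /(_ N (leqnn N))] :=
    @cvg_expr R (2^-1) ltac:(by rewrite ger0_norm ?invr_ge0// invf_lt1// ltr1n).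
  by rewrite sub0r normrN ger0_norm ?exprn_ge0 ?invr_ge0//; exists N.
apply: filterS (Fc' N) => y; rewrite ballEmdist/= => /coin_dist_ltP cNy.
apply: zA; rewrite ballEmdist/=; apply: lt_trans Ne; apply/coin_dist_ltP => i iN.
have [w []] := filter_ex (filterI (Fc' i) (Fc' N)).
rewrite !ballEmdist/= => /coin_dist_ltP ciw /coin_dist_ltP cNw.
by rewrite /z ciw// -cNw// cNy.
Qed.

Definition cyl (s : seq bool) : set (coins R) := [set x | mkseq x (size s) = s].

Lemma cyl_mkseq x n : cyl (mkseq x n) x.
Proof. by rewrite /cyl/= size_mkseq. Qed.

Lemma mem_cylP x y n : cyl (mkseq x n) y <-> forall i, (i < n)%N -> x i = y i.
Proof.
rewrite /cyl/= size_mkseq; split=> [e i iltn|H].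
  by have := congr1 (nth false ^~ i) e; rewrite !nth_mkseq.
apply: (@eq_from_nth _ false); rewrite ?size_mkseq// => i iltn.
by rewrite !nth_mkseq// H.
Qed.

Lemma cyl_ball x n : cyl (mkseq x n.+1) = ball x (2^-1 ^+ n : R).
Proof.
rewrite ballEmdist; apply/seteqP; split => y /=.
  by move=> /mem_cylP H; apply/coin_dist_ltP => i iltn; exact: H.
by move=> /coin_dist_ltP H; apply/mem_cylP => i iltn; exact: H.
Qed.

Lemma open_cyl s : open (cyl s).
Proof.
rewrite openE => x xs; apply/nbhs_ballP; exists (2^-1 ^+ size s) => /=.
  by rewrite exprn_gt0// invr_gt0.
move=> y; rewrite ballEmdist/= => /coin_dist_ltP xy.
rewrite /cyl/= -{2}xs; apply: (@eq_from_nth _ false); rewrite ?size_mkseq// => i iltn.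
by rewrite !nth_mkseq// xy// ltnW.
Qed.

Lemma nbhs_cyl x (A : set (coins R)) : nbhs x A -> exists n, cyl (mkseq x n) `<=` A.
Proof.
move=> /nbhs_ballP[e /= e0 xA].
have [N Ne] : exists N, 2^-1 ^+ N < e :> R.
  have /cvgrPdist_lt /(_ e e0)[N _ /(_ N (leqnn N))] :=
    @cvg_expr R (2^-1) ltac:(by rewrite ger0_norm ?invr_ge0// invf_lt1// ltr1n).
  by rewrite sub0r normrN ger0_norm ?exprn_ge0 ?invr_ge0//; exists N.
exists N.+1; rewrite cyl_ball; apply: subset_trans xA.
by apply: le_ball; exact: ltW.
Qed.

Lemma coin_second_countable : @second_countable (coins R).
Proof.
exists (range cyl).
  by apply: (sub_countable (card_image_le cyl _)); exact: countableP.
split; first by move=> _ [s _ <-]; exact: open_cyl.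
move=> x A /nbhs_cyl[n nA]; exists (cyl (mkseq x n)) => //=.
by split; [exists (mkseq x n)|exact: cyl_mkseq].
Qed.

Definition coin_mtype : Type := g_sigma_algebraType (@open (coins R)).
HB.instance Definition _ := Measurable.copy coin_mtype
  (g_sigma_algebraType (@open (coins R))).

Lemma coin_standard_borel : standard_borel R coin_mtype.
Proof.
exists (coins R), (fun x => x); split => //.
- exact: coin_complete.
- exact: coin_second_countable.
- by exists id.
Qed.

(** There are countably many cylinders and every open set is the union of those inside it. *)
Lemma coin_measurableE : @measurable _ coin_mtype = <<s range cyl >>.
Proof.
apply/seteqP; split; last first.
  apply: smallest_sub; first exact: smallest_sigma_algebra.
  by move=> _ [s _ <-]; apply: sub_sigma_algebra; exact: open_cyl.
apply: smallest_sub; first exact: smallest_sigma_algebra.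
move=> A oA; have -> : A = \bigcup_(s in [set s | cyl s `<=` A]) cyl s.
  apply/seteqP; split=> [x Ax|x [s /= sA /sA]//].
  have /nbhs_cyl[n nA] : nbhs x A by move: oA; rewrite openE; apply.
  by exists (mkseq x n) => //; exact: cyl_mkseq.
rewrite bigcup_mkcond.
apply: (@countable_bigcupT_measurable _ (g_sigma_algebraType (range cyl))) => //.
move=> s; case: ifP => _; last exact: (@measurable0 _ (g_sigma_algebraType (range cyl))).
by apply: sub_sigma_algebra; exists s.
Qed.

End coin_space.

(** * Real-valued probabilities *)

Ltac meas := repeat first
  [ assumption | apply: measurableI | apply: measurableU | apply: measurableD
  | apply: measurableC | apply: measurable0 | apply: measurableT ].

Ltac set_cases z := repeat match goal with
  | |- context [?A z] => is_var A;
      lazymatch goal with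
      | _ : A z |- _ => fail
      | _ : ~ A z |- _ => fail
      | _ => let H := fresh in destruct (pselect (A z)) as [H|H]
      end
  end.

Ltac set_tauto :=
  let z := fresh "z" in
  rewrite /setY; first [apply/seteqP; split => z /= | move=> z /=];
  set_cases z; tauto.

Section pr.
Context d (T : measurableType d) (R : realType) (P : probability T R).
Implicit Types A B C D : set T.

Definition pr A : R := fine (P A).

Lemma prE A : measurable A -> P A = (pr A)%:E.
Proof. by move=> mA; rewrite /pr fineK//; exact: fin_num_measure. Qed.

Lemma pr_ge0 A : 0 <= pr A.
Proof. by rewrite fine_ge0. Qed.

Lemma pr0 : pr set0 = 0.
Proof. by rewrite /pr measure0. Qed.

Lemma prT : pr setT = 1.
Proof. by rewrite /pr probability_setT. Qed.

Lemma le_pr A B : measurable A -> measurable B -> A `<=` B -> pr A <= pr B.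
Proof. by move=> mA mB AB; rewrite -lee_fin -!prE// le_measure// inE. Qed.

Lemma pr_le1 A : measurable A -> pr A <= 1.
Proof. by move=> mA; rewrite -prT le_pr. Qed.

Lemma prU A B : measurable A -> measurable B -> A `&` B = set0 ->
  pr (A `|` B) = pr A + pr B.
Proof.
move=> mA mB AB; apply: EFin_inj; rewrite EFinD -!prE//; last exact: measurableU.
by rewrite measureU.
Qed.

Lemma prID B A : measurable A -> measurable B ->
  pr A = pr (A `&` B) + pr (A `\` B).
Proof. by move=> mA mB; rewrite -prU ?setUIDK//; meas; set_tauto. Qed.

Lemma prC A : measurable A -> pr (~` A) = 1 - pr A.
Proof. by move=> mA; rewrite -prT (prID measurableT mA) setTI setTD addrAC subrr add0r. Qed.

Lemma le_prU A B : measurable A -> measurable B -> pr (A `|` B) <= pr A + pr B.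
Proof.
move=> mA mB; have -> : A `|` B = A `|` (B `\` A) by set_tauto.
rewrite prU; meas; last set_tauto.
by rewrite lerD2l le_pr//; meas; set_tauto.
Qed.

Lemma pr_bigcup (I : finType) (p : pred I) (F : I -> set T) :
  (forall i, measurable (F i)) -> (forall i j, i != j -> F i `&` F j = set0) ->
  pr (\big[setU/set0]_(i | p i) F i) = \sum_(i | p i) pr (F i).
Proof.
move=> mF dF.
suff H (s : seq I) : uniq s -> pr (\big[setU/set0]_(i <- s | p i) F i) = \sum_(i <- s | p i) pr (F i).
  by have := H (index_enum I) (index_enum_uniq I).
elim: s => [|i s IH] /= => [_|/andP[nis us]]; first by rewrite !big_nil pr0.
rewrite !big_cons; case: ifPn => pi; last exact: IH.
rewrite prU ?IH//; first exact: bigsetU_measurable.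
rewrite big_distrr/= big_seq_cond big1// => j /andP[js _].
by apply: dF; apply: contraNneq nis => ->.
Qed.

Lemma pr_fincover (I : finType) (F : I -> set T) A :
  (forall i, measurable (F i)) -> (forall i j, i != j -> F i `&` F j = set0) ->
  measurable A -> A `<=` \bigcup_i F i ->
  pr A = \sum_i pr (A `&` F i).
Proof.
move=> mF dF mA AF; rewrite -pr_bigcup.
- congr pr; rewrite -big_distrr/=; apply/seteqP; split => [x Ax|x []//].
  by split => //; have [i _ Fi] := AF x Ax; rewrite -bigcup_seq; exists i => //=; rewrite mem_index_enum.
- by move=> i; meas.
- by move=> i j ij; rewrite setIACA dF// setI0.
Qed.

Lemma le_pr_bigcup (I : finType) (p : pred I) (F : I -> set T) :
  (forall i, measurable (F i)) ->
  pr (\big[setU/set0]_(i | p i) F i) <= \sum_(i | p i) pr (F i).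
Proof.
move=> mF.
suff [] : measurable (\big[setU/set0]_(i | p i) F i) /\
  pr (\big[setU/set0]_(i | p i) F i) <= \sum_(i | p i) pr (F i) by [].
apply: (big_ind2 (fun A x => measurable A /\ pr A <= x)).
- by rewrite pr0.
- move=> A x B y [mA Ax] [mB By]; split; meas.
  by rewrite (le_trans (le_prU mA mB))// lerD.
- by [].
Qed.

Lemma pr_setYE A B : measurable A -> measurable B ->
  pr (A `+` B) = pr (A `\` B) + pr (B `\` A).
Proof. by move=> mA mB; rewrite prU//; meas; set_tauto. Qed.

Lemma measurableY A B : measurable A -> measurable B -> measurable (A `+` B).
Proof. by move=> mA mB; rewrite /setY; meas. Qed.

Lemma prY_triangle B A C : measurable A -> measurable B -> measurable C ->
  pr (A `+` C) <= pr (A `+` B) + pr (B `+` C).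
Proof.
move=> mA mB mC; apply: le_trans (le_prU _ _); try exact: measurableY.
by apply: le_pr; [exact: measurableY|meas; exact: measurableY|set_tauto].
Qed.

Lemma pr_dist A B : measurable A -> measurable B ->
  `|pr A - pr B| <= pr (A `+` B).
Proof.
move=> mA mB; rewrite pr_setYE// (prID mA mB) (prID mB mA) (setIC B A).
have := pr_ge0 (A `\` B); have := pr_ge0 (B `\` A).
by rewrite ler_norml; lra.
Qed.

Lemma prY_I A A' B B' :
  measurable A -> measurable A' -> measurable B -> measurable B' ->
  pr ((A `&` A') `+` (B `&` B')) <= pr (A `+` B) + pr (A' `+` B').
Proof.
move=> mA mA' mB mB'; apply: le_trans (le_prU _ _); try exact: measurableY.
by apply: le_pr; [rewrite /setY; meas..|set_tauto].
Qed.

Lemma prYC A B : pr (~` A `+` ~` B) = pr (A `+` B).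
Proof. by congr pr; set_tauto. Qed.

Lemma prY_setCr A B : measurable A -> measurable B ->
  pr (A `+` ~` B) = 1 - pr (A `+` B).
Proof.
by move=> mA mB; rewrite -prC; [congr pr; set_tauto|exact: measurableY].
Qed.

Lemma pr_cup_lim (F : (set T)^nat) (e : R) : 0 < e ->
  (forall n, measurable (F n)) -> nondecreasing_seq F ->
  exists n, pr (\bigcup_k F k) < pr (F n) + e.
Proof.
move=> e0 mF ndF; have mU : measurable (\bigcup_k F k) by exact: bigcupT_measurable.
have /fine_cvgP[_ /cvgrPdist_lt /(_ e e0)[N _ /(_ N (leqnn N))]] :
    P \o F @ \oo --> (pr (\bigcup_k F k))%:E.
  by rewrite -prE//; exact: nondecreasing_cvg_mu.
by move=> /= FN; exists N; move: FN; rewrite ltr_norml => /andP[_]; rewrite ltrBlDl.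
Qed.

End pr.

(** * Fair coins *)

Section fair_coins.
Variable R : realType.
Notation X := (coin_mtype R).
Implicit Types (s : seq bool) (u : R) (x : X) (A B : set X).

Lemma measurable_cyl s : measurable (cyl s : set X).
Proof. by rewrite coin_measurableE; apply: sub_sigma_algebra; exists s. Qed.

Lemma measurable_fun_coin d (T : measurableType d) (f : T -> X) :
  (forall n, measurable [set t | f t n]) -> measurable_fun setT f.
Proof.
move=> mf; apply: (@measurability _ _ T X setT f (range (@cyl R))); first exact: coin_measurableE.
move=> _ [_ [s _ <-] <-]; rewrite setTI.
have -> : f @^-1` cyl s =
    \bigcap_(i in `I_(size s)) [set t | f t i = nth false s i].
  apply/seteqP; split => t /=.
    by move=> /= E i iltn; rewrite -E nth_mkseq.
  move=> H; apply: (@eq_from_nth _ false); rewrite ?size_mkseq// => i iltn.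
  by rewrite nth_mkseq//; exact: H.
apply: fin_bigcap_measurable => // i _; case: (nth _ _ _); first exact: mf.
have -> : [set t | f t i = false] = ~` [set t | f t i].
  by apply/seteqP; split => t /=; case: (f t i).
exact: measurableC.
Qed.

Lemma measurable_coin n (b : bool) : measurable [set x : X | x n = b].
Proof.
suff H : measurable [set x : X | x n].
  case: b; first exact: H.
  have -> : [set x : X | x n = false] = ~` [set x : X | x n].
    by apply/seteqP; split => t /=; case: (t n).
  exact: measurableC.
have -> : [set x : X | x n] = \bigcup_(s in [set s | (n < size s)%N && nth false s n]) cyl s.
  apply/seteqP; split => x /=; last by move=> [s /andP[ns sn] E]; move: sn; rewrite -E nth_mkseq.
  by move=> xn; exists (mkseq x n.+1); [apply/andP; rewrite size_mkseq nth_mkseq|exact: cyl_mkseq].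
rewrite bigcup_mkcond; apply: countable_bigcupT_measurable => // s.
by case: ifP => _; [exact: measurable_cyl|exact: measurable0].
Qed.

Lemma coin_prob_unique (P Q : probability X R) : (forall s, P (cyl s) = Q (cyl s)) ->
  forall A, measurable A -> P A = Q A.
Proof.
(* Two cylinders are nested or disjoint; adding the empty set makes the family closed under
   intersection. *)
move=> PQ A mA; pose G : set (set X) := set0 |` range (@cyl R).
apply: (measure_unique G (fun=> cyl [::])) => //.
- rewrite coin_measurableE; apply/seteqP; split.
    apply: smallest_sub; first exact: smallest_sigma_algebra.
    by move=> B [s _ <-]; apply: sub_sigma_algebra; right; exists s.
  apply: smallest_sub; first exact: smallest_sigma_algebra.
  move=> B [->|[s _ <-]]; last by apply: sub_sigma_algebra; exists s.
  exact: (@measurable0 _ (g_sigma_algebraType (range (@cyl R)))).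
- suff W s t : (size s <= size t)%N -> G (cyl s `&` cyl t).
    move=> B C [->|[s _ <-]]; first by rewrite set0I; left.
    move=> [->|[t _ <-]]; first by rewrite setI0; left.
    by case/orP: (leq_total (size s) (size t)) => /W//; rewrite setIC.
  move=> st; have [E|NE] := eqVneq (take (size s) t) s.
    right; exists t => //; apply/seteqP; split => [x /= xt|x []//]; split => //.
    rewrite /cyl/= -[RHS]E -xt; apply: (@eq_from_nth _ false).
      by rewrite size_mkseq size_takel// size_mkseq.
    rewrite size_mkseq => i iltn.
    by rewrite nth_take// !nth_mkseq// (leq_trans iltn).
  left; apply/seteqP; split => // x [/= xs xt]; move/eqP: NE; apply.
  rewrite -[RHS]xs -xt; apply: (@eq_from_nth _ false).
    by rewrite size_mkseq size_takel// size_mkseq.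
  rewrite size_takel ?size_mkseq// => i iltn.
  by rewrite nth_take// !nth_mkseq// (leq_trans iltn).
- by move=> i; right; exists [::].
- by apply/seteqP; split => // x _; exists 0%N.
- by move=> B [->|[s _ <-]]; [rewrite !measure0|exact: PQ].
- by move=> _; rewrite (le_lt_trans (probability_le1 _ _)) ?ltry//; exact: measurable_cyl.
Qed.

(** The doubling map of the unit interval. Its itinerary through the two halves is the binary
    expansion, which makes the fair coin measure an image of Lebesgue measure and avoids infinite
    products. *)
Definition doubling u : R := if u < 2^-1 then 2 * u else 2 * u - 1.

Definition digits (u : measurableTypeR R) : X := fun n => ~~ (iter n doubling u < 2^-1).

Lemma measurable_doubling : measurable_fun setT doubling.
Proof.
apply: measurable_fun_if => //; first exact: measurable_fun_ltr.
by apply: measurable_funTS; apply: measurable_funB => //; exact: measurable_funM.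
Qed.

Lemma measurable_digits : measurable_fun setT digits.
Proof.
apply: measurable_fun_coin => n.
have -> : [set t | digits t n] = iter n doubling @^-1` `[2^-1, +oo[.
  by apply/seteqP; split => u /=; rewrite in_itv/= andbT /digits -leNgt.
rewrite -[X in measurable X]setTI; suff : measurable_fun setT (iter n doubling) by apply.
elim: n => [|n IH]; first exact: measurable_id.
by exact: (measurableT_comp measurable_doubling).
Qed.

HB.instance Definition _ := isMeasurableFun.Build _ _ _ _ digits measurable_digits.

Lemma digits_cons b s u :
  @cyl R (b :: s) (digits u) <->
  b = ~~ (u < 2^-1) /\ @cyl R s (digits (doubling u)).
Proof.
rewrite /cyl/= /mkseq/= (iotaDl 1 0) -map_comp; split.
  move=> [<- E]; split => //; rewrite -[RHS]E; apply: eq_map => i /=.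
  by rewrite /digits -iterSr.
move=> [-> E]; congr cons; rewrite -[RHS]E; apply: eq_map => i /=.
by rewrite /digits -iterSr.
Qed.

Lemma digits_cyl s : exists a : R, [/\ 0 <= a, a + 2^-1 ^+ size s <= 1 &
  digits @^-1` (cyl s) `&` `[0, 1[ = `[a, a + 2^-1 ^+ size s[%classic].
Proof.
elim: s => [|b s [a [a0 a1 E]]] /=.
  by exists 0; rewrite expr0 add0r; split => //; rewrite setIidr.
set h := 2^-1 ^+ size s in a1 E.
have h0 : 0 < h by rewrite exprn_gt0// invr_gt0.
have Ea u : 0 <= u < 1 -> @cyl R s (digits u) <-> a <= u < a + h.
  move=> u01; have := congr1 (@^~ u) E => /= /propeqP; rewrite !in_itv/= u01.
  by move=> <-; split => [//|[]].
(* The left end moves by the inverse branch of [doubling] on the half selected by [b], and the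
   length is halved. *)
rewrite exprS -/h; exists ((a + b%:R) / 2); split.
- by rewrite divr_ge0// addr_ge0.
- by case: b => /=; lra.
apply/seteqP; split => u /=; rewrite !in_itv/=.
  move=> [/digits_cons[-> us] u01]; move: us; rewrite /doubling.
  by case: ltP => hu /Ea => /(_ ltac:(lra)); rewrite /=; lra.
move=> uab; have u01 : 0 <= u < 1 by case: b uab => /=; lra.
split => //; apply/digits_cons; rewrite /doubling; case: b uab => /= uab; case: ltP => hu; split => //; try lra; apply/Ea; lra.
Qed.

Definition unit_prob : set (measurableTypeR R) -> \bar R :=
  mrestr (@lebesgue_measure R) (measurable_itv `[0%R, 1%R[).

HB.instance Definition _ := Measure.on unit_prob.

Lemma unit_probT : unit_prob setT = 1%E.
Proof.
by rewrite /unit_prob /mrestr setTI lebesgue_measure_itv/= lte_fin ltr01 oppr0 adde0.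
Qed.

HB.instance Definition _ := @Measure_isProbability.Build _ _ R unit_prob unit_probT.

Definition coin_prob : probability X R := distribution unit_prob digits.

Lemma coin_prob_cyl s : coin_prob (cyl s) = (2^-1 ^+ size s)%:E.
Proof.
rewrite /coin_prob/= /distribution/= /pushforward/= /unit_prob /mrestr.
have [a [_ _ ->]] := digits_cyl s; rewrite lebesgue_measure_itv/= lte_fin.
by rewrite ltrDl exprn_gt0 ?invr_gt0// -EFinD addrAC subrr add0r.
Qed.

End fair_coins.

(** * Flips and reindexings of the coins *)

Section coin_symmetries.
Variable R : realType.
Notation X := (coin_mtype R).
Notation P := (coin_prob R).
Implicit Types (s : seq bool) (x : X) (A D : set X).

Lemma coin_prob_preserving (f : X -> X) : measurable_fun setT f ->
  (forall s, pr P (f @^-1` (@cyl R s)) = 2^-1 ^+ size s) ->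
  forall A, measurable A -> P (f @^-1` A) = P A.
Proof.
move=> mf fcyl A mA.
have mfcyl s : measurable (f @^-1` (@cyl R s)).
  by rewrite -[X in measurable X]setTI; apply: mf => //; exact: measurable_cyl.
pose fM : {mfun X >-> X} := HB.pack f (isMeasurableFun.Build _ _ _ _ f mf).
have -> : P (f @^-1` A) = (distribution P fM : probability _ _) A by [].
apply: coin_prob_unique => // s; rewrite coin_prob_cyl -fcyl -[RHS]prE//; exact: mfcyl.
Qed.

Definition flip (i : nat) x : X := fun n => if n == i then ~~ x n else x n.

Lemma flip_id i n x : n != i -> flip i x n = x n.
Proof. by rewrite /flip => /negbTE ->. Qed.

Lemma flip_neg i x : flip i x i = ~~ x i.
Proof. by rewrite /flip eqxx. Qed.

Lemma measurable_flip i : measurable_fun setT (flip i).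
Proof.
apply: measurable_fun_coin => n; rewrite /flip; have [->|ni] := eqVneq n i.
- have -> : [set t : X | ~~ t i] = [set t : X | t i = false].
    by apply/seteqP; split => t /=; case: (t i).
  exact: measurable_coin.
- exact: (measurable_coin n true).
Qed.

Lemma cylP s x : @cyl R s x <-> forall i, (i < size s)%N -> x i = nth false s i.
Proof.
rewrite /cyl/=; split=> [E i iltn|H]; first by rewrite -E nth_mkseq.
apply: (@eq_from_nth _ false); rewrite ?size_mkseq// => i iltn.
by rewrite nth_mkseq// H.
Qed.

Lemma coin_flip i A : measurable A -> P (flip i @^-1` A) = P A.
Proof.
apply: coin_prob_preserving => [|s]; first exact: measurable_flip.
have -> : flip i @^-1` (@cyl R s) =
    @cyl R (mkseq (fun n => if n == i then ~~ nth false s n else nth false s n) (size s)).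
  apply/seteqP; split => x /cylP H; apply/cylP; rewrite ?size_mkseq in H *;
    move=> n ns; have := H n ns; rewrite nth_mkseq// /flip; case: eqP => // _.
    by move=> <-; rewrite negbK.
  by move=> ->; rewrite negbK.
by rewrite /pr coin_prob_cyl size_mkseq.
Qed.

(** The flip preserves the measure and exchanges the two parts into which [D] cuts [A]. This is the
    form in which independence is used. *)
Lemma coin_half i A D : measurable A -> measurable D ->
  flip i @^-1` A = A -> flip i @^-1` D = ~` D -> pr P (A `&` D) = pr P A / 2.
Proof.
move=> mA mD fA fD; have := prID P mA mD.
have -> : pr P (A `\` D) = pr P (A `&` D).
  by rewrite setDE -fD -{1}fA -preimage_setI /pr coin_flip//; meas.
by move=> ->; lra.
Qed.

Lemma flip_coin i n (b : bool) :
  flip i @^-1` [set x : X | x n = b] =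
  if n == i then ~` [set x : X | x n = b] else [set x : X | x n = b].
Proof.
have [->|ni] := eqVneq n i; apply/seteqP; split => x /=.
- by rewrite flip_neg => <-; case: (x i).
- by rewrite flip_neg; case: (x i) b => -[].
- by rewrite flip_id.
- by rewrite flip_id.
Qed.

Lemma coin_cylinder (L : seq nat) s : uniq L -> size L = size s ->
  measurable [set x : X | map x L = s] /\
  pr P [set x : X | map x L = s] = 2^-1 ^+ size s.
Proof.
elim: L s => [|i L IH] [|b s]//= => [_ _|/andP[iL uL] [/IH[]// mE pE]].
  by rewrite (_ : [set _ | _] = setT) ?prT//; apply/seteqP.
have E : [set x : X | x i :: map x L = b :: s] =
    [set x : X | map x L = s] `&` [set x : X | x i = b].
  by apply/seteqP; split => x /= [-> ->].
rewrite E; split; first by apply: measurableI => //; exact: measurable_coin.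
rewrite (@coin_half i) ?flip_coin ?eqxx//.
- by rewrite pE exprS mulrC.
- exact: measurable_coin.
apply/seteqP; split => x /= <-; [apply/esym|]; apply/eq_in_map => j jL; rewrite flip_id//;
  by apply: contraNneq iL => <-.
Qed.

Lemma coin_reindex (p : nat -> nat) A : injective p -> measurable A ->
  P ((fun x : X => (fun n => x (p n)) : X) @^-1` A) = P A.
Proof.
move=> injp; apply: coin_prob_preserving => [|s].
  by apply: measurable_fun_coin => n; exact: (measurable_coin (p n) true).
have -> : (fun x : X => (fun n => x (p n)) : X) @^-1` (@cyl R s) =
    [set x : X | map x (map p (iota 0 (size s))) = s].
  by apply/seteqP; split => x; rewrite /cyl/= -map_comp.
by apply: (coin_cylinder _ _).2; rewrite ?size_map ?size_iota// map_inj_uniq// iota_uniq.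
Qed.

Lemma measurable_coin_eq n m : measurable [set x : X | x n = x m].
Proof.
have -> : [set x : X | x n = x m] =
    ([set x : X | x n = true] `&` [set x : X | x m = true]) `|`
    ([set x : X | x n = false] `&` [set x : X | x m = false]).
  by apply/seteqP; split => x /=; case: (x n); case: (x m) => //=; intuition discriminate.
by apply: measurableU; apply: measurableI; exact: measurable_coin.
Qed.

(* Each of infinitely many moved points imposes an independent condition of
   probability 1/2. *)
Lemma coin_fixed_negligible (p : nat -> nat) :
  (forall V : seq nat, exists2 i, i \notin V & p i != i) ->
  P.-negligible [set x : X | forall n, x (p n) = x n].
Proof.
move=> pmoves; pose E (V : seq nat) := [set x : X | forall i, i \in V -> x (p i) = x i].
have mE V : measurable (E V).
  have -> : E V = \bigcap_(i in [set` V]) [set x : X | x (p i) = x i] by [].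
  by apply: fin_bigcap_measurable => // i _; exact: measurable_coin_eq.
have EV n : exists V, pr P (E V) = 2^-1 ^+ n.
  elim: n => [|n [V VE]].
    by exists [::]; rewrite (_ : E _ = setT) ?prT//; apply/seteqP.
  (* The conditions indexed by [V] read only coordinates in [V] and [p V], so flipping a coordinate
     [i] outside both leaves them alone, while it reverses the condition at [i] because [p i]
     differs from [i]. *)
  have [i iV pi] := pmoves (V ++ map p V); rewrite mem_cat negb_or in iV.
  have /andP[iV1 iV2] := iV.
  exists (i :: V); have -> : E (i :: V) = E V `&` [set x : X | x (p i) = x i].
    apply/seteqP; split => x /=.
      by move=> H; split => [j jV|]; apply: H; rewrite inE ?jV ?orbT ?eqxx.
    by move=> [H1 H2] j; rewrite inE => /orP[/eqP->//|/H1].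
  rewrite (@coin_half i)//.
  - by rewrite VE exprS mulrC.
  - exact: measurable_coin_eq.
  - apply/seteqP; split => x /= H j jV; have := H j jV; rewrite !flip_id//;
      try by [apply: contraNneq iV1 => <-|apply: contraNneq iV2 => <-; exact: map_f].
  - apply/seteqP; split => x /=; rewrite flip_neg flip_id//;
      by case: (x _) (x _) => -[].
pose F := \bigcap_n E (iota 0 n).
have mF : measurable F by apply: bigcapT_measurable.
exists F; split => //; last by move=> x /= H n _ i _; exact: H.
have FE V : F `<=` E V.
  move=> x Fx i iV; apply: (Fx i.+1) => //; by rewrite mem_iota/= add0n.
rewrite prE//; congr EFin; apply/eqP; rewrite eq_le pr_ge0 andbT.
apply/ler_addgt0Pl => e e0; rewrite addr0.
have /cvgrPdist_lt /(_ e e0)[N _ /(_ N (leqnn N))] :=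
    @cvg_expr R (2^-1) ltac:(by rewrite ger0_norm ?invr_ge0// invf_lt1// ltr1n).
rewrite sub0r normrN ger0_norm ?exprn_ge0 ?invr_ge0// => /ltW; apply: le_trans.
by have [V <-] := EV N; exact: le_pr.
Qed.

End coin_symmetries.

(** * Integrals of bounded functions *)

Section bounded_integrals.
Context d (T : measurableType d) (R : realType) (P : probability T R).
Implicit Types (f g : T -> R) (A : set T).

(** Bounded measurable functions: integrable for a probability and closed under products and sums,
    so linearity of [I_] needs no further side condition. *)
Definition bm f := measurable_fun setT f /\ exists M, forall x, `|f x| <= M.

Lemma bm_cst (c : R) : bm (fun=> c).
Proof. by split => //; exists `|c|. Qed.

Lemma bmD f g : bm f -> bm g -> bm (fun x => f x + g x).
Proof.
move=> [mf [M fM]] [mg [N gN]]; split; first exact: measurable_funD.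
by exists (M + N) => x; rewrite (le_trans (ler_normD _ _))// lerD.
Qed.

Lemma bmM f g : bm f -> bm g -> bm (fun x => f x * g x).
Proof.
move=> [mf [M fM]] [mg [N gN]]; split; first exact: measurable_funM.
by exists (M * N) => x; rewrite normrM ler_pM.
Qed.

Lemma bmB f g : bm f -> bm g -> bm (fun x => f x - g x).
Proof.
move=> [mf [M fM]] [mg [N gN]]; split; first exact: measurable_funB.
by exists (M + N) => x; rewrite (le_trans (ler_normB _ _))// lerD.
Qed.

Lemma bm_sum (I : Type) (s : seq I) (F : I -> T -> R) :
  (forall i, bm (F i)) -> bm (fun x => \sum_(i <- s) F i x).
Proof.
move=> bF; elim: s => [|i s IH].
  by under eq_fun do rewrite big_nil; exact: bm_cst.
by under eq_fun do rewrite big_cons; exact: bmD.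
Qed.

Lemma bm_indic A : measurable A -> bm (\1_A : T -> R).
Proof.
move=> mA; split; first exact: measurable_indic.
by exists 1 => x; rewrite indicE; case: (_ \in _); rewrite ?normr1 ?normr0.
Qed.

Lemma bm_comp f (th : T -> T) : measurable_fun setT th -> bm f -> bm (f \o th).
Proof.
move=> mth [mf [M fM]]; split; first exact: measurableT_comp.
by exists M => x; exact: fM.
Qed.

Definition I_ f : R := \int[P]_x f x.

Lemma bm_integrable f : bm f -> P.-integrable setT (EFin \o f).
Proof.
move=> [mf [M fM]]; apply: measurable_bounded_integrable => //.
  by rewrite /= probability_setT ltry.
by exists M; split; [exact: num_real|move=> N MN x _ /=; exact: le_trans (fM x) (ltW MN)].
Qed.

Lemma I_D f g : bm f -> bm g -> I_ (fun x => f x + g x) = I_ f + I_ g.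
Proof. by move=> bf bg; rewrite /I_ RintegralD//; exact: bm_integrable. Qed.

Lemma I_B f g : bm f -> bm g -> I_ (fun x => f x - g x) = I_ f - I_ g.
Proof. by move=> bf bg; rewrite /I_ RintegralB//; exact: bm_integrable. Qed.

Lemma I_Z c f : bm f -> I_ (fun x => c * f x) = c * I_ f.
Proof. by move=> bf; rewrite /I_ RintegralZl//; exact: bm_integrable. Qed.

Lemma I_cst c : I_ (fun=> c) = c.
Proof. by rewrite /I_ Rintegral_cst// -[fine _]/(pr P setT) prT mulr1. Qed.

Lemma I_le f g : bm f -> bm g -> (forall x, f x <= g x) -> I_ f <= I_ g.
Proof. by move=> bf bg fg; apply: le_Rintegral => //; exact: bm_integrable. Qed.

Lemma I_ge0 f : (forall x, 0 <= f x) -> 0 <= I_ f.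
Proof. by move=> f0; apply: Rintegral_ge0. Qed.

Lemma I_sum (I : Type) (s : seq I) (F : I -> T -> R) : (forall i, bm (F i)) ->
  I_ (fun x => \sum_(i <- s) F i x) = \sum_(i <- s) I_ (F i).
Proof.
move=> bF; elim: s => [|i s IH].
  by under eq_fun do rewrite big_nil; rewrite I_cst big_nil.
under eq_fun do rewrite big_cons; rewrite I_D ?IH ?big_cons//.
exact: bm_sum.
Qed.

Lemma I_indic A : measurable A -> I_ \1_A = pr P A.
Proof. by move=> mA; rewrite /I_ /Rintegral integral_indic// setIT. Qed.

Lemma I_comp f (th : T -> T) : measurable_fun setT th ->
  (forall A, measurable A -> P (th @^-1` A) = P A) -> bm f ->
  I_ (f \o th) = I_ f.
Proof.
move=> mth pth bf; rewrite /I_ /Rintegral; congr fine.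
have bm_int := bm_integrable (bm_comp mth bf).
rewrite -(@integral_pushforward _ _ _ _ _ th mth P setT (EFin \o f))//.
  by apply: eq_measure_integral => A mA _; exact: pth.
by apply/measurable_EFinP; case: bf.
Qed.

Lemma I_indicB A B : measurable A -> measurable B ->
  I_ (fun x => (\1_A x - \1_B x) ^+ 2) = pr P (A `+` B).
Proof.
move=> mA mB; rewrite -I_indic; last exact: measurableY.
congr I_; apply/funext => x; rewrite !indicE.
rewrite /setY in_setU !in_setD.
by case: (x \in A); case: (x \in B) => /=; ring.
Qed.

End bounded_integrals.

(** * Walsh polynomials *)

Lemma sum_widen (I : eqType) (V : nmodType) (L M : seq I) (F : I -> V) :
  uniq L -> uniq M -> {subset L <= M} -> (forall i, i \notin L -> F i = 0) ->
  \sum_(i <- L) F i = \sum_(i <- M) F i.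
Proof.
move=> uL uM LM F0; rewrite [RHS](bigID (mem L) predT)/=.
rewrite [X in _ = _ + X]big1 ?addr0 => [|S SL]; last exact: F0.
rewrite -[RHS]big_filter; apply: perm_big; apply: uniq_perm => //; first exact: filter_uniq.
by move=> S; rewrite mem_filter; case: (boolP (S \in L)) => //= /LM ->.
Qed.

Section walsh.
Variable R : realType.
Notation X := (coin_mtype R).
Notation P := (coin_prob R).
Implicit Types (s t : seq nat) (S : {fset nat}) (x : X) (A B : set X) (f h : X -> R).

(** Walsh function. Lists rather than finite sets make products into concatenations; [chi_reduce]
    cancels repetitions afterwards. *)
Definition chi s x : R := \prod_(i <- s) (-1) ^+ (x i).

Lemma chi_cons i s x : chi (i :: s) x = (-1) ^+ (x i) * chi s x.
Proof. by rewrite /chi big_cons. Qed.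

Lemma chi_cat s t x : chi (s ++ t) x = chi s x * chi t x.
Proof. by rewrite /chi big_cat. Qed.

Lemma chi_sqr s x : chi s x * chi s x = 1.
Proof.
elim: s => [|i s IH]; first by rewrite /chi big_nil mul1r.
by rewrite chi_cons mulrACA IH mulr1 -signr_addb addbb.
Qed.

Lemma bm_chi s : bm (chi s).
Proof.
elim: s => [|i s IH].
  by rewrite (_ : chi _ = fun=> 1); [exact: bm_cst|apply/funext => x; rewrite /chi big_nil].
rewrite (_ : chi _ = fun x => (1 - 2 * \1_[set x : X | x i = true] x) * chi s x).
  apply: bmM => //; apply: bmB; first exact: bm_cst.
  apply: bmM; first exact: bm_cst.
  apply: bm_indic; exact: measurable_coin.
apply/funext => x; rewrite chi_cons indicE; congr (_ * _).
case: (boolP (x \in _)); rewrite ?notin_setE ?inE/=.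
  by move=> ->; rewrite expr1; ring.
by case: (x i) => // _; rewrite expr0; ring.
Qed.

Lemma chi_flip_id i s x : i \notin s -> chi s (flip i x) = chi s x.
Proof.
move=> iS; rewrite /chi !big_seq; apply: eq_bigr => j js.
by rewrite flip_id//; apply: contraNneq iS => <-.
Qed.

Lemma chi_flip i s x : uniq s -> i \in s -> chi s (flip i x) = - chi s x.
Proof.
elim: s => // j s IH /= /andP[js us]; rewrite inE !chi_cons => /orP[/eqP ij|si].
  rewrite ij flip_neg chi_flip_id// -mulNr.
  by case: (x j); rewrite /= ?expr0 ?expr1 ?opprK.
rewrite IH// flip_id ?mulrN//; by apply: contraNneq js => ->.
Qed.

Lemma I_flip i f : bm f -> I_ P (fun x => f (flip i x)) = I_ P f.
Proof.
move=> bf; apply: (@I_comp _ _ _ P f (@flip R i)) => //.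
  exact: measurable_flip.
by move=> A mA; exact: coin_flip.
Qed.

(** Flipping a coordinate that lies in exactly one of the two sets negates the product and preserves
    the integral. *)
Lemma I_chi S (T : {fset nat}) : I_ P (fun x => chi S x * chi T x) = (S == T)%:R.
Proof.
have [->|ST] := eqVneq S T.
  by under eq_fun do rewrite chi_sqr; rewrite I_cst.
have : exists i, (i \in S) (+) (i \in T).
  apply: contrapT => H; move/eqP: ST; apply; apply/fsetP => i.
  by case iS: (i \in S); case iT: (i \in T) => //;
    exfalso; apply: H; exists i; rewrite iS iT.
move=> [i iST]; have bST : bm (fun x => chi S x * chi T x) by apply: bmM; exact: bm_chi.
have := I_flip i bST.
rewrite (_ : (fun x => _) = (fun x => (-1) * (chi S x * chi T x))).
  by rewrite I_Z// => /eqP; rewrite mulN1r eqNr => /eqP.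
apply/funext => x; move: iST; case: (boolP (i \in S)) => iS /=; last move=> iT.
  by move=> iT; rewrite chi_flip ?fset_uniq// chi_flip_id//; ring.
by rewrite chi_flip_id// chi_flip ?fset_uniq//; ring.
Qed.

Lemma chi_reduce s : exists S, forall x, chi s x = chi S x.
Proof.
elim: s => [|i s [S HS]]; first by exists fset0.
have [iS|iS] := boolP (i \in S).
  exists (S `\ i)%fset => x; rewrite chi_cons HS /chi (big_fsetD1 i iS)/= mulrA.
  by rewrite -signr_addb addbb mul1r.
by exists (i |` S)%fset => x; rewrite chi_cons HS /chi big_fsetU1.
Qed.

(** The Walsh-Fourier coefficient of [f] at [S]. *)
Definition hat f S : R := I_ P (fun x => f x * chi S x).

Definition wexp (L : seq {fset nat}) f := forall x, f x = \sum_(S <- L) hat f S * chi S x.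

Definition trigpoly f := exists l : seq (R * seq nat),
  forall x, f x = \sum_(p <- l) p.1 * chi p.2 x.

Lemma trigpoly_cst c : trigpoly (fun=> c).
Proof. by exists [:: (c, [::])] => x; rewrite big_seq1 /chi big_nil mulr1. Qed.

Lemma trigpolyM f h : trigpoly f -> trigpoly h -> trigpoly (fun x => f x * h x).
Proof.
move=> [l fl] [k hk]; exists [seq (p.1 * q.1, p.2 ++ q.2) | p <- l, q <- k] => x.
rewrite fl hk big_allpairs_dep mulr_suml; apply: eq_bigr => p _.
by rewrite mulr_sumr; apply: eq_bigr => q _ /=; rewrite chi_cat mulrACA.
Qed.

Lemma trigpolyB f h : trigpoly f -> trigpoly h -> trigpoly (fun x => f x - h x).
Proof.
move=> [l fl] [k hk]; exists (l ++ [seq (- q.1, q.2) | q <- k]) => x.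
rewrite fl hk big_cat big_map/=; congr (_ + _).
by rewrite -sumrN; apply: eq_bigr => q _; rewrite mulNr.
Qed.

Lemma trigpoly_coin i b : trigpoly (\1_[set x : X | x i = b]).
Proof.
exists [:: (2^-1, [::]); ((-1) ^+ b / 2, [:: i])] => x.
rewrite big_cons big_seq1 /chi/= big_nil big_seq1 indicE.
case: (boolP (x \in _)); rewrite ?notin_setE ?inE/=.
  by move=> ->; rewrite mulrAC -signr_addb addbb expr0; lra.
move=> xb; have -> : x i = ~~ b by move: xb; case: (x i) b => -[].
by rewrite mulrAC -signr_addb; case: b {xb}; rewrite /= expr1; lra.
Qed.

Lemma trigpoly_hat f : trigpoly f -> exists2 L, uniq L & wexp L f.
Proof.
move=> [l fl].
have [l' fl'] : exists l' : seq (R * {fset nat}), forall x, f x = \sum_(p <- l') p.1 * chi p.2 x.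
  elim: l f fl => [|[c s] l IH] f fl.
    by exists [::] => x; rewrite fl !big_nil.
  have [l' H] := IH _ (fun x => erefl); have [S sS] := chi_reduce s.
  by exists ((c, S) :: l') => x; rewrite fl !big_cons H sS.
have hatE S : hat f S = \sum_(p <- l') p.1 * (p.2 == S)%:R.
  rewrite /hat; under eq_fun do rewrite fl' mulr_suml.
  rewrite I_sum => [|p]; last by apply: bmM; [apply: bmM; [exact: bm_cst|]|]; exact: bm_chi.
  apply: eq_bigr => p _; under eq_fun do rewrite -mulrA.
  by rewrite I_Z ?I_chi//; apply: bmM; exact: bm_chi.
exists (undup (map snd l')); first exact: undup_uniq.
move=> x; under eq_bigr do rewrite hatE mulr_suml.
rewrite exchange_big/= fl' !big_seq; apply: eq_bigr => p pl.
rewrite (bigD1_seq p.2) ?undup_uniq//= ?mem_undup ?map_f// eqxx mulr1.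
rewrite big1_seq ?addr0// => S /andP[Sp _].
by rewrite eq_sym (negbTE Sp) mulr0 mul0r.
Qed.

Lemma I_wsum (L : seq {fset nat}) (c : {fset nat} -> R) h : bm h ->
  I_ P (fun x => (\sum_(S <- L) c S * chi S x) * h x) = \sum_(S <- L) c S * hat h S.
Proof.
move=> bh; under eq_fun do rewrite mulr_suml.
rewrite I_sum; last by move=> S; do 2! [apply: bmM => //]; [exact: bm_cst|exact: bm_chi].
apply: eq_bigr => S _; under eq_fun do rewrite -mulrA.
by rewrite I_Z; [congr (_ * I_ _ _); apply/funext => x; rewrite mulrC|apply: bmM => //; exact: bm_chi].
Qed.

Lemma I_wexp L f h : wexp L f -> bm h ->
  I_ P (fun x => f x * h x) = \sum_(S <- L) hat f S * hat h S.
Proof. by move=> fL bh; under eq_fun do rewrite fL; exact: I_wsum. Qed.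

Lemma hat_wsum (L : seq {fset nat}) (c : {fset nat} -> R) S : uniq L ->
  hat (fun x => \sum_(T <- L) c T * chi T x) S = if S \in L then c S else 0.
Proof.
move=> uL; rewrite /hat I_wsum; last exact: bm_chi.
rewrite (eq_bigr (fun T => c T * (S == T)%:R)) => [|T _]; last by rewrite /hat I_chi.
case: ifPn => SL; last first.
  by rewrite big1_seq// => T /andP[_ TL]; case: eqVneq => [ST|_]; [rewrite ST TL in SL|rewrite mulr0].
rewrite (bigD1_seq S)//= eqxx mulr1 big1 ?addr0// => T.
by rewrite eq_sym => /negbTE ->; rewrite mulr0.
Qed.

Lemma hat_out L f S : uniq L -> wexp L f -> S \notin L -> hat f S = 0.
Proof.
move=> uL fL SL; have := hat_wsum (hat f) S uL; rewrite (negbTE SL) => <-.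
by congr (hat _ S); exact/funext.
Qed.

Lemma wexp_sub L M f : uniq L -> uniq M -> {subset L <= M} -> wexp L f -> wexp M f.
Proof.
move=> uL uM LM fL x; rewrite fL; apply: sum_widen => // S SL.
by rewrite (hat_out uL fL SL) mul0r.
Qed.

Lemma parseval (L : seq {fset nat}) (c : {fset nat} -> R) : uniq L ->
  I_ P (fun x => (\sum_(S <- L) c S * chi S x) ^+ 2) = \sum_(S <- L) c S ^+ 2.
Proof.
move=> uL; under eq_fun do rewrite expr2; rewrite I_wsum; last first.
  by apply: bm_sum => S; apply: bmM; [exact: bm_cst|exact: bm_chi].
by rewrite !big_seq; apply: eq_bigr => S SL; rewrite hat_wsum// SL expr2.
Qed.

(** Expand the integral of the square of [h - q], which is nonnegative, where [q] is the partial
    Walsh sum of [h]. *)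
Lemma bessel (L : seq {fset nat}) h : uniq L -> bm h ->
  \sum_(S <- L) hat h S ^+ 2 <= I_ P (fun x => h x ^+ 2).
Proof.
move=> uL bh; pose q x := \sum_(S <- L) hat h S * chi S x.
have bq : bm q by apply: bm_sum => S; apply: bmM; [exact: bm_cst|exact: bm_chi].
have : 0 <= I_ P (fun x => (h x - q x) ^+ 2) by apply: I_ge0 => x; exact: sqr_ge0.
have -> : I_ P (fun x => (h x - q x) ^+ 2) =
    I_ P (fun x => h x ^+ 2) - 2 * I_ P (fun x => q x * h x) + I_ P (fun x => q x ^+ 2).
  rewrite -I_Z -?I_B -?I_D; do ?[apply: bmB|apply: bmM|exact: bm_cst|assumption];
    do 1? [congr (I_ P); apply/funext => x; ring].
rewrite parseval// /q I_wsum//; under [X in _ - _ * X]eq_bigr do rewrite -expr2.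
lra.
Qed.

End walsh.

(** * Approximation of measurable sets by Walsh polynomials *)

Section approximation.
Variable R : realType.
Notation X := (coin_mtype R).
Notation P := (coin_prob R).
Implicit Types A B : set X.

Definition walsh_set B := measurable B /\ trigpoly (\1_B : X -> R).

Lemma walsh_setC B : walsh_set B -> walsh_set (~` B).
Proof.
move=> [mB tB]; split; first exact: measurableC.
rewrite (_ : \1_(~` B) = fun x => 1 - \1_B x); first exact: trigpolyB (trigpoly_cst _) tB.
by apply/funext => x; rewrite !indicE in_setC; case: (_ \in _); rewrite /= ?subrr ?subr0.
Qed.

Lemma walsh_setI A B : walsh_set A -> walsh_set B -> walsh_set (A `&` B).
Proof.
move=> [mA tA] [mB tB]; split; first exact: measurableI.
rewrite (_ : \1_(A `&` B) = fun x => \1_A x * \1_B x); first exact: trigpolyM.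
by apply/funext => x; rewrite !indicE in_setI; case: (_ \in _); rewrite /= ?mul1r ?mul0r.
Qed.

Lemma walsh_setT : walsh_set setT.
Proof. by split => //; rewrite indicT; exact: trigpoly_cst. Qed.

Lemma walsh_set_coin i b : walsh_set [set x : X | x i = b].
Proof. by split; [exact: measurable_coin|exact: trigpoly_coin]. Qed.

Lemma walsh_set_cyl s : walsh_set (@cyl R s).
Proof.
have -> : @cyl R s = \big[setI/setT]_(i < size s) [set x : X | x i = nth false s i].
  apply/seteqP; split => x.
    move=> /(cylP s x) H; rewrite -bigcap_seq => i /= _; exact: H.
  rewrite -bigcap_seq => H; apply/(cylP s x) => i iltn.
  exact: (H (Ordinal iltn) (mem_index_enum _)).
by apply: big_ind => [|? ?|i _]; [exact: walsh_setT|exact: walsh_setI|exact: walsh_set_coin].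
Qed.

Definition walsh_approx A := measurable A /\
  forall e : R, 0 < e -> exists2 B, walsh_set B & pr P (A `+` B) < e.

Lemma walsh_approxS B : walsh_set B -> walsh_approx B.
Proof. by move=> wB; split; [case: wB|move=> e e0; exists B; rewrite // setYK pr0]. Qed.

Lemma walsh_approxC A : walsh_approx A -> walsh_approx (~` A).
Proof.
move=> [mA H]; split; first exact: measurableC.
move=> e e0; have [B wB AB] := H e e0; exists (~` B); first exact: walsh_setC.
by rewrite prYC.
Qed.

Lemma walsh_approxI A B : walsh_approx A -> walsh_approx B -> walsh_approx (A `&` B).
Proof.
move=> [mA HA] [mB HB]; split; first exact: measurableI.
move=> e e0; have e20 : 0 < e / 2 by lra.
have [A' wA AA'] := HA (e / 2) e20.
have [B' wB BB'] := HB (e / 2) e20.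
exists (A' `&` B'); first exact: walsh_setI.
apply: le_lt_trans (prY_I _ _ _ _ _) _ => //; [exact: wA.1|exact: wB.1|lra].
Qed.

Lemma walsh_approxU A B : walsh_approx A -> walsh_approx B -> walsh_approx (A `|` B).
Proof.
move=> wA wB; rewrite -(setCK (A `|` B)) setCU; apply: walsh_approxC.
by apply: walsh_approxI; exact: walsh_approxC.
Qed.

(** The approximable sets contain the cylinders and form a sigma-algebra: continuity of the measure
    replaces a countable union by a finite one at a cost of [e / 2]. *)
Lemma measurable_walsh_approx A : measurable A -> walsh_approx A.
Proof.
rewrite coin_measurableE; move: A; apply: smallest_sub; last first.
  by move=> _ [s _ <-]; apply/walsh_approxS/walsh_set_cyl.
have w0 : walsh_approx set0 by rewrite -setCT; apply/walsh_approxC/walsh_approxS/walsh_setT.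
split => // [A wA|F0 wF0]; first by rewrite setTD; exact: walsh_approxC.
pose F : nat -> set X := F0; have wF n : walsh_approx (F n) by exact: wF0.
rewrite -/F.
have mF n : measurable (F n) by case: (wF n).
split; first exact: bigcupT_measurable.
move=> e e0; have e20 : 0 < e / 2 by lra.
pose U n := \big[setU/set0]_(i < n) F i.
have wU n : walsh_approx (U n) by rewrite /U; elim/big_ind: _ => // ? ?; exact: walsh_approxU.
have UF : \bigcup_n U n = \bigcup_n F n.
  apply/seteqP; split => x [n _]; [exact: bigsetU_bigcup|].
  by move=> Fx; exists n.+1 => //; rewrite /U big_ord_recr/=; right.
have ndU : nondecreasing_seq U by move=> m n mn; apply/subsetPset/subset_bigsetU.
have [n Un] := @pr_cup_lim _ _ _ P U (e / 2) e20 (fun n => (wU n).1) ndU.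
have [B wB BU] := (wU n).2 (e / 2) e20.
exists B => //; have mU := (wU n).1; have mB := wB.1.
have mUU : measurable (\bigcup_n F n) by exact: bigcupT_measurable.
apply: le_lt_trans (@prY_triangle _ _ _ P (U n) _ _ _ _ _) _ => //.
have UsF : U n `<=` \bigcup_n F n by rewrite -UF; exact: bigcup_sup.
rewrite UF in Un; rewrite pr_setYE// (_ : U n `\` _ = set0) ?pr0 ?addr0; last by apply/seteqP; split => x // [/UsF].
have := prID P mUU mU; rewrite (setIidr UsF); lra.
Qed.

End approximation.

(** * Actions permuting the coordinates *)

Section coordinate_actions.
Context (R : realType) (G : groupType) (pi : G -> nat -> nat).
Hypothesis pi1 : forall n, pi 1%g n = n.
Hypothesis piM : forall g h n, pi (g * h)%g n = pi g (pi h n).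
Notation X := (coin_mtype R).
Notation P := (coin_prob R).

Lemma piK g : cancel (pi g) (pi g^-1).
Proof. by move=> n; rewrite -piM mulVg pi1. Qed.

Lemma piKV g : cancel (pi g^-1) (pi g).
Proof. by move=> n; rewrite -piM mulgV pi1. Qed.

Definition coin_act (g : G) (x : X) : X := fun n => x (pi g^-1 n).

Lemma coin_act1 x : coin_act 1%g x = x.
Proof. by apply/funext => n; rewrite /coin_act invg1 pi1. Qed.

Lemma coin_actM g h x : coin_act (g * h)%g x = coin_act g (coin_act h x).
Proof. by apply/funext => n; rewrite /coin_act invgM piM. Qed.

Lemma measurable_coin_act g : measurable_fun setT (coin_act g).
Proof. by apply: measurable_fun_coin => n; exact: (measurable_coin _ true). Qed.

Lemma coin_act_preserving g A : measurable A -> P (coin_act g @^-1` A) = P A.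
Proof. by apply: coin_reindex; exact: can_inj (piKV g). Qed.

Definition coin_action : mp_action R G := MPAction (coin_standard_borel R)
  coin_act1 coin_actM measurable_coin_act coin_act_preserving.

Definition shift_fset (g : G) (S : {fset nat}) : {fset nat} := [fset pi g n | n in S]%fset.

Lemma chi_act g (S : {fset nat}) x : chi S (coin_act g x) = chi (shift_fset g^-1 S) x.
Proof. by rewrite /chi big_imfset//= => i j _ _; exact: can_inj (piK _) i j. Qed.

Lemma shift_fsetK g : cancel (shift_fset g) (shift_fset g^-1).
Proof.
move=> S; apply/fsetP => n; apply/imfsetP/idP => /= [[m /imfsetP[k kS ->] ->]|nS].
  by rewrite piK.
by exists (pi g n); rewrite ?piK//; apply/imfsetP; exists n.
Qed.

Lemma hat_act f g S : bm f -> hat (f \o coin_act g) S = hat f (shift_fset g S).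
Proof.
move=> bf; rewrite /hat -(@I_comp _ _ _ P (fun x => f x * chi (shift_fset g S) x) (coin_act g)).
- by congr (I_ P); apply/funext => x /=; rewrite chi_act shift_fsetK.
- exact: measurable_coin_act.
- exact: coin_act_preserving.
- by apply: bmM => //; exact: bm_chi.
Qed.

End coordinate_actions.

Section coordinate_actions_free_ergodic.
Context (R : realType) (G : groupType) (pi : G -> nat -> nat).
Hypothesis pi1 : forall n, pi 1%g n = n.
Hypothesis piM : forall g h n, pi (g * h)%g n = pi g (pi h n).
Notation X := (coin_mtype R).
Notation P := (coin_prob R).

Lemma coin_action_free (e : nat -> G) : (forall g, exists n, e n = g) ->
  (forall g, g != 1%g -> forall V : seq nat, exists2 i, i \notin V & pi g i != i) ->
  free_action (coin_action R pi1 piM).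
Proof.
move=> esurj moves; rewrite /free_action.
pose N n : set X := if e n == 1%g then set0 else [set x | forall i, x (pi (e n)^-1 i) = x i].
have NN n : P.-negligible (N n).
  rewrite /N; case: eqP => [_|/eqP en1]; first exact: negligible_set0.
  by apply: coin_fixed_negligible; apply: moves; rewrite invg_eq1.
apply: negligibleS (negligible_bigcup NN) => x /= /existsNP[g].
move=> /not_implyP[gx /eqP g1]; have [n eng] := esurj g; exists n => //.
by rewrite /N eng (negbTE g1) => i; rewrite -[in RHS]gx.
Qed.

(** A mixing argument. An approximation [B] of [A] that depends on finitely many coordinates is
    independent of a suitable translate of itself, so an invariant [A] has measure equal to its
    square. *)
Lemma coin_action_ergodic :
  (forall V : seq nat, exists g, forall n, n \in V -> pi g n \notin V) ->
  ergodic (coin_action R pi1 piM).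
Proof.
move=> disj A mA invA.
(* Replacing [A] by [B] costs [2 * e] in the intersection with the translate and [2 * e] in the
   square. *)
have key (e : R) : 0 < e -> `|pr P A - pr P A ^+ 2| <= 4 * e.
  move=> e0; have [_ /(_ e e0)[B [mB tB] AB]] := measurable_walsh_approx mA.
  have [L0 uL0 L0B] := trigpoly_hat tB.
  pose L := undup (fset0 :: L0).
  have uL : uniq L by exact: undup_uniq.
  have LB : wexp L (\1_B : X -> R).
    by apply: wexp_sub L0B => // S SL; rewrite mem_undup inE SL orbT.
  have bB : bm (\1_B : X -> R) := bm_indic R mB.
  (* [g] moves every coordinate occurring in [L] off all of them, so [B] and its translate share
     only the constant Walsh term; [fset0] was put into [L] in order to isolate that term. *)
  have [g gV] := disj (flatten (map (fun S : {fset nat} => S : seq nat) L)).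
  have mth := @measurable_coin_act R G pi g.
  have mgB : measurable (coin_act pi g @^-1` B) by rewrite -[X in measurable X]setTI; exact: mth.
  have mgA : measurable (coin_act pi g @^-1` A) by rewrite -[X in measurable X]setTI; exact: mth.
  have BgB : pr P (B `&` coin_act pi g @^-1` B) = pr P B ^+ 2.
    rewrite -I_indic; last exact: measurableI.
    rewrite (_ : \1_ _ = fun x => \1_B x * (\1_B \o coin_act pi g) x); last first.
      apply/funext => x; rewrite !indicE in_setI.
      rewrite (_ : (x \in coin_act pi g @^-1` B) = (coin_act pi g x \in B)); last first.
        by apply/idP/idP; rewrite !inE.
      by case: (x \in B); rewrite /= ?mul1r ?mul0r// indicE.
    rewrite (I_wexp LB); last exact: bm_comp.
    rewrite (bigD1_seq fset0) ?mem_undup ?inE ?eqxx//=.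
    rewrite big1_seq ?addr0 => [|S /andP[S0 SL]].
      rewrite hat_act// (_ : shift_fset pi g fset0 = fset0); last first.
        by apply/fsetP => n; apply/imfsetP; rewrite inE => -[].
      rewrite -expr2; congr (_ ^+ 2); rewrite -I_indic//; congr (I_ P).
      by apply/funext => x; rewrite /chi big_seq_fset0 mulr1.
    rewrite hat_act// [X in _ * X](hat_out uL LB) ?mulr0//.
    apply/negP => gSL.
    have /fset0Pn[n nS] := S0; have /negP := gV n ltac:(by apply/flatten_mapP; exists S).
    by apply; apply/flatten_mapP; exists (shift_fset pi g S) => //; apply/imfsetP; exists n.
  have dAB := pr_dist P mA mB.
  have dI := pr_dist P mA (measurableI _ _ mB mgB).
  have : pr P (A `+` (B `&` coin_act pi g @^-1` B)) <= e + e.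
    have := prY_I P mA mgA mB mgB; rewrite {1}(invA g) setIid => /le_trans; apply.
    rewrite lerD ?ltW//.
    have -> : coin_act pi g @^-1` A `+` coin_act pi g @^-1` B = coin_act pi g @^-1` (A `+` B) by [].
    by rewrite {1}/pr coin_act_preserving//; exact: measurableY.
  move=> /(le_trans dI); rewrite BgB => dI2.
  have := pr_ge0 P A; have := pr_le1 P mA; have := pr_ge0 P B; have := pr_le1 P mB.
  move: dAB dI2 AB; rewrite !ler_norml => /andP[a1 a2] /andP[b1 b2] AB B1 B0 A1 A0.
  move: (pr P A) (pr P B) (pr P (A `+` B)) a1 a2 b1 b2 AB B1 B0 A1 A0 => a b c a1 a2 b1 b2 AB B1 B0 A1 A0.
  have H1 : 0 <= (e - (b - a)) * (a + b) by apply: mulr_ge0; lra.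
  have H2 : 0 <= (e - (a - b)) * (a + b) by apply: mulr_ge0; lra.
  have H3 : 0 <= e * (2 - a - b) by apply: mulr_ge0; lra.
  by apply/andP; split; nra.
have {key} : pr P A - pr P A ^+ 2 = 0.
  apply/eqP; rewrite -normr_le0; apply/ler_addgt0Pl => e e0; rewrite addr0.
  have e4 : 0 < e / 4 by lra.
  by have := key _ e4; lra.
rewrite -[act_measure _]/P !prE// -[pr P A - _]/(_ - _).
move=> /eqP; rewrite expr2 -{1}(mulr1 (pr P A)) -mulrBr mulf_eq0 subr_eq0 => /orP[/eqP->|/eqP<-]; [left|right]; by [].
Qed.

End coordinate_actions_free_ergodic.

(** * Almost invariant means *)

Section means.
Context (R : realType) (G : groupType).

Definition mean (m : set G -> R) := [/\ forall A, 0 <= m A, m setT = 1 &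
  forall A B, A `&` B = set0 -> m (A `|` B) = m A + m B].

Definition ltrans (g : G) (A : set G) : set G := [set (g * x)%g | x in A].

Lemma mean_le1 m A : mean m -> m A <= 1.
Proof.
move=> [m0 m1 mU]; rewrite -m1 -(setUv A) mU ?setICr//.
by rewrite lerDl m0.
Qed.

(** Countability allows a single sequence of means, the mean of index [n] being nearly invariant
    under the first [n] elements. Values lie in a compact interval, so they converge along an
    ultrafilter finer than [\oo], and the limit is exactly invariant. *)
Lemma almost_invariant_amenable (e : nat -> G) : (forall g, exists n, e n = g) ->
  (forall (F : seq G) (k : R), 0 < k -> exists2 m, mean m &
     forall g, g \in F -> forall A, `|m (ltrans g A) - m A| <= k) ->
  amenable R G.
Proof.
move=> esurj H.
have /choice[m mP] (n : nat) : exists m, mean m /\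
    forall i, (i < n)%N -> forall A, `|m (ltrans (e i) A) - m A| <= n.+1%:R^-1.
  have [|m mm mi] := H (map e (iota 0 n)) n.+1%:R^-1; first by rewrite invr_gt0.
  exists m; split => // i iltn A; apply: mi; apply: map_f.
  by rewrite mem_iota.
have [U [UU Uoo]] := ultraFilterLemma (F := \oo) _.
have cvgU (u : nat -> R) : (forall n, 0 <= u n <= 1) -> exists l : R, u @ U --> l.
  move=> u01; have Uu : U (u @^-1` `[0, 1]).
    by apply: (filterS _ filterT) => n _ /=; rewrite in_itv/= u01.
  have [l [_ ul]] := @segment_compact R 0 1 (u @ U) _ Uu.
  exists l => W lW; case: (in_ultra_setVsetC (u @^-1` W) UU) => // UW.
  by have [x [nWx Wx]] := ul (~` W) W UW lW.
have mU A : exists l : R, (fun n => m n A) @ U --> l.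
  by apply: cvgU => n; have [mm _] := mP n; rewrite (mean_le1 _ mm) andbT; case: mm.
have /choice[l lP] := mU.
exists l; split.
- move=> A; apply: (closed_cvg (fun x : R => 0 <= x) _ _ _ (lP A)); first exact: closed_ge.
  by apply: (filterS _ filterT) => n _; have [[]] := mP n.
- apply: cvg_unique (lP setT) _ => //.
  have -> : (fun n => m n setT) = fun=> 1 by apply/funext => n; have [[]] := mP n.
  exact: cvg_cst.
- move=> A B AB; apply: (cvg_unique _ (lP (A `|` B))) => //.
  have -> : (fun n => m n (A `|` B)) = (fun n => m n A) \+ (fun n => m n B).
    by apply/funext => n; have [[_ _ ->]] := mP n.
  exact: cvgD (lP A) (lP B).
- move=> g A; have [i ei] := esurj g.
  have d0 : (fun n => m n (ltrans g A)) \- (fun n => m n A) @ U --> (0 : R).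
    apply: (cvg_trans _ (_ : _ @ \oo --> (0:R))).
      by apply: cvg_app; exact: Uoo.
    apply/cvgrPdist_le => d dgt0.
    have := @cvg_harmonic R; move=> /cvgrPdist_le/(_ d dgt0) Hd.
    near=> n; rewrite sub0r normrN /= -ei.
    have [_ mi] := mP n; have iltn : (i < n)%N by near: n; exists i.+1.
    apply: le_trans (mi _ iltn A) _.
    have : `|0 - harmonic n| <= d :> R by near: n.
    by rewrite sub0r normrN ger0_norm // /harmonic/= invr_ge0.
  apply/eqP; rewrite -subr_eq0; apply/eqP.
  apply: (cvg_unique _ _ d0) => //; exact: cvgB (lP _) (lP _).
Unshelve. all: by end_near.
Qed.

End means.

(** * Spectral gap from non-amenability *)

Section gap.
Context (R : realType) (G : groupType) (e : G -> nat) (e' : nat -> G).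
Hypotheses (eK : cancel e e') (eK' : cancel e' e).
Notation X := (coin_mtype R).
Notation P := (coin_prob R).

(* The coordinates are [option G], with [None] encoded as [0]. *)
Definition pointed_shift (g : G) (n : nat) : nat :=
  if n is m.+1 then (e (g * e' m)%g).+1 else 0%N.

Lemma pointed_shift1 n : pointed_shift 1%g n = n.
Proof. by case: n => //= n; rewrite mul1g eK'. Qed.

Lemma pointed_shiftM g h n :
  pointed_shift (g * h)%g n = pointed_shift g (pointed_shift h n).
Proof. by case: n => //= n; rewrite eK mulgA. Qed.

Notation act := (@coin_act R G pointed_shift).
Notation shiftS := (shift_fset pointed_shift).

Definition cnt (E : set G) (S : {fset nat}) : R :=
  \sum_(n <- S) (if n is m.+1 then `[< E (e' m) >]%:R else 0).

Lemma cnt_ge0 E S : 0 <= cnt E S.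
Proof. by apply: sumr_ge0 => -[]. Qed.

Lemma cntU E F S : E `&` F = set0 -> cnt (E `|` F) S = cnt E S + cnt F S.
Proof.
move=> EF; rewrite /cnt -big_split/=; apply: eq_bigr => -[|m] _; first by rewrite addr0.
have := congr1 (@^~ (e' m)) EF => /= /propeqP EF'.
rewrite asbool_or; case: asboolP => [Em|]; case: asboolP => [Fm|] //=; rewrite ?addr0 ?add0r//.
by exfalso; apply EF'.
Qed.

Lemma cnt_ltrans g E S : cnt (ltrans g E) (shiftS g S) = cnt E S.
Proof.
rewrite /cnt big_imfset/=; last by move=> i j _ _; exact: can_inj (piK pointed_shift1 pointed_shiftM _) i j.
apply: eq_bigr => -[|m] _ //=; congr (_%:R); congr nat_of_bool; apply/asboolP/asboolP; rewrite eK.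
  by move=> [x Ex /mulgI <-].
by move=> Em; exists (e' m).
Qed.

Lemma cntT_eq0 S : (cnt setT S == 0) = (S `<=` [fset 0%N])%fset.
Proof.
apply/idP/fsubsetP => [/eqP c0 n nS|S0].
  rewrite inE; case: n nS => // n nS; move/eqP: c0.
  rewrite /cnt psumr_eq0 => [|[]//] /allP/(_ _ nS)/=.
  by rewrite asboolT// oner_eq0.
by apply/eqP; rewrite /cnt big_seq big1// => n /S0; rewrite inE => /eqP ->.
Qed.

(** The probability that a uniform element of [S], its fixed coordinate [0] discarded, lies in [E].
    If nothing remains, division by zero gives [0], so such [S] carry no mass. *)
Definition share E S : R := cnt E S / cnt setT S.

Lemma share_ge0 E S : 0 <= share E S.
Proof. by rewrite divr_ge0 ?cnt_ge0. Qed.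

Lemma shareU E F S : E `&` F = set0 -> share (E `|` F) S = share E S + share F S.
Proof. by move=> EF; rewrite /share cntU// mulrDl. Qed.

Lemma ltransT (g : G) : ltrans g setT = setT.
Proof. by apply/seteqP; split => // x _; exists (g^-1 * x)%g; rewrite // mulVKg. Qed.

Lemma share_ltrans g E S : share (ltrans g E) (shiftS g S) = share E S.
Proof. by rewrite /share cnt_ltrans -{1}(ltransT g) cnt_ltrans. Qed.

Lemma shareT S : share setT S = (~~ (S `<=` [fset 0%N])%fset)%:R.
Proof.
rewrite /share -cntT_eq0; case: eqVneq => [->|c0]; first by rewrite mul0r.
by rewrite divff.
Qed.

Lemma share_le1 E S : share E S <= 1.
Proof.
have : share E S + share (~` E) S <= 1.
  by rewrite -shareU ?setICr// setUv shareT lern1 leq_b1.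
by have := share_ge0 (~` E) S; lra.
Qed.

Section walsh_mean.
Variables (B : set X) (L : seq {fset nat}).
Hypotheses (mB : measurable B) (uL : uniq L) (LB : wexp L (\1_B : X -> R)).
Notation f := (\1_B : X -> R).

(* The spectral measure of [B], pushed to [G] by picking a uniform element of
   each nonempty finite set [S]. *)
Definition spec (E : set G) : R := \sum_(S <- L) hat f S ^+ 2 * share E S.

Lemma spec_ge0 E : 0 <= spec E.
Proof. by apply: sumr_ge0 => S _; rewrite mulr_ge0 ?sqr_ge0 ?share_ge0. Qed.

Lemma specU E F : E `&` F = set0 -> spec (E `|` F) = spec E + spec F.
Proof.
by move=> EF; rewrite /spec -big_split/=; apply: eq_bigr => S _; rewrite shareU// mulrDr.
Qed.

(** Squared coefficients [a ^+ 2] and [b ^+ 2] of [B] and its translate differ by a product of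
    [a - b] and [a + b]. Bessel bounds the sum of squares of the latter by 4, as the two indicators
    add up to at most 2, and of the former by the measure of the symmetric difference. The free
    weight [t] stands in for the square root of Cauchy-Schwarz. *)
Lemma spec_almost_invariant g E (t : R) : 0 < t ->
  `|spec (ltrans g E) - spec E| <= 2 * t + pr P (B `+` (act g @^-1` B)) / (2 * t).
Proof.
move=> t0; have bf : bm f := bm_indic R mB.
have mgB : measurable (act g @^-1` B).
  by rewrite -[X in measurable X]setTI; exact: (@measurable_coin_act R G pointed_shift g).
pose h := f \o act g; have hE : h = \1_(act g @^-1` B).
  apply/funext => x; rewrite /h/= !indicE.
  by rewrite (_ : (x \in act g @^-1` B) = (act g x \in B)).
have bh : bm h by rewrite hE; exact: bm_indic.
have hhat S : hat h S = hat f (shiftS g S) by exact: (hat_act pointed_shift1 pointed_shiftM).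
(* [M] contains the Walsh supports of both [f] and [h], so that the two spectral sums can be
   compared term by term. *)
pose M := undup (L ++ map (shiftS g^-1) L).
have uM : uniq M by exact: undup_uniq.
have sVK : cancel (shiftS g) (shiftS g^-1) := shift_fsetK pointed_shift1 pointed_shiftM g.
have sK : cancel (shiftS g^-1) (shiftS g).
  by move=> S; rewrite -{1}(invgK g) shift_fsetK//; [exact: pointed_shift1|exact: pointed_shiftM].
have specM : spec E = \sum_(S <- M) hat f S ^+ 2 * share E S.
  apply: sum_widen => // [S SL|S SL]; first by rewrite mem_undup mem_cat SL.
  by rewrite (hat_out uL LB SL) expr0n mul0r.
have specM' : spec (ltrans g E) = \sum_(S <- M) hat h S ^+ 2 * share E S.
  transitivity (\sum_(S <- map (shiftS g^-1) L) hat h S ^+ 2 * share E S).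
    rewrite big_map; apply: eq_bigr => S _; rewrite hhat sK; congr (_ * _).
    by rewrite -{1}(sK S) share_ltrans.
  apply: sum_widen => //; first by rewrite map_inj_uniq//; exact: can_inj sK.
    by move=> S SL; rewrite mem_undup mem_cat SL orbT.
  move=> S SL; rewrite hhat (hat_out uL LB) ?expr0n ?mul0r//.
  by apply: contra SL => SL; apply/mapP; exists (shiftS g S).
rewrite specM specM' -sumrB; apply: le_trans (ler_norm_sum _ _ _) _.
pose u := fun x => f x + h x; pose v := fun x => f x - h x.
have bu : bm u by exact: bmD. have bv : bm v by exact: bmB.
have hatu S : hat u S = hat f S + hat h S.
  rewrite /hat -I_D; try by apply: bmM => //; exact: bm_chi.
  by congr (I_ P); apply/funext => x; rewrite /u mulrDl.
have hatv S : hat v S = hat f S - hat h S.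
  rewrite /hat -I_B; try by apply: bmM => //; exact: bm_chi.
  by congr (I_ P); apply/funext => x; rewrite /v mulrBl.
have Bu : \sum_(S <- M) hat u S ^+ 2 <= 4.
  apply: le_trans (bessel uM bu) _; rewrite -(I_cst P 4); apply: I_le.
  - by under eq_fun do rewrite expr2; exact: bmM.
  - exact: bm_cst.
  - move=> x; rewrite /u hE !indicE; case: (_ \in _); case: (_ \in _) => /=; lra.
have Bv : \sum_(S <- M) hat v S ^+ 2 <= pr P (B `+` (act g @^-1` B)).
  by apply: le_trans (bessel uM bv) _; rewrite -I_indicB// /v hE.
(* AM-GM: [|a^2 - b^2| <= t/2 (a+b)^2 + (a-b)^2/(2t)] *)
apply: (@le_trans _ _ (\sum_(S <- M) (t / 2 * hat u S ^+ 2 + (2 * t)^-1 * hat v S ^+ 2))).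
  apply: ler_sum => S _; rewrite hatu hatv -mulrBl normrM.
  apply: le_trans (_ : `|hat h S ^+ 2 - hat f S ^+ 2| * 1 <= _).
    by rewrite ler_wpM2l// ger0_norm ?share_ge0// share_le1.
  rewrite mulr1; move: (hat f S) (hat h S) => a b.
  have T0 : t != 0 by rewrite gt_eqF.
  have E1 : t / 2 * (a + b) ^+ 2 + (2 * t)^-1 * (a - b) ^+ 2 - (b ^+ 2 - a ^+ 2) =
    (2 * t)^-1 * (t * (a + b) + (a - b)) ^+ 2 by field.
  have E2 : t / 2 * (a + b) ^+ 2 + (2 * t)^-1 * (a - b) ^+ 2 + (b ^+ 2 - a ^+ 2) =
    (2 * t)^-1 * (t * (a + b) - (a - b)) ^+ 2 by field.
  have t2 : 0 <= (2 * t)^-1 by rewrite invr_ge0; lra.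
  have F1 := mulr_ge0 t2 (sqr_ge0 (t * (a + b) + (a - b))).
  have F2 := mulr_ge0 t2 (sqr_ge0 (t * (a + b) - (a - b))).
  by rewrite ler_norml; apply/andP; split; lra.
rewrite big_split/= -!mulr_sumr.
apply: lerD; last by rewrite mulrC ler_wpM2r// invr_ge0; lra.
by nra.
Qed.

Definition heads0 : set X := [set x | x 0%N = true].

Lemma measurable_heads0 : measurable heads0.
Proof. exact: measurable_coin. Qed.

(** The Walsh terms at [fset0] and at the fixed coordinate form a function [v] of the fixed coin,
    and by Parseval the other terms have squared norm [spec setT]. [Z] rounds [v] at 1/2; where the
    rounding disagrees with [B], the error of [v] is at least 1/2, whence the factor 4. *)
Lemma spec_total : exists2 Z, Z \in [:: set0; setT; heads0; ~` heads0] &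
  pr P (B `+` Z) <= 4 * spec setT.
Proof.
pose L' := undup (fset0 :: [fset 0%N]%fset :: L).
have uL' : uniq L' by exact: undup_uniq.
have LL' : {subset L <= L'} by move=> S SL; rewrite mem_undup !inE SL !orbT.
have LB' : wexp L' f by apply: wexp_sub LB.
pose c S : R := if (S `<=` [fset 0%N])%fset then 0 else hat f S.
pose v (b : bool) := hat f fset0 + hat f [fset 0%N]%fset * (-1) ^+ b.
have fv x : f x - v (x 0%N) = \sum_(S <- L') c S * chi S x.
  have m0 : fset0 \in L' by rewrite mem_undup !inE eqxx.
  have m1 : [fset 0%N]%fset \in L' by rewrite mem_undup !inE eqxx orbT.
  have n01 : [fset 0%N]%fset != fset0 by rewrite -cardfs_eq0 cardfs1.
  have m1' : [fset 0%N]%fset \in [seq i <- L' | i != fset0] by rewrite mem_filter n01.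
  have uF : uniq [seq i <- L' | i != fset0] by exact: filter_uniq.
  have splitL (F : {fset nat} -> R) : \sum_(S <- L') F S = F fset0 + (F [fset 0%N]%fset +
      \sum_(S <- [seq i <- L' | i != fset0] | S != [fset 0%N]%fset) F S).
    by rewrite (bigD1_seq fset0 m0 uL')/= -big_filter (bigD1_seq [fset 0%N]%fset m1' uF).
  rewrite LB' (splitL (fun S => hat f S * chi S x)) (splitL (fun S => c S * chi S x)).
  have -> : c fset0 = 0 by rewrite /c fsub0set.
  have -> : c [fset 0%N]%fset = 0 by rewrite /c fsubset_refl.
  rewrite !mul0r !add0r.
  rewrite /v {1 2}/chi big_seq_fset0 big_seq_fset1 mulr1.
  set s1 := \sum_(i <- _ | _) _; set s2 := \sum_(i <- _ | _) _.
  suff -> : s1 = s2 by ring.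
  rewrite /s1 /s2 [LHS]big_seq_cond [RHS]big_seq_cond; apply: eq_bigr => S.
  by rewrite mem_filter => /andP[/andP[S0 _] S1]; rewrite /c fsubset1 (negbTE S1) (negbTE S0).
pose Z : set X := [set x | 2^-1 <= v (x 0%N)].
have mZ : measurable Z /\ Z \in [:: set0; setT; heads0; ~` heads0].
  have mA0 := measurable_heads0.
  suff [-> //|[->|[->|->]]] : Z = set0 \/ Z = setT \/ Z = heads0 \/ Z = ~` heads0.
  - by rewrite !inE eqxx.
  - by rewrite !inE eqxx !orbT.
  - by rewrite !inE eqxx !orbT.
  - by rewrite !inE eqxx !orbT; split => //; exact: measurableC.
  case bT: (2^-1 <= v true); case bF: (2^-1 <= v false); [right; left|right; right; left|right; right; right|left];
    apply/seteqP; split => x; rewrite /Z /heads0/=; case: (x 0%N); rewrite ?bT ?bF //.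
exists Z; first exact: mZ.2.
have bf : bm f := bm_indic R mB.
have bv : bm (fun x : X => v (x 0%N)).
  have -> : (fun x : X => v (x 0%N)) = fun x => f x - \sum_(S <- L') c S * chi S x.
    by apply/funext => x; rewrite -fv; ring.
  by apply: bmB => //; apply: bm_sum => S; apply: bmM; [exact: bm_cst|exact: bm_chi].
rewrite -I_indicB//; last exact: mZ.1.
apply: (@le_trans _ _ (I_ P (fun x => 4 * (f x - v (x 0%N)) ^+ 2))).
  apply: I_le.
  - by under eq_fun do rewrite expr2; apply: bmM; apply: bmB => //; exact: (bm_indic R mZ.1).
  - by under eq_fun do rewrite expr2; apply: bmM; [exact: bm_cst|apply: bmM; exact: bmB].
  move=> x; have -> : \1_Z x = (2^-1 <= v (x 0%N))%R%:R :> R.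
    by rewrite indicE; congr (nat_of_bool _)%:R; apply/idP/idP; rewrite inE.
  move: (v (x 0%N)) => w; have s1 := sqr_ge0 (1 - w); have s2 := sqr_ge0 w.
  by rewrite indicE; case: (_ \in _); case: (leP _ w) => /= hw; nra.
rewrite I_Z; last by under eq_fun do rewrite expr2; apply: bmM; exact: bmB.
apply: ler_wpM2l => //; under eq_fun do rewrite fv.
rewrite parseval// /spec.
rewrite [X in _ <= X](_ : _ = \sum_(S <- L') hat f S ^+ 2 * share setT S); last first.
  by apply: sum_widen => // S SL; rewrite (hat_out uL LB SL) expr0n mul0r.
apply: ler_sum => S _; rewrite /c shareT; case: (_ `<=` _)%fset => /=.
  by rewrite expr0n mulr0.
by rewrite mulr1.
Qed.

End walsh_mean.

Lemma spectral_gap : ~ amenable R G -> forall dl : R, 0 < dl ->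
  exists (F : seq G) (eps : R), 0 < eps /\ forall A : set X, measurable A ->
    (forall g, g \in F -> pr P (A `+` (act g @^-1` A)) <= eps) ->
    exists2 Z, Z \in [:: set0; setT; heads0; ~` heads0] & pr P (A `+` Z) <= dl.
Proof.
move=> nam dl dl0; apply: contrapT => nogap; apply: nam.
apply: (@almost_invariant_amenable R G e'); first by move=> g; exists (e g).
(* The spectral mass of [B] will be at least [dl / 8] and a translation will change it by at most
   [4 * t], so [t] of order [k * dl] survives the normalization. The error term is of order
   [eps / t], hence the bound [t ^+ 2] for [eps]. *)
move=> F k k0; pose t : R := Num.min (k * dl / 64) (1 / 4).
have t0 : 0 < t by rewrite lt_min; apply/andP; split; [rewrite divr_gt0// mulr_gt0|]; lra.
pose eps : R := Num.min (dl / 2) (t ^+ 2).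
have eps0 : 0 < eps by rewrite lt_min divr_gt0//= exprn_gt0.
have [A [mA [invA farA]]] : exists A : set X, measurable A /\
    ((forall g, g \in F -> pr P (A `+` (act g @^-1` A)) <= eps) /\
    forall Z, Z \in [:: set0; setT; heads0; ~` heads0] -> dl < pr P (A `+` Z)).
  apply: contrapT => H; apply: nogap; exists F, eps; split => // A mA invA.
  apply: contrapT => H'; apply: H; exists A; split => //; split => // Z ZZ.
  by rewrite ltNge; apply/negP => AZ; apply: H'; exists Z.
have [_ /(_ eps eps0)[B [mB tB] AB]] := measurable_walsh_approx mA.
have [L uL LB] := trigpoly_hat tB.
have mact g C : measurable C -> measurable (act g @^-1` C).
  by move=> mC; rewrite -[X in measurable X]setTI; exact: (@measurable_coin_act R G pointed_shift g).
have eps_dl : eps <= dl / 2 by rewrite /eps ge_min lexx.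
have eps_t : eps <= t ^+ 2 by rewrite /eps ge_min lexx orbT.
(* [A] is farther than [dl] from all four sets and [B] is within [dl / 2] of [A], so the distance
   bounded in [spec_total] exceeds [dl / 2]. *)
have W8 : dl / 8 <= spec B L setT.
  have [Z ZZ BZ] := spec_total mB uL LB.
  have mZ : measurable Z.
    by move: ZZ; rewrite !inE => /or4P[]/eqP->; have mA0 := measurable_heads0; meas.
  have := prY_triangle P mA mB mZ; have := farA Z ZZ; lra.
have W0 : 0 < spec B L setT by lra.
exists (fun E => spec B L E / spec B L setT).
  split.
  - by move=> E; rewrite divr_ge0 ?spec_ge0.
  - by rewrite divff// gt_eqF.
  - by move=> E E' EE'; rewrite specU// mulrDl.
move=> g gF E; rewrite -mulrBl normrM [X in _ * X]gtr0_norm ?invr_gt0// ler_pdivrMr//.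
apply: le_trans (spec_almost_invariant mB uL LB g E t0) _.
have BgB : pr P (B `+` (act g @^-1` B)) <= 3 * eps.
  have := prY_triangle P mB mA (mact g _ mB); have := prY_triangle P mA (mact g _ mA) (mact g _ mB).
  have -> : pr P ((act g @^-1` A) `+` (act g @^-1` B)) = pr P (A `+` B).
    rewrite (_ : (act g @^-1` A) `+` (act g @^-1` B) = act g @^-1` (A `+` B))//.
    by rewrite {1}/pr (coin_act_preserving pointed_shift1 pointed_shiftM)//; exact: measurableY.
  have := invA g gF; rewrite (setYC B A); lra.
apply: (@le_trans _ _ (4 * t)).
  suff : pr P (B `+` act g @^-1` B) / (2 * t) <= 2 * t by lra.
  rewrite ler_pdivrMr; last lra.
  by apply: le_trans BgB _; rewrite expr2 in eps_t; nra.
have tk : t <= k * dl / 64 by rewrite /t ge_min lexx.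
nra.
Qed.

End gap.

(** * Weak containment *)

Section action_lemmas.
Context (R : realType) (G : groupType) (a : mp_action R G).
Notation X := (act_space a).
Notation P := (act_measure a).

Lemma actK g : cancel (act a g) (act a g^-1).
Proof. by move=> x; rewrite -act_mul mulVg act_one. Qed.

Lemma actKV g : cancel (act a g^-1) (act a g).
Proof. by move=> x; rewrite -act_mul mulgV act_one. Qed.

Lemma act_image g (A : set X) : act a g @` A = act a g^-1 @^-1` A.
Proof.
apply/seteqP; split => x /=; first by move=> [y Ay <-]; rewrite actK.
by move=> Ax; exists (act a g^-1 x); rewrite ?actKV.
Qed.

Lemma measurable_act g (A : set X) : measurable A -> measurable (act a g @^-1` A).
Proof. by move=> mA; rewrite -[X in measurable X]setTI; exact: act_measurable. Qed.

Lemma pr_act g (A : set X) : measurable A -> pr P (act a g @^-1` A) = pr P A.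
Proof. by move=> mA; rewrite /pr act_preserving. Qed.

Lemma pr_act_image g (A B : set X) : measurable A -> measurable B ->
  P ((act a g @` A) `&` B) = (pr P (A `&` act a g @^-1` B))%:E.
Proof.
move=> mA mB; have mgB := measurable_act g mB.
rewrite -(@act_preserving _ _ a g); last first.
  by rewrite act_image; apply: measurableI => //; exact: measurable_act.
rewrite -prE; last exact: measurableI.
congr (act_measure a _); rewrite act_image; apply/seteqP; split => x /=; by rewrite actK.
Qed.

(** Weak containment controls only measures of intersections; this identity reads almost invariance
    off them. *)
Lemma act_invariantY g (A : set X) : measurable A ->
  pr P (A `+` act a g @^-1` A) = 2 * (pr P A - pr P (A `&` act a g @^-1` A)).
Proof.
move=> mA; have mgA := measurable_act g mA; rewrite pr_setYE//.
have := prID P mA mgA; have := prID P mgA mA; rewrite pr_act// setIC; lra.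
Qed.

End action_lemmas.

Section weak_containment.
Context (R : realType) (G : groupType).
Implicit Types a b : mp_action R G.

Lemma weakly_containedP a b : weakly_contained a b <->
  forall (k : nat) (A : 'I_k -> set (act_space a)), borel_partition A ->
  forall (F : seq G) (eps : R), 0 < eps ->
  exists2 B : 'I_k -> set (act_space b), borel_partition B &
    forall g, g \in F -> forall i j,
      `|pr (act_measure a) (A i `&` act a g @^-1` A j) -
        pr (act_measure b) (B i `&` act b g @^-1` B j)| < eps.
Proof.
split => [H k A pA F eps eps0|H k A pA F finF eps eps0].
  have [B pB HB] := H k A pA [set` F] (finite_seq F) eps eps0.
  exists B => // g gF i j; have [mA _ _] := pA; have [mB _ _] := pB.
  by have := HB g gF i j; rewrite !pr_act_image// -EFinB abse_EFin lte_fin.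
have [s FE] := (finite_seqP F).1 finF; have [B pB HB] := H k A pA s eps eps0.
exists B => // g; rewrite FE /= => gs i j; have [mA _ _] := pA; have [mB _ _] := pB.
by rewrite !pr_act_image// -EFinB abse_EFin lte_fin; exact: HB.
Qed.

Lemma pr_blocks a (I : finType) (F : I -> set (act_space a)) (p q : pred I) g :
  (forall i, measurable (F i)) -> (forall i j, i != j -> F i `&` F j = set0) ->
  pr (act_measure a) ((\big[setU/set0]_(i | p i) F i) `&`
     act a g @^-1` (\big[setU/set0]_(i | q i) F i)) =
  \sum_(i | p i) \sum_(j | q j) pr (act_measure a) (F i `&` act a g @^-1` F j).
Proof.
move=> mF dF; rewrite big_distrl/= pr_bigcup; last 2 first.
- move=> i; apply: measurableI => //; apply: measurable_act.
  by apply: bigsetU_measurable.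
- by move=> i j ij; rewrite setIACA dF// set0I.
apply: eq_bigr => i _.
have -> : act a g @^-1` (\big[setU/set0]_(j | q j) F j) = \big[setU/set0]_(j | q j) (act a g @^-1` F j).
  by rewrite (big_morph (fun A => act a g @^-1` A) (id1 := set0) (op1 := setU)).
rewrite big_distrr/= pr_bigcup// => [j|j k jk].
  by apply: measurableI => //; exact: measurable_act.
by rewrite setIACA -preimage_setI (dF j k)// preimage_set0 setI0.
Qed.

(** Overlapping sets are handled through the atoms [At] of the finite algebra they generate: copy
    the atoms as a partition and reassemble. *)
Lemma weakly_contained_sets a b (J : finType) (A : J -> set (act_space a))
    (F : seq G) (eps : R) : weakly_contained a b -> (forall j, measurable (A j)) -> 0 < eps ->
  exists2 B : J -> set (act_space b), (forall j, measurable (B j)) &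
    forall g, g \in F -> forall i j,
      `|pr (act_measure a) (A i `&` act a g @^-1` A j) -
        pr (act_measure b) (B i `&` act b g @^-1` B j)| < eps.
Proof.
move=> /weakly_containedP wc mA eps0; pose V : finType := {ffun J -> bool}.
pose k := #|V|; pose ev (i : 'I_k) : V := enum_val i.
pose At (v : V) : set (act_space a) := \big[setI/setT]_(j : J) (if v j then A j else ~` A j).
have AtP v x : At v x <-> forall j, v j = `[< A j x >].
  rewrite /At -bigcap_seq; split.
    move=> H j; have := H j (mem_index_enum _).
    by case: (v j); [move=> /asboolT ->|move=> /asboolF ->].
  by move=> H j _; rewrite H; case: asboolP.
have mAt v : measurable (At v).
  by apply: bigsetI_measurable => j _; case: (v j) => //; exact: measurableC.
have dAt i j : i != j -> At (ev i) `&` At (ev j) = set0.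
  move=> ij; apply/seteqP; split => // x [/AtP H1 /AtP H2]; move/eqP: ij; apply.
  by apply: enum_val_inj; apply/ffunP => l; rewrite H1 H2.
have pAt : borel_partition (fun i => At (ev i)).
  split => //; first by apply/trivIsetP => i j _ _; exact: dAt.
  apply/seteqP; split => // x _.
  pose v : V := [ffun j => `[< A j x >]].
  by exists (enum_rank v) => //; rewrite /ev enum_rankK; apply/AtP => j; rewrite ffunE.
(* The denominator exceeds the number of pairs of atoms, so the accumulated error stays strictly
   below [eps]. *)
pose e1 := eps / (k.+1 * k.+1)%:R.
have e10 : 0 < e1 by rewrite divr_gt0// ltr0n muln_gt0.
have [B' pB' HB'] := wc k _ pAt F e1 e10; have [mB' tB' _] := pB'.
have dB' i j : i != j -> B' i `&` B' j = set0 by move=> ij; move/trivIsetP: tB'; apply.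
pose B j := \big[setU/set0]_(i : 'I_k | ev i j) B' i.
have AE j : A j = \big[setU/set0]_(i : 'I_k | ev i j) At (ev i).
  rewrite -bigcup_seq_cond; apply/seteqP; split => x.
    move=> Ajx; pose v : V := [ffun j => `[< A j x >]].
    exists (enum_rank v); rewrite /= ?mem_index_enum /ev ?enum_rankK ?ffunE; first exact/asboolP.
    by apply/AtP => i; rewrite ffunE.
  by move=> [i /= /andP[_ vj]] /AtP/(_ j); rewrite vj => /esym/asboolP.
exists B; first by move=> j; exact: bigsetU_measurable.
move=> g gF i j; rewrite (AE i) (AE j) /B !pr_blocks// -sumrB.
apply: le_lt_trans (ler_norm_sum _ _ _) _.
apply: (@le_lt_trans _ _ (\sum_(p : 'I_k) \sum_(q : 'I_k) e1)).
  rewrite big_mkcond; apply: ler_sum => p _.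
  case: ifP => _; last by apply: sumr_ge0 => q _; exact: ltW.
  rewrite -sumrB; apply: le_trans (ler_norm_sum _ _ _) _.
  rewrite big_mkcond; apply: ler_sum => q _.
  by case: ifP => _; apply: ltW => //; exact: HB'.
rewrite !sumr_const card_ord -mulrnA -mulr_natr /e1 mulrAC ltr_pdivrMr ?ltr0n ?muln_gt0//.
by rewrite ltr_pM2l// ltr_nat ltn_mul.
Qed.

(** [ergodic] speaks of strictly invariant sets. The intersection [D] of all translates of [C] is
    one, and by countability of the group it differs from [C] by a null set. *)
Lemma ae_invariant_ergodic b (e : nat -> G) (C : set (act_space b)) :
  (forall g, exists n, e n = g) -> ergodic b -> measurable C ->
  (forall g, pr (act_measure b) (C `+` act b g @^-1` C) = 0) ->
  pr (act_measure b) C = 0 \/ pr (act_measure b) C = 1.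
Proof.
move=> esurj erg mC invC; pose D := \bigcap_n (act b (e n) @^-1` C).
have mD : measurable D by apply: bigcapT_measurable => n; exact: measurable_act.
have invD g : act b g @^-1` D = D.
  apply/seteqP; split => x Dx n _.
    have [k ek] := esurj (e n * g^-1)%g; have := Dx k Logic.I.
    by rewrite /= ek -act_mul mulgVK.
  have [k ek] := esurj (e n * g)%g; have := Dx k Logic.I.
  by rewrite /= ek act_mul.
have DC : D `<=` C.
  by have [k ek] := esurj 1%g; move=> x /(_ k Logic.I); rewrite /= ek act_one.
have CD0 : pr (act_measure b) (C `\` D) = 0.
  have mN n : measurable (C `\` act b (e n) @^-1` C) by apply: measurableD => //; exact: measurable_act.
  have N0 n : (act_measure b).-negligible (C `\` act b (e n) @^-1` C).
    exists (C `\` act b (e n) @^-1` C); split => //; rewrite prE//; congr EFin.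
    apply/eqP; rewrite eq_le pr_ge0 andbT -(invC (e n)) le_pr//; last by set_tauto.
    by apply: measurableY => //; exact: measurable_act.
  have : (act_measure b).-negligible (C `\` D).
    apply: negligibleS (negligible_bigcup N0) => x [Cx /existsNP[n /not_implyP[_ nCx]]].
    by exists n.
  by move=> /negligibleP => /(_ (measurableD mC mD)) ; rewrite /pr => ->.
have CE : pr (act_measure b) C = pr (act_measure b) D.
  by rewrite (prID _ mC mD) CD0 addr0 setIidr.
by rewrite CE /pr; case: (erg D mD invD) => ->; [left|right].
Qed.

End weak_containment.

(** * Limits of sets in measure *)

Section set_limit.
Context d (T : measurableType d) (R : realType) (P : probability T R).

(** Borel-Cantelli: outside the union of the later differences [E], all sets from index [N] on
    agree, hence so does their upper limit. The bound is the tail of the geometric series. *)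
Lemma fast_cauchy_sets (C : (set T)^nat) (K : R) : (forall n, measurable (C n)) ->
  (forall n, pr P (C n `+` C n.+1) <= K * 2^-1 ^+ n) ->
  exists2 D, measurable D & forall n, pr P (C n `+` D) <= 2 * K * 2^-1 ^+ n.
Proof.
move=> mC CC; pose D := lim_sup_set C.
have mD : measurable D.
  by apply: bigcapT_measurable => n; exact: bigcup_measurable.
exists D => // N; pose E n := C n `+` C n.+1.
have mE n : measurable (E n) by exact: measurableY.
pose U M := \big[setU/set0]_(i < M) E (N + i)%N.
have mU M : measurable (U M) by exact: bigsetU_measurable.
have sub : C N `+` D `<=` \bigcup_M U M.
  move=> x H; apply: contrapT => nU.
  have same n : C (N + n)%N x <-> C N x.
    elim: n => [|n IH]; first by rewrite addn0.
    rewrite addnS -IH; have : ~ E (N + n)%N x.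
      move=> Ex; apply: nU; exists n.+1 => //; rewrite /U big_ord_recr/=; right.
      exact: Ex.
    by rewrite /E /setY/=; case: (pselect (C (N + n)%N x)) (pselect (C (N + n).+1 x)) => [] ? []; tauto.
  have DN : D x <-> C N x.
    split => [Dx|CNx].
      by have [j /= Nj Cj] := Dx N Logic.I; apply/(same (j - N)%N); rewrite subnKC.
    move=> n _; exists (N + n)%N; rewrite /= ?leq_addl//; exact/same.
  by move: H; rewrite /setY/=; tauto.
have ndU : nondecreasing_seq U.
  move=> m n mn; apply/subsetPset.
  exact: (@subset_bigsetU _ (fun i => E (N + i)%N) m n mn).
have UM M : pr P (U M) <= 2 * K * 2^-1 ^+ N.
  have K0 : 0 <= K by have := CC 0%N; rewrite expr0 mulr1; apply: le_trans; exact: pr_ge0.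
  apply: le_trans (le_pr_bigcup P (fun i : 'I_M => true) (fun i => mE (N + i)%N)) _.
  apply: (@le_trans _ _ (\sum_(i < M) K * 2^-1 ^+ N * 2^-1 ^+ i)).
    by apply: ler_sum => i _; rewrite -mulrA -exprD; exact: CC.
  rewrite -mulr_sumr [leRHS](_ : _ = K * 2^-1 ^+ N * 2); last by ring.
  rewrite ler_wpM2l//.
    by rewrite mulr_ge0// exprn_ge0// invr_ge0.
  suff -> : \sum_(i < M) 2^-1 ^+ i = 2 - 2 * 2^-1 ^+ M :> R.
    by rewrite lerBlDr lerDl mulr_ge0// exprn_ge0// invr_ge0.
  elim: M {ndU} => [|M IH]; first by rewrite big_ord0 expr0; lra.
  by rewrite big_ord_recr/= IH exprS; lra.
have mUU : measurable (\bigcup_M U M) by exact: bigcupT_measurable.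
apply: le_trans (le_pr P (measurableY (mC N) mD) mUU sub) _.
apply/ler_addgt0Pr => ep ep0; have [M] := pr_cup_lim P ep0 mU ndU.
by have := UM M; lra.
Qed.

End set_limit.

Lemma seq_nat_bound (V : seq nat) : exists N, forall n, n \in V -> (n < N)%N.
Proof.
exists (\max_(n <- V) n).+1 => n nV; rewrite ltnS (big_rem n nV)/=.
exact: leq_maxl.
Qed.

(** * The non-amenable case *)

Section nonamenable.
Context (R : realType) (G : groupType) (e : G -> nat) (e' : nat -> G).
Hypotheses (eK : cancel e e') (eK' : cancel e' e).
Notation X := (coin_mtype R).
Notation P := (coin_prob R).

Definition pointed_action : mp_action R G :=
  coin_action R (pointed_shift1 eK') (pointed_shiftM eK).
Notation act1 := (@coin_act R G (pointed_shift e e')).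
Notation A0 := (@heads0 R).

Lemma pointed_action_free : free_action pointed_action.
Proof.
apply: (@coin_action_free R G _ _ _ e') => [g|g g1 V]; first by exists (e g).
have [N VN] := seq_nat_bound V; exists N.+1; first by apply/negP => /VN; rewrite ltnNge leqnSn.
rewrite /= eqSS; apply: contra g1 => /eqP egN; apply/eqP.
apply: (mulIg (e' N)); rewrite mul1g; apply: (can_inj eK); by rewrite egN eK'.
Qed.

Lemma pr_A0 : pr P A0 = 1 / 2.
Proof.
have := @coin_half R 0%N setT _ measurableT (@measurable_heads0 R).
rewrite setTI prT; apply => //.
by rewrite /heads0 flip_coin.
Qed.

(** A measure close to 1/2 excludes the two trivial sets from the list given by the spectral gap. *)
Lemma near_A0 (A Z : set X) (dl : R) : measurable A -> `|pr P A - 1 / 2| < 1 / 4 -> dl <= 1 / 4 ->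
  Z \in [:: set0; setT; A0; ~` A0] -> pr P (A `+` Z) <= dl -> Z = A0 \/ Z = ~` A0.
Proof.
move=> mA; rewrite ltr_norml => /andP[A1 A2] dl4; rewrite !inE => /or4P[]/eqP-> AZ; [| |by left|by right].
  by exfalso; have := pr_dist P mA measurable0; rewrite pr0 ler_norml => /andP[_]; lra.
by exfalso; have := pr_dist P mA measurableT; rewrite prT ler_norml => /andP[]; lra.
Qed.

Lemma dichotomy_A0 (A B Z Z' : set X) (d d' : R) : measurable A -> measurable B ->
  Z = A0 \/ Z = ~` A0 -> Z' = A0 \/ Z' = ~` A0 ->
  pr P (A `+` Z) <= d -> pr P (B `+` Z') <= d' ->
  pr P (A `+` B) <= d + d' \/ 1 - (d + d') <= pr P (A `+` B).
Proof.
move=> mA mB; have mA0 := @measurable_heads0 R; have mCA0 := measurableC mA0.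
have key C D : measurable C -> measurable D -> pr P (A `+` C) <= d -> pr P (B `+` D) <= d' ->
    pr P (A `+` B) <= pr P (C `+` D) + (d + d') /\ pr P (C `+` D) <= pr P (A `+` B) + (d + d').
  move=> mC mD AC BD; split.
    have := prY_triangle P mA mC mB; have := prY_triangle P mC mD mB.
    by rewrite (setYC D B); lra.
  have := prY_triangle P mC mA mD; have := prY_triangle P mA mB mD.
  by rewrite (setYC C A); lra.
move=> [->|->] [->|->] AZ BZ'; have [||K1 K2] := key _ _ _ _ AZ BZ' => //.
- by left; move: K1; rewrite setYK pr0; lra.
- by right; move: K2; rewrite setYCT prT; lra.
- by right; move: K2; rewrite setYC setYCT prT; lra.
- by left; move: K1; rewrite setYK pr0; lra.
Qed.

Lemma pr_setY_I d (T : measurableType d) (Q : probability T R) (A B : set T) :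
  measurable A -> measurable B -> pr Q (A `+` B) = pr Q A + pr Q B - 2 * pr Q (A `&` B).
Proof.
move=> mA mB; rewrite pr_setYE//.
by have := prID Q mA mB; have := prID Q mB mA; rewrite (setIC B A); lra.
Qed.

(** Summable, so that the copies converge, and at most 1/64, so that being close and being nearly
    complementary exclude each other. *)
Definition radius (n : nat) : R := 2^-1 ^+ n / 64.

Lemma radius_gt0 n : 0 < radius n.
Proof. by rewrite divr_gt0// exprn_gt0// invr_gt0. Qed.

Lemma radius_le n : radius n <= 1 / 64.
Proof. by rewrite ler_pM2r ?invr_gt0// exprn_ile1// ?invr_ge0// invf_le1// ler1n. Qed.

Section asymptotically_invariant.
Variable b : mp_action R G.
Hypotheses (ab : weakly_contained pointed_action b) (ba : weakly_contained b pointed_action).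
Hypothesis nam : ~ amenable R G.
Notation Q := (act_measure b).

Lemma asymptotically_invariant_sets : exists B : nat -> set (act_space b),
  [/\ forall n, measurable (B n),
      forall n, `|pr Q (B n) - 1 / 2| <= radius n,
      forall n i, (i < n)%N -> pr Q (B n `+` act b (e' i) @^-1` (B n)) <= radius n &
      forall n m, pr Q (B n `+` B m) <= 2 * (radius n + radius m) \/
                  1 - 2 * (radius n + radius m) <= pr Q (B n `+` B m)].
Proof.
have /choice[F0 /choice[eps0 gapP]] (n : nat) := spectral_gap eK eK' nam (radius_gt0 n).
(* The identity makes the measure of a single copy readable, [F0 n] feeds the spectral gap, and the
   first [n] group elements give invariance in the limit. *)
pose F n := 1%g :: F0 n ++ map e' (iota 0 n).
pose eps n := Num.min (eps0 n) (radius n).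
have eps_gt0 n : 0 < eps n by rewrite lt_min (gapP n).1 radius_gt0.
have eps_rad n : eps n <= radius n by rewrite ge_min lexx orbT.
have eps_eps0 n : eps n <= eps0 n by rewrite ge_min lexx.
have /choice[B BP] (n : nat) : exists B : set (act_space b), measurable B /\
    forall g, g \in F n -> `|1 / 2 - pr Q (B `&` act b g @^-1` B)| < eps n / 8.
  have e80 : 0 < eps n / 8 by rewrite divr_gt0.
  have [|B mB HB] := @weakly_contained_sets R G pointed_action b unit (fun=> A0) (F n) _ ab _ e80.
    by move=> _; exact: measurable_heads0.
  exists (B tt); split => // g gF.
  have : `|pr P (A0 `&` A0) - pr Q (B tt `&` act b g @^-1` B tt)| < eps n / 8 := HB g gF tt tt.
  by rewrite setIid pr_A0.
have mB n : measurable (B n) := (BP n).1.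
have F1 n : 1%g \in F n by rewrite inE eqxx.
have actb1 (C : set (act_space b)) : act b 1%g @^-1` C = C.
  by apply/seteqP; split => x /=; rewrite act_one.
have B2 n : `|1 / 2 - pr Q (B n)| < eps n / 8.
  by have := (BP n).2 1%g (F1 n); rewrite actb1 setIid.
have Binv n g : g \in F n -> pr Q (B n `+` act b g @^-1` (B n)) <= eps n / 2.
  move=> gF; rewrite act_invariantY//; have := (BP n).2 g gF; have := B2 n.
  by rewrite !ltr_norml => /andP[a1 a2] /andP[a3 a4]; lra.
exists B; split => //.
- by move=> n; rewrite distrC ltW// (lt_le_trans (B2 n))//; have := eps_rad n; have := eps_gt0 n; lra.
- move=> n i iltn; apply: le_trans (Binv n _ _) _.
    by rewrite inE mem_cat map_f ?orbT// mem_iota.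
  by have := eps_rad n; have := eps_gt0 n; lra.
(* [B n] and [B m] are copied back together, so that their mutual distance is preserved as well. *)
move=> n m; pose ep := Num.min (eps n) (eps m) / 16.
have ep0 : 0 < ep by rewrite divr_gt0// lt_min !eps_gt0.
have epn : ep <= eps n / 16 by rewrite ler_pM2r ?invr_gt0// ge_min lexx.
have epm : ep <= eps m / 16 by rewrite ler_pM2r ?invr_gt0// ge_min lexx orbT.
pose BB (c : bool) := if c then B n else B m.
have [|A mA HA] := @weakly_contained_sets R G b pointed_action bool BB (F n ++ F m) _ ba _ ep0.
  by case; exact: mB.
have F1' : 1%g \in F n ++ F m by rewrite mem_cat F1.
have HI c c' : `|pr Q (BB c `&` BB c') - pr P (A c `&` A c')| < ep.
  have := HA _ F1' c c'; rewrite actb1.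
  rewrite (_ : act pointed_action 1%g @^-1` A c' = A c')//.
  by apply/seteqP; split => x /=; rewrite coin_act1//; exact: pointed_shift1.
have nearby (c : bool) (k : nat) : BB c = B k -> {subset F k <= F n ++ F m} ->
    ep <= eps k / 16 -> exists2 Z, Z = A0 \/ Z = ~` A0 & pr P (A c `+` Z) <= radius k.
  move=> BBk Fk epk; have := HI c c; rewrite !setIid BBk ltr_norml => /andP[c1 c2].
  have := B2 k; rewrite ltr_norml => /andP[c3 c4].
  have := eps_rad k; have := radius_le k; have := eps_gt0 k => k1 k2 k3.
  have [g gF|Z ZZ AZ] := (gapP k).2 (A c) (mA c).
    have gFk : g \in F k by rewrite inE mem_cat gF orbT.
    have -> : pr P (A c `+` act1 g @^-1` A c) = 2 * (pr P (A c) - pr P (A c `&` act1 g @^-1` A c)).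
      exact: (@act_invariantY R G pointed_action g).
    have : `|pr Q (BB c `&` act b g @^-1` BB c) - pr P (A c `&` act1 g @^-1` A c)| < ep :=
      HA g (Fk g gFk) c c.
    rewrite BBk; have := (BP k).2 g gFk.
    by rewrite !ltr_norml => /andP[c5 c6] /andP[c7 c8]; have := eps_eps0 k; lra.
  exists Z => //; apply: near_A0 ZZ AZ => //; last lra.
  by rewrite ltr_norml; apply/andP; split; lra.
have [|Z ZA0 AZ] := nearby true n erefl _ epn; first by move=> g gF; rewrite mem_cat gF.
have [|Z' ZA0' AZ'] := nearby false m erefl _ epm; first by move=> g gF; rewrite mem_cat gF orbT.
(* The measure of a symmetric difference combines three intersections with coefficients 1, 1 and -2,
   hence the error [4 * ep]. *)
have close : `|pr Q (B n `+` B m) - pr P (A true `+` A false)| <= 4 * ep.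
  rewrite !pr_setY_I//; have := HI true true; have := HI false false; have := HI true false.
  rewrite !setIid !ltr_norml /BB => /andP[c1 c2] /andP[c3 c4] /andP[c5 c6].
  by rewrite ler_norml; apply/andP; split; lra.
move: close; rewrite ler_norml => /andP[c1 c2].
have := eps_rad n; have := eps_gt0 n; have := radius_gt0 n; have := radius_gt0 m => r1 r2 r3 r4.
by have [D|D] := dichotomy_A0 (mA true) (mA false) ZA0 ZA0' AZ AZ'; [left|right]; lra.
Qed.

Lemma not_ergodic : ~ ergodic b.
Proof.
move=> erg; have [B [mB B2 Binv Bdich]] := asymptotically_invariant_sets.
(* Passing to complements preserves the invariance estimates and puts all copies on the same side as
   [B 0]. The far alternative of the dichotomy is thereby excluded for every pair. *)
pose C n := if pr Q (B n `+` B 0%N) <= 1 / 2 then B n else ~` B n.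
have mC n : measurable (C n) by rewrite /C; case: ifP => // _; exact: measurableC.
have CB n : C n = B n \/ C n = ~` B n by rewrite /C; case: ifP => _; [left|right].
have r0 n : 0 < radius n by exact: radius_gt0.
have r1 n : radius n <= 1 / 64 by exact: radius_le.
have Cdich n m : pr Q (C n `+` C m) <= 2 * (radius n + radius m) \/
                  1 - 2 * (radius n + radius m) <= pr Q (C n `+` C m).
  case: (CB n) => ->; case: (CB m) => ->; rewrite ?prYC ?prY_setCr// 1?(setYC (~` _)) ?prY_setCr//.
  - by case: (Bdich n m); [right|left]; lra.
  - by rewrite (setYC (B m)); case: (Bdich n m); [right|left]; lra.
have C0 n : pr Q (C n `+` B 0%N) <= 1 / 16.
  have := r1 0%N; have := r1 n => rn r00; rewrite /C; case: ifP => [H|/negbT].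
    by case: (Bdich n 0%N); lra.
  by rewrite -ltNge => H; rewrite setYC prY_setCr// setYC; case: (Bdich n 0%N); lra.
have CC n m : pr Q (C n `+` C m) <= 2 * (radius n + radius m).
  have := r1 n; have := r1 m => rm rn; case: (Cdich n m) => //.
  have := prY_triangle Q (mC n) (mB 0%N) (mC m); have := C0 n; have := C0 m.
  rewrite (setYC (B 0%N) (C m)); lra.
have rS n : radius n.+1 <= radius n.
  by rewrite /radius exprS; have : 0 <= 2^-1 ^+ n :> R by []; lra.
have fast n : pr Q (C n `+` C n.+1) <= 16^-1 * 2^-1 ^+ n.
  by apply: le_trans (CC n n.+1) _; have := rS n; rewrite /radius; lra.
have [D mD DC] := fast_cauchy_sets mC fast.
have Cinv n i : (i < n)%N -> pr Q (C n `+` act b (e' i) @^-1` (C n)) <= radius n.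
  move=> iltn; case: (CB n) => ->; first exact: Binv.
  by rewrite preimage_setC prYC; exact: Binv.
have Dinv g : pr Q (D `+` act b g @^-1` D) = 0.
  apply/eqP; rewrite eq_le pr_ge0 andbT; apply/ler_addgt0Pl => ep ep0; rewrite addr0.
  have /cvgrPdist_lt /(_ ep ep0)[N _ HN] :=
    @cvg_expr R (2^-1) ltac:(by rewrite ger0_norm ?invr_ge0// invf_lt1// ltr1n).
  pose n := maxn N (e g).+1; have := HN n (leq_maxl _ _).
  rewrite sub0r normrN ger0_norm ?exprn_ge0 ?invr_ge0// => ne.
  have := Cinv n (e g) (leq_maxr _ _); rewrite eK => gC.
  have mgD := measurable_act g mD; have mgC := measurable_act g (mC n).
  have := prY_triangle Q mD (mC n) mgD; have := prY_triangle Q (mC n) mgC mgD.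
  have -> : pr Q (act b g @^-1` C n `+` act b g @^-1` D) = pr Q (C n `+` D).
    by rewrite -[RHS](pr_act g)//; exact: measurableY.
  rewrite (setYC D (C n)); have := DC n; move: gC; rewrite /radius; lra.
(* [C 0] is [B 0], of measure within 1/64 of 1/2, and the limit is within 1/8 of it. *)
have D2 : `|pr Q D - 1 / 2| < 1 / 2.
  have := pr_dist Q (mC 0%N) mD; have := DC 0%N; have := B2 0%N; have := r1 0%N.
  have -> : C 0%N = B 0%N by rewrite /C setYK pr0 ifT//; lra.
  rewrite expr0 !ler_norml ltr_norml => u1 /andP[u2 u3] u4 /andP[u5 u6].
  by apply/andP; split; lra.
move: D2; rewrite ltr_norml => /andP[D2 D2'].
by case: (@ae_invariant_ergodic R G b e' D (fun g => ex_intro _ (e g) (eK g)) erg mD Dinv); lra.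
Qed.

End asymptotically_invariant.

Lemma nonamenable_witness : ~ amenable R G -> exists a : mp_action R G,
  free_action a /\ forall b : mp_action R G, ergodic b -> ~ weakly_equivalent a b.
Proof.
move=> nam; exists pointed_action; split; first exact: pointed_action_free.
by move=> b erg [ab ba]; exact: (not_ergodic ab ba nam erg).
Qed.

End nonamenable.

(** * Hall's theorem and Folner sets *)

Section hall.
Variables I V : choiceType.
Implicit Types (A : I -> {fset V}) (J : {fset I}).
Local Open Scope fset_scope.
Local Open Scope nat_scope.

Definition nbrs A J : {fset V} := \bigcup_(i <- J) A i.

Definition hall A := forall J, #|` J| <= #|` nbrs A J|.

Definition upd A i (S : {fset V}) : I -> {fset V} := fun j => if j == i then S else A j.

Lemma mem_nbrs A J v : reflect (exists2 i, i \in J & v \in A i) (v \in nbrs A J).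
Proof.
apply: (iffP (bigfcupP _ _ _ _)) => [[i /andP[iJ _] vi]|[i iJ vi]]; exists i => //.
by rewrite iJ.
Qed.

(** A set violating Hall's condition after the removal must contain [i]; [J] is that set without
    [i]. *)
Lemma hall_remove A i x : hall A -> ~ hall (upd A i (A i `\ x)) ->
  exists2 J, i \notin J & #|` nbrs A J `|` (A i `\ x)| <= #|` J|.
Proof.
move=> hA /existsNP[J /negP]; rewrite -ltnNge => cJ.
have iJ : i \in J.
  apply: contraLR cJ => iJ; rewrite -leqNgt; apply: leq_trans (hA J) _.
  apply: fsubset_leq_card; apply/fsubsetP => v /mem_nbrs[j jJ vj].
  apply/mem_nbrs; exists j => //; rewrite /upd; case: eqP => // ji.
  by rewrite -ji jJ in iJ.
exists (J `\ i); first by rewrite !inE eqxx.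
rewrite (cardfsD1 i J) iJ add1n ltnS in cJ; apply: leq_trans cJ.
apply: fsubset_leq_card; apply/fsubsetP => v; rewrite inE => /orP[/mem_nbrs[j]|vi].
  rewrite !inE => /andP[ji jJ] vj; apply/mem_nbrs; exists j => //.
  by rewrite /upd (negbTE ji).
by apply/mem_nbrs; exists i; rewrite // /upd eqxx.
Qed.

(* If neither removal were possible, submodularity of [#|` nbrs A J|] would
   produce a violation of Hall's condition for [A] itself. *)
Lemma hall_remove2 A i x y : hall A -> x != y ->
  hall (upd A i (A i `\ x)) \/ hall (upd A i (A i `\ y)).
Proof.
move=> hA xy; apply: contrapT => /not_orP[/(hall_remove hA)[J iJ cJ] /(hall_remove hA)[K iK cK]].
have cU : (#|` J `|` K|).+1 <= #|` (nbrs A J `|` (A i `\ x)) `|` (nbrs A K `|` (A i `\ y))|.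
  have -> : (#|` J `|` K|).+1 = #|` i |` (J `|` K)|.
    by rewrite cardfsU1 inE negb_or iJ iK add1n.
  apply: leq_trans (hA _) _; apply: fsubset_leq_card; apply/fsubsetP => v /mem_nbrs[j].
  rewrite !inE => /or3P[/eqP-> vi|jJ vj|jK vj].
  - by rewrite vi !andbT; case: (eqVneq v x) => [->|]; rewrite ?xy ?orbT.
  - by apply/orP; left; apply/orP; left; apply/mem_nbrs; exists j.
  - by apply/orP; right; apply/orP; left; apply/mem_nbrs; exists j.
have cI : #|` J `&` K| <= #|` (nbrs A J `|` (A i `\ x)) `&` (nbrs A K `|` (A i `\ y))|.
  apply: leq_trans (hA _) _; apply: fsubset_leq_card; apply/fsubsetP => v /mem_nbrs[j].
  rewrite !inE => /andP[jJ jK] vj.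
  by apply/andP; split; apply/orP; left; apply/mem_nbrs; exists j.
have := cardfsUI J K; have := cardfsUI (nbrs A J `|` (A i `\ x)) (nbrs A K `|` (A i `\ y)).
lia.
Qed.

Lemma hall_gt0 A i : hall A -> 0 < #|` A i|.
Proof.
move=> /(_ [fset i]); rewrite cardfs1; rewrite (_ : nbrs A [fset i] = A i)//.
by rewrite /nbrs big_seq_fset1.
Qed.

Lemma hall_shrink A i : hall A -> exists A', [/\ hall A', forall j, A' j `<=` A j,
  #|` A' i| = 1%N & forall j, j != i -> A' j = A j].
Proof.
move: {2}(#|` A i|) (leqnn #|` A i|) => n; elim: n A => [|n IH] A An hA.
  by have := hall_gt0 i hA; rewrite ltnNge An.
have [/eqP c1|cN1] := boolP (#|` A i| == 1%N).
  by exists A; split => // j; exact: fsubset_refl.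
have c2 : 1 < #|` A i| by rewrite ltn_neqAle eq_sym cN1 hall_gt0.
have [x xi] : exists x, x \in A i by apply/fset0Pn; rewrite -cardfs_gt0 ltnW.
have [y] : exists y, y \in A i `\ x.
  by apply/fset0Pn; rewrite -cardfs_gt0; move: c2; rewrite (cardfsD1 x) xi.
rewrite !inE => /andP[yx yi].
have step z : z \in A i -> hall (upd A i (A i `\ z)) -> exists A', [/\ hall A', forall j, A' j `<=` A j,
    #|` A' i| = 1%N & forall j, j != i -> A' j = A j].
  move=> zi hz; have [|A' [hA' sA' cA' eA']] := IH _ _ hz.
    by rewrite /upd eqxx; move: An; rewrite (cardfsD1 z) zi.
  exists A'; split => // j.
    apply: fsubset_trans (sA' j) _; rewrite /upd; case: eqP => [->|_]; last exact: fsubset_refl.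
    exact: fsubsetDl.
  by move=> ji; rewrite eA'// /upd (negbTE ji).
by have [hx|hy] := hall_remove2 i hA yx; [exact: step hx|exact: step hy].
Qed.

(** Shrink the sets to singletons one index at a time, keeping Hall's condition. A singleton stays
    unchanged later, since Hall's condition forbids emptiness; applied to a pair of indices at a
    late stage, it gives injectivity. *)
Theorem hall_countable A (e : nat -> I) : (forall i, exists n, e n = i) -> hall A ->
  exists2 f : I -> V, injective f & forall i, f i \in A i.
Proof.
move=> esurj hA.
have /choice[sh shP] (Ai : (I -> {fset V}) * I) : exists A', hall Ai.1 ->
    [/\ hall A', forall j, A' j `<=` Ai.1 j, #|` A' Ai.2| = 1%N & forall j, j != Ai.2 -> A' j = Ai.1 j].
  have [h|nh] := pselect (hall Ai.1); last by exists Ai.1.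
  by have [A' H] := hall_shrink Ai.2 h; exists A'.
pose AA := fix AA n := if n is m.+1 then sh (AA m, e m) else A.
have hAA n : hall (AA n).
  by elim: n => //= n IH; have [] := shP (AA n, e n) IH.
have sAA n i : AA n.+1 i `<=` AA n i by have [_ + _ _] := shP (AA n, e n) (hAA n); apply.
have sAAm m n i : m <= n -> AA n i `<=` AA m i.
  move=> /subnK <-; elim: (n - m) => [|k IH]; first exact: fsubset_refl.
  exact: fsubset_trans (sAA _ _) IH.
have /choice[idx idxP] i : exists n, e n = i by exact: esurj.
have single i : exists v, AA (idx i).+1 i = [fset v].
  by apply/cardfs1P; have [_ _ + _] := shP (AA (idx i), e (idx i)) (hAA _); rewrite /= idxP => ->.
have /choice[f fP] := single.
have AAf n i : idx i < n -> AA n i = [fset f i].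
  move=> iltn; have := sAAm _ _ i iltn; rewrite fP fsubset1 => /orP[/eqP//|/eqP A0].
  by have := hall_gt0 i (hAA n); rewrite A0 cardfs0.
exists f => [i j fij|i]; last first.
  by apply: (fsubsetP (sAAm 0 (idx i).+1 i (leq0n _))); rewrite fP inE.
apply/eqP; apply: contraT => ij.
pose n := (maxn (idx i) (idx j)).+1.
have := hAA n [fset i; j]; rewrite cardfs2 ij.
rewrite (_ : nbrs _ _ = [fset f i]) ?cardfs1//.
apply/fsetP => v; rewrite inE; apply/mem_nbrs/eqP => [[k]|->]; last first.
  by exists i; rewrite ?inE ?eqxx// AAf ?inE// ltnS leq_maxl.
rewrite !inE => /orP[]/eqP->; rewrite AAf ?inE ?ltnS ?leq_maxl ?leq_maxr// => /eqP//.
by rewrite -fij.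
Qed.

End hall.

Section folner.
Context (R : realType) (G : groupType).
Implicit Types (K T : {fset G}).
Local Open Scope fset_scope.
Local Open Scope ring_scope.

Definition mulF K T : {fset G} := \bigcup_(k <- K) [fset (k * t)%g | t in T].

Lemma mem_mulF K T x : reflect (exists2 k, k \in K & (k^-1 * x)%g \in T) (x \in mulF K T).
Proof.
apply: (iffP (bigfcupP _ _ _ _)) => [[k /andP[kK _] /imfsetP[t tT ->]]|[k kK kT]].
  by exists k => //; rewrite mulKg.
by exists k; rewrite ?kK//; apply/imfsetP; exists (k^-1 * x)%g; rewrite // mulVKg.
Qed.

Lemma mulFA K L T : mulF (mulF K L) T = mulF K (mulF L T).
Proof.
apply/fsetP => x; apply/mem_mulF/mem_mulF.
  move=> [y /mem_mulF[k kK ky] yx]; exists k => //; apply/mem_mulF; exists (k^-1 * y)%g => //.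
  by rewrite invgM invgK -mulgA mulVKg.
move=> [k kK /mem_mulF[l lL lx]]; exists (k * l)%g; last by rewrite invgM -mulgA.
by apply/mem_mulF; exists k; rewrite ?mulKg.
Qed.

Lemma mulF1 T : mulF [fset 1%g] T = T.
Proof.
apply/fsetP => x; apply/mem_mulF/idP => [[k]|xT].
  by rewrite inE => /eqP ->; rewrite invg1 mul1g.
by exists 1%g; rewrite ?inE// invg1 mul1g.
Qed.

Definition boundary (K : seq G) T : {fset G} := [fset t in T | has (fun k => (k * t)%g \notin T) K].

(** Each [k] carries the boundary points that it expels injectively into [mulF S T] outside [T]. The
    form with sums avoids truncated subtraction. *)
Lemma card_boundary (K : seq G) T (S : {fset G}) : 1%g \in S -> {subset K <= S} ->
  (#|` boundary K T| + size K * #|` T| <= size K * #|` mulF S T|)%N.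
Proof.
move=> S1 KS.
have TS : T `<=` mulF S T.
  by apply/fsubsetP => t tT; apply/mem_mulF; exists 1%g; rewrite ?invg1 ?mul1g.
suff : (#|` boundary K T| <= size K * #|` mulF S T `\` T|)%N.
  rewrite cardfsDS// mulnBr => H.
  have := leq_mul (leqnn (size K)) (fsubset_leq_card TS); lia.
have : boundary K T `<=` \bigcup_(k <- K) [fset (k^-1 * y)%g | y in mulF S T `\` T].
  apply/fsubsetP => t; rewrite !inE /= => /andP[tT /hasP[k kK ktT]].
  apply/bigfcupP; exists k; rewrite ?kK//; apply/imfsetP; exists (k * t)%g; last by rewrite mulKg.
  by rewrite /= !inE ktT/=; apply/mem_mulF; exists k; [exact: KS|rewrite mulKg].
move=> /fsubset_leq_card /leq_trans; apply.
elim: (K) => [|k L IH]; first by rewrite big_nil cardfs0.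
rewrite big_cons /= mulSn; apply: leq_trans (leq_card_fsetU _ _) _.
by apply: leq_add => //; apply: leq_trans (leq_imfset_card _ _ _) _.
Qed.

Lemma mean_seq (m : set G -> R) (I : eqType) (s : seq I) (E : I -> set G) : mean m ->
  uniq s -> (forall i j, i \in s -> j \in s -> i != j -> E i `&` E j = set0)%classic ->
  m (\big[setU/set0]_(i <- s) E i)%classic = \sum_(i <- s) m (E i).
Proof.
move=> [m0 m1 mU]; have mset0 : m set0 = 0.
  by have := mU set0 set0 (setI0 _); rewrite setU0; lra.
elim: s => [|i s IH] /= => [_ _|/andP[nis us] dE]; first by rewrite !big_nil.
rewrite !big_cons mU ?IH//.
  by move=> j k js ks; apply: dE; rewrite inE ?js ?ks orbT.
rewrite big_distrr/= big_seq big1// => j js.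
by apply: dE; rewrite ?inE ?eqxx ?js ?orbT//; apply: contraNneq nis => ->.
Qed.

Lemma amenable_not_doubling (e : nat -> G) (S : {fset G}) : (forall g, exists n, e n = g) ->
  amenable R G -> ~ forall T, (2 * #|` T| <= #|` mulF S T|)%N.
Proof.
move=> esurj [m [m0 m1 mU mG]] dbl; have mm : mean m by split.
(* Every group element claims two representatives in its own right translate of [S]; doubling is
   exactly Hall's condition for these claims. *)
have [f finj fS] : exists2 f : G * bool -> G, injective f &
    forall p, f p \in mulF S [fset p.1].
  apply: (@hall_countable _ _ (fun p : G * bool => mulF S [fset p.1])
           (fun n => (e n./2, odd n))).
    move=> [g b]; have [n en] := esurj g; exists (b + n.*2)%N.
    by rewrite half_bit_double en oddD odd_double addbF; case: b.
  move=> J; pose J1 := [fset p.1 | p in J].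
  have JJ : (#|` J| <= 2 * #|` J1|)%N.
    have JU : J `<=` [fset (g, true) | g in J1] `|` [fset (g, false) | g in J1].
      apply/fsubsetP => -[g b] gJ; rewrite inE.
      have gJ1 : g \in J1 by apply/imfsetP; exists (g, b).
      by apply/orP; case: b {gJ} => [|]; [left|right]; apply/imfsetP; exists g.
    apply: leq_trans (fsubset_leq_card JU) _; apply: leq_trans (leq_card_fsetU _ _) _.
    by rewrite mul2n -addnn leq_add// (leq_trans (leq_imfset_card _ _ _)).
  apply: leq_trans JJ _; apply: leq_trans (dbl J1) _; apply: fsubset_leq_card.
  apply/fsubsetP => x /mem_mulF[k kS /imfsetP[p pJ kx]]; apply/mem_nbrs; exists p => //.
  by apply/mem_mulF; exists k; rewrite // kx inE.
(* For each value of the boolean, the sets [E (k, b)] with [k] in [S] partition the group, so their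
   means add up to 1. Injectivity of [f] makes the translates by [k] disjoint over all pairs, so an
   invariant mean would give 2 at most 1. *)
pose E (p : G * bool) : set G := [set g | f (g, p.2) = (p.1 * g)%g].
pose s : seq (G * bool) := [seq (k, b) | k <- S, b <- [:: true; false]].
have us : uniq s by apply: allpairs_uniq => [||[k c] [l d] _ _ /=]; [exact: fset_uniq|by []|].
have dis p q : p \in s -> q \in s -> p != q -> (ltrans p.1 (E p) `&` ltrans q.1 (E q) = set0)%classic.
  move=> _ _ pq; apply/seteqP; split => // x [[g Eg <-] [h Eh hg]]; move/eqP: pq; apply.
  have : f (g, p.2) = f (h, q.2) by rewrite Eg Eh hg.
  move=> /finj[gh]; case: p q Eg Eh hg => p b [q c] /= _ _; rewrite gh => /mulIg -> ->; by [].
have := mean_le1 (\big[setU/set0]_(p <- s) ltrans p.1 (E p))%classic mm.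
rewrite (mean_seq mm us dis).
under eq_bigr do rewrite /ltrans mG.
rewrite big_allpairs_dep/= (eq_bigr (fun k => m (E (k, true)) + m (E (k, false)))); last first.
  by move=> k _; rewrite !big_cons big_nil addr0.
rewrite big_split/=.
have full b : \sum_(k <- S) m (E (k, b)) = 1.
  rewrite -(mean_seq (E := fun k => E (k, b)) mm (fset_uniq S)); last first.
    move=> k l _ _ kl; apply/seteqP; split => // g [Ek El].
    have /mulIg klE : (k * g = l * g)%g by rewrite -[LHS]Ek.
    by rewrite klE eqxx in kl.
  rewrite -m1; congr m; apply/seteqP; split => // g _.
  have /mem_mulF[k kS] := fS (g, b); rewrite inE => /eqP kf.
  by rewrite -bigcup_seq; exists k => //; apply: (@mulgI _ k^-1%g); rewrite mulKg.
rewrite !full; lra.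
Qed.

(** If every nonempty finite set has a large boundary, multiplication by [S] enlarges finite sets by
    the factor [q > 1]. By Bernoulli's inequality some power of [S] then doubles them, against
    [amenable_not_doubling]. *)
Lemma folner (e : nat -> G) (K : seq G) (eps : R) : (forall g, exists n, e n = g) ->
  amenable R G -> 0 < eps ->
  exists2 T : {fset G}, T != fset0 & #|` boundary K T|%:R <= eps * #|` T|%:R.
Proof.
move=> esurj am eps0; apply: contrapT => nof.
have bd T : T != fset0 -> eps * #|` T|%:R < #|` boundary K T|%:R.
  by move=> T0; rewrite ltNge; apply/negP => H; apply: nof; exists T.
pose S := 1%g |` [fset k in K].
have S1 : 1%g \in S by rewrite !inE eqxx.
have KS : {subset K <= S} by move=> k kK; rewrite !inE kK orbT.
have K0 : 0 < (size K)%:R :> R.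
  rewrite ltr0n lt0n; apply/negP => /nilP K0; have := bd [fset 1%g].
  rewrite -cardfs_gt0 cardfs1 => /(_ isT); apply/negP; rewrite -leNgt.
  rewrite (_ : boundary K _ = fset0) ?cardfs0 ?mulr1 ?ltW//.
  by apply/fsetP => t; rewrite !inE K0 /= andbF.
pose q := 1 + eps / (size K)%:R.
have grow T : q * #|` T|%:R <= #|` mulF S T|%:R.
  have [->|T0] := eqVneq T fset0; first by rewrite cardfs0 mulr0.
  have := card_boundary T S1 KS; rewrite -(ler_nat R) natrD !natrM.
  have := bd T T0; rewrite /q => b1 b2.
  rewrite -(ler_pM2l K0) mulrA mulrDr mulr1 mulrCA mulfV ?mulr1 ?gt_eqF// mulrDl; lra.
pose P := fix P n := if n is n'.+1 then mulF S (P n') else [fset 1%g].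
have growP n T : q ^+ n * #|` T|%:R <= #|` mulF (P n) T|%:R.
  elim: n => [|n IH]; first by rewrite expr0 mul1r mulF1.
  rewrite /= mulFA exprS -mulrA; apply: le_trans (grow _).
  rewrite ler_wpM2l//; rewrite /q addr_ge0// divr_ge0// ltW//.
have [n qn] : exists n, 2 <= q ^+ n.
  have d0 : 0 < eps / (size K)%:R by rewrite divr_gt0.
  have bern n : 1 + (eps / (size K)%:R) *+ n <= q ^+ n.
    elim: n => [|n IH]; first by rewrite mulr0n addr0 expr0.
    rewrite exprS mulrS /q; move: IH; rewrite -/q; set x := eps / _ in d0 *; set y := x *+ n.
    have y0 : 0 <= y by rewrite mulrn_wge0// ltW.
    rewrite /q -/x; move: (_ ^+ n) => z yz; nra.
  have [n] : exists n, 1 <= (eps / (size K)%:R) *+ n.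
    have := archi_boundP (ltW (divr_gt0 ltr01 d0)); set n := Num.Def.archi_bound _ => nb.
    by exists n; rewrite -mulr_natl -ler_pdivrMr// ltW.
  by move=> dn; exists n; have := bern n; lra.
apply: (amenable_not_doubling (S := P n) esurj am) => T.
rewrite -(ler_nat R) natrM; apply: le_trans (growP n T).
by rewrite ler_wpM2r.
Qed.

End folner.

(** * Free actions *)

Section separating.
Context (R : realType) d (T : measurableType d).

Lemma standard_borel_separating : standard_borel R T ->
  exists2 U : nat -> set T, forall n, measurable (U n) &
    forall x y, x <> y -> exists n, U n x /\ ~ U n y.
Proof.
move=> [M [f [_ [B cB [Bo Bb]] bf mf]]].
have finj : injective f by exact: bij_inj.
have [U0 BU] : exists U0 : nat -> set M, forall A, A !=set0 -> B A -> exists n, U0 n = A.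
  have /countable_injP[h hinj] := cB.
  (* Indices that code no base element yield the default; [U] replaces a value outside the base by
     the empty set. *)
  exists (fun n => xget set0 [set A | B A /\ h A = n]) => A _ BA; exists (h A).
  case: xgetP => [A' _ [BA' hA']|/(_ A)]; last by case; split.
  by apply: hinj => //; rewrite inE.
pose U n := f @^-1` (if `[< B (U0 n) >] then U0 n else set0).
exists U => [n|x y xy].
  apply/mf; case: asboolP => [BUn|_]; last first.
    by have [] := smallest_sigma_algebra setT [set V : set M | open V].
  by apply: sub_sigma_algebra; exact: Bo.
have fxy : f x != f y by apply/eqP => /finj.
have dxy : 0 < mdist (f x) (f y) by rewrite mdist_gt0.
have /Bb : nbhs (f x) (ball (f x) (mdist (f x) (f y))) by exact: nbhsx_ballx.
move=> [V [BV Vx] Vball]; have [n nV] := BU V (ex_intro _ _ Vx) BV.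
exists n; rewrite /U /= nV; case: asboolP => // _; split => // /Vball.
by rewrite ballEmdist/= ltxx.
Qed.

End separating.

Section free_cells.
Context (R : realType) (G : groupType) (b : mp_action R G).
Hypothesis free : free_action b.
Notation Y := (act_space b).
Notation Q := (act_measure b).

(** [P] is the base of a Rokhlin tower with levels indexed by [I]. *)
Definition tower_base (I : Type) (t : I -> G) (P : set Y) :=
  forall i j x y, i <> j -> P x -> P y -> act b (t i) x <> act b (t j) y.

Lemma tower_baseS (I : Type) (t : I -> G) (P P' : set Y) :
  P' `<=` P -> tower_base t P -> tower_base t P'.
Proof. by move=> P'P tP i j x y ij /P'P Px /P'P Py; exact: tP. Qed.

(** By freeness almost every point has distinct images under the [t i], and a countable family [U]
    separates them; finitely many [U k] suffice off a small set. A cell records which images lie in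
    which [U k], so on one cell the images under different [t i] are told apart even for different
    points. *)
Lemma free_cells (I : finType) (t : I -> G) (dl : R) : injective t -> 0 < dl ->
  exists (N : finType) (F : N -> set Y), [/\ forall v, measurable (F v),
    forall v w, v != w -> F v `&` F w = set0,
    forall v, tower_base t (F v) &
    1 - dl <= pr Q (\big[setU/set0]_v F v)].
Proof.
move=> tinj dl0; have [U mU sep] := standard_borel_separating (act_space_borel b).
pose sepn (n : nat) (i j : I) : set Y :=
  \big[setU/set0]_(k < n) ((act b (t i) @^-1` U k) `\` (act b (t j) @^-1` U k)).
pose D n : set Y := \big[setI/setT]_(p : I * I | p.1 != p.2) sepn n p.1 p.2.
have mtU i k : measurable (act b (t i) @^-1` U k) by exact: measurable_act.
have msep n i j : measurable (sepn n i j).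
  by apply: bigsetU_measurable => k _; apply: measurableD.
have mD n : measurable (D n) by apply: bigsetI_measurable => p _.
have DP n x : D n x <-> forall i j, i != j -> sepn n i j x.
  rewrite /D -bigcap_seq_cond; split => [H i j ij|H p /= /andP[_ ij]]; last exact: H.
  by apply: (H (i, j)); rewrite /= mem_index_enum.
have sepP n i j x : sepn n i j x <-> exists2 k, (k < n)%N & U k (act b (t i) x) /\ ~ U k (act b (t j) x).
  rewrite /sepn -bigcup_seq; split => [[k _ H]|[k kn H]]; first by exists k.
  by exists (Ordinal kn); rewrite /= ?mem_index_enum.
have sep_mono n m i j : (n <= m)%N -> sepn n i j `<=` sepn m i j.
  by move=> nm x /sepP[k kn H]; apply/sepP; exists k => //; exact: leq_trans nm.
have ndD : nondecreasing_seq D.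
  move=> n m nm; apply/subsetPset => x /DP H; apply/DP => i j ij.
  exact: sep_mono nm _ (H i j ij).
have DU : pr Q (\bigcup_n D n) = 1.
  have mDU : measurable (\bigcup_n D n) by exact: bigcupT_measurable.
  suff N0 : pr Q (~` \bigcup_n D n) = 0 by move: N0; rewrite prC//; lra.
  suff NU : Q.-negligible (~` \bigcup_n D n).
    by move: NU => /negligibleP => /(_ (measurableC mDU)); rewrite /pr => ->.
  apply: negligibleS free => x nDx /= frx; apply: nDx.
  have /choice[kk kkP] (p : I * I) : exists k, p.1 != p.2 ->
      U k (act b (t p.1) x) /\ ~ U k (act b (t p.2) x).
    case: (eqVneq p.1 p.2) => [|ij]; first by exists 0%N.
    have [|k Hk] := sep (act b (t p.1) x) (act b (t p.2) x); last by exists k.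
    move=> E; move/eqP: ij; apply; apply: tinj.
    have : act b ((t p.1)^-1 * t p.2)%g x = x by rewrite act_mul -E actK.
    by move=> /frx; move=> /(congr1 (fun g => (t p.1 * g)%g)); rewrite mulVKg mulg1.
  exists (\max_(p : I * I) kk p).+1 => //; apply/DP => i j ij; apply/sepP.
  exists (kk (i, j)); last exact: (kkP (i, j)).
  by rewrite ltnS (leq_bigmax (i, j)).
have [n Dn] := pr_cup_lim Q dl0 mD ndD.
pose N : finType := {ffun I * 'I_n -> bool}.
pose cell (v : N) : set Y := D n `&` \big[setI/setT]_(p : I * 'I_n)
  (if v p then act b (t p.1) @^-1` U p.2 else ~` (act b (t p.1) @^-1` U p.2)).
have cellP v x : cell v x <-> D n x /\ forall i (k : 'I_n), v (i, k) = `[< U k (act b (t i) x) >].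
  rewrite /cell -bigcap_seq; split => [[Dx H]|[Dx H]]; split => //.
    move=> i k; have := H (i, k) (mem_index_enum _).
    by case: (v (i, k)) => /= [/asboolT ->|/asboolF ->].
  by move=> [i k] _; rewrite /= H; case: asboolP.
exists N, cell; split.
- move=> v; apply: measurableI => //; apply: bigsetI_measurable => p _.
  by case: (v p) => //; exact: measurableC.
- move=> v w vw; apply/seteqP; split => // x [/cellP[_ H1] /cellP[_ H2]].
  by move/eqP: vw; apply; apply/ffunP => -[i k]; rewrite H1 H2.
- move=> v i j x y /eqP ij /cellP[/DP/(_ i j ij)/sepP[k kn [Ux nUx]] H1] /cellP[_ H2] E.
  have := H2 j (Ordinal kn); rewrite (H1 j (Ordinal kn)) /= -E.
  by rewrite (asboolT Ux) (asboolF nUx).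
have DC : D n `<=` \big[setU/set0]_v cell v.
  move=> x Dx; rewrite -bigcup_seq.
  exists [ffun p : I * 'I_n => `[< U p.2 (act b (t p.1) x) >]]; rewrite /= ?mem_index_enum//.
  by apply/cellP; split => // i k; rewrite ffunE.
apply: (@le_trans _ _ (pr Q (D n))); first by rewrite DU in Dn; lra.
apply: le_pr => //; apply: bigsetU_measurable => v _; apply: measurableI => //.
by apply: bigsetI_measurable => p _; case: (v p) => //; exact: measurableC.
Qed.

Lemma pr_tower_base (I : finType) (t : I -> G) (P : set Y) : measurable P ->
  tower_base t P -> #|I|%:R * pr Q P <= 1.
Proof.
move=> mP tP; have mt i : measurable (act b (t i)^-1 @^-1` P) by exact: measurable_act.
have mU : measurable (\big[setU/set0]_i (act b (t i)^-1 @^-1` P)) by apply: bigsetU_measurable.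
apply: le_trans (pr_le1 Q mU); rewrite (pr_bigcup Q) => //.
  by under eq_bigr do rewrite pr_act//; rewrite sumr_const mulr_natl.
move=> i j /eqP ij; apply/seteqP; split => // x [/= Pi Pj].
by have := tP i j _ _ ij Pi Pj; rewrite !actKV.
Qed.

(** This is nonatomicity: the base of a tower with [n.+1] levels has measure at most the inverse of
    [n.+1], and an infinite group provides towers of any height. *)
Lemma small_cells (e : nat -> G) (h : R) : injective e -> 0 < h ->
  exists (s : seq (set Y)), [/\ forall A, A \in s -> measurable A,
    forall A, A \in s -> pr Q A <= h & \big[setU/set0]_(A <- s) A = setT].
Proof.
move=> einj h0; have [n hn] : exists n, 1 <= n.+1%:R * h.
  have := archi_boundP (ltW (divr_gt0 ltr01 h0)); set n := Num.Def.archi_bound _ => nb.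
  by exists n; rewrite -ler_pdivrMr//; apply: (le_trans (ltW nb)); rewrite ler_nat.
pose t (i : 'I_n.+1) := e i.
have tinj : injective t by move=> i j /einj /val_inj.
have [N [F [mF dF tF cF]]] := free_cells tinj h0.
have mU : measurable (\big[setU/set0]_v F v) by apply: bigsetU_measurable.
exists (~` (\big[setU/set0]_v F v) :: [seq F v | v <- index_enum N]); split.
- move=> A; rewrite inE => /orP[/eqP->|/mapP[v _ ->]]; first exact: measurableC.
  exact: mF.
- move=> A; rewrite inE => /orP[/eqP->|/mapP[v _ ->]]; first by rewrite prC//; lra.
  have H := pr_tower_base (mF v) (tF v); rewrite card_ord in H.
  have n0 : 0 < n.+1%:R :> R by rewrite ltr0n.
  by rewrite -(ler_pM2l n0); exact: le_trans H hn.
- by rewrite big_cons big_map setvU.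
Qed.

(** Add the traces of small sets one by one and stop as soon as the measure is within [h] of [tau];
    no addition can overshoot. *)
Lemma approx_split (e : nat -> G) (P : set Y) (tau h : R) : injective e -> measurable P ->
  0 <= tau <= pr Q P -> 0 < h ->
  exists P', [/\ measurable P', P' `<=` P & tau - h <= pr Q P' <= tau].
Proof.
move=> einj mP /andP[tau0 tauP] h0.
have [s [ms hs Us]] := small_cells einj h0.
suff H (l : seq (set Y)) : {subset l <= s} -> exists P', [/\ measurable P', P' `<=` P,
    pr Q P' <= tau & tau - h <= pr Q P' \/ P' = P `&` \big[setU/set0]_(A <- l) A].
  have [P' [mP' sP' tP' [H1|H2]]] := H s (fun _ x => x).
    by exists P'; split => //; apply/andP.
  by exists P'; split => //; apply/andP; split => //; rewrite H2 Us setIT; lra.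
elim: l => [_|A l IH sl].
  by exists set0; split; rewrite ?pr0//; right; rewrite big_nil setI0.
have [|P' [mP' sP' tP' [H1|H2]]] := IH.
- by move=> B Bl; apply: sl; rewrite inE Bl orbT.
- by exists P'; split => //; left.
have [H3|H3] := leP (tau - h) (pr Q P'); first by exists P'; split => //; left.
have As : A \in s by apply: sl; rewrite inE eqxx.
have mA := ms A As; exists (P' `|` (P `&` A)); split.
- by apply: measurableU => //; exact: measurableI.
- by move=> x [/sP'//|[]].
- apply: le_trans (le_prU Q mP' (measurableI _ _ mP mA)) _.
  have := hs A As; have := le_pr Q (measurableI _ _ mP mA) mA (@subIsetr _ P A); lra.
- by right; rewrite H2 big_cons setIUr setUC.
Qed.

(** An increasing union of approximate solutions, the gap after step [n] being at most
    [2^-1 ^+ n]. *)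
Lemma exact_split (e : nat -> G) (P : set Y) (tau : R) : injective e -> measurable P ->
  0 <= tau <= pr Q P ->
  exists P', [/\ measurable P', P' `<=` P & pr Q P' = tau].
Proof.
move=> einj mP /andP[tau0 tauP].
have half0 n : 0 < 2^-1 ^+ n :> R by rewrite exprn_gt0// invr_gt0.
have /choice[st stP] (An : set Y * nat) : exists A', measurable An.1 -> An.1 `<=` P -> pr Q An.1 <= tau ->
    [/\ measurable A', An.1 `<=` A', A' `<=` P & tau - 2^-1 ^+ An.2 <= pr Q A' <= tau].
  case: An => A n /=.
  have [[mA [sA tA]]|H] := pselect (measurable A /\ A `<=` P /\ pr Q A <= tau); last first.
    by exists A => mA sA tA; exfalso; apply: H.
  have mPA : measurable (P `\` A) by exact: measurableD.
  have pPA : pr Q (P `\` A) = pr Q P - pr Q A by rewrite (prID Q mP mA) setIidr//; lra.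
  have [|E [mE sE /andP[E1 E2]]] := @approx_split e (P `\` A) (tau - pr Q A) (2^-1 ^+ n) einj mPA _ (half0 n).
    by rewrite pPA; apply/andP; split; lra.
  exists (A `|` E) => _ _ _.
  have pAE : pr Q (A `|` E) = pr Q A + pr Q E.
    by rewrite prU//; apply/seteqP; split => // x [Ax /sE[_]].
  split.
  - exact: measurableU.
  - by move=> x; left.
  - by move=> x [/sA//|/sE[]].
  - by rewrite pAE; apply/andP; split; lra.
pose AA := fix AA n := if n is m.+1 then st (AA m, m) else set0.
have AAP n : [/\ measurable (AA n), AA n `<=` P & pr Q (AA n) <= tau].
  elim: n => [|n [m1 m2 m3]]; first by split; rewrite /= ?pr0.
  by have [n1 n2 n3 /andP[n4 n5]] := stP (AA n, n) m1 m2 m3.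
have AAS n : AA n `<=` AA n.+1 /\ tau - 2^-1 ^+ n <= pr Q (AA n.+1).
  by have [m1 m2 m3] := AAP n; have [n1 n2 n3 /andP[n4 n5]] := stP (AA n, n) m1 m2 m3.
have ndA : nondecreasing_seq AA.
  by apply/nondecreasing_seqP => n; apply/subsetPset; case: (AAS n).
have mU : measurable (\bigcup_n AA n) by apply: bigcupT_measurable => n; case: (AAP n).
exists (\bigcup_n AA n); split => //.
  by move=> x [n _]; case: (AAP n) => _ + _; apply.
apply/eqP; rewrite eq_le; apply/andP; split.
  apply/ler_addgt0Pr => ep ep0.
  have [n] := pr_cup_lim Q ep0 (fun n => let: And3 m _ _ := AAP n in m) ndA.
  by case: (AAP n) => _ _; lra.
apply/ler_addgt0Pr => ep ep0.
have /cvgrPdist_lt /(_ ep ep0)[N _ /(_ N (leqnn N))] :=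
  @cvg_expr R (2^-1) ltac:(by rewrite ger0_norm ?invr_ge0// invf_lt1// ltr1n).
rewrite sub0r normrN ger0_norm ?(ltW (half0 _))// => Ne.
have := le_pr Q (let: And3 m _ _ := AAP N.+1 in m) mU (@bigcup_sup _ _ N.+1 setT AA Logic.I).
by case: (AAS N) => _; lra.
Qed.

Lemma weighted_split (e : nat -> G) (P : set Y) (W : finType) (al : W -> R) :
  injective e -> measurable P -> (forall w, 0 <= al w) -> \sum_w al w = 1 ->
  exists F : W -> set Y, [/\ forall w, measurable (F w), forall w, F w `<=` P,
    forall v w, v != w -> F v `&` F w = set0 & forall w, pr Q (F w) = al w * pr Q P].
Proof.
move=> einj mP al0 al1.
suff H (s : seq W) : uniq s -> exists F : W -> set Y, [/\ forall w, measurable (F w), forall w, F w `<=` P,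
    forall v w, v != w -> F v `&` F w = set0 & forall w, pr Q (F w) = (w \in s)%:R * al w * pr Q P].
  have [F [mF sF dF pF]] := H (index_enum W) (index_enum_uniq W).
  by exists F; split => // w; rewrite pF mem_index_enum mul1r.
elim: s => [_|w s IH /= /andP[ws us]].
  by exists (fun=> set0); split => // *; rewrite ?setI0 ?pr0 ?in_nil ?mul0r.
have [F [mF sF dF pF]] := IH us.
pose U := \big[setU/set0]_v F v.
have mU : measurable U by apply: bigsetU_measurable.
have UP : U `<=` P by rewrite /U -bigcup_seq => x [v _ /sF].
have pU : pr Q U = (\sum_(v <- s) al v) * pr Q P.
  rewrite /U pr_bigcup// (eq_bigr _ (fun v _ => pF v)) -mulr_suml; congr (_ * _).
  rewrite [RHS]big_uniq//= [RHS]big_mkcond; apply: eq_bigr => v _.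
  by case: (v \in s); rewrite ?mul1r ?mul0r.
have alws : al w + \sum_(v <- s) al v <= 1.
  rewrite -al1 (bigD1 w)//= lerD2l [leLHS]big_uniq//= [leRHS](bigID (mem s))/=.
  rewrite [X in _ <= X + _](eq_bigl (mem s)) ?lerDl ?sumr_ge0// => v.
  by rewrite /= andb_idl// => vs; apply: contraNneq ws => <-.
have mPU : measurable (P `\` U) by exact: measurableD.
have [|E [mE sE pE]] := @exact_split e (P `\` U) (al w * pr Q P) einj mPU _.
  have := prID Q mP mU; rewrite setIidr// pU; have := pr_ge0 Q P; have := al0 w.
  by move=> a0 p0 E; apply/andP; split; nra.
exists (fun v => if v == w then E else F v); split.
- by move=> v; case: eqP.
- by move=> v; case: eqP => // _ x /sE[].
- have EF v : E `&` F v = set0.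
    apply/seteqP; split => // x [/sE[_ nU] Fx]; apply: nU.
    by rewrite /U -bigcup_seq; exists v; rewrite /= ?mem_index_enum.
  move=> v v' vv'; case: (eqVneq v w) => [vw|_]; case: (eqVneq v' w) => [v'w|_] //.
  + by rewrite vw v'w eqxx in vv'.
  + by rewrite setIC.
  + exact: dF.
- move=> v; rewrite inE; case: eqP => [->|_]; first by rewrite mul1r.
  by rewrite pF.
Qed.

End free_cells.

(** * Copying colourings along tilings *)

Section copying.
Context (R : realType) (G : groupType) (b : mp_action R G).
Notation Y := (act_space b).
Notation Q := (act_measure b).
Variables (k : nat) (p : G -> 'I_k -> 'I_k -> R) (F : seq G) (eps : R).

(* [C] is the part of [Y] tiled so far, [B] a colouring of it, and [H f] the set
   of points whose [f]-image lies in the same tile; on [H f] the colouring has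
   exactly the prescribed statistics. The three bad events of [pc_bad] are: being
   sent by [f] into another tile, and leaving [C] under [f] or under [f^-1]. *)
Record partial_copy (C : set Y) (B : 'I_k -> set Y) (H : G -> set Y) : Prop := PartialCopy {
  pc_mC : measurable C;
  pc_mB : forall c, measurable (B c);
  pc_mH : forall f, measurable (H f);
  pc_BC : forall c, B c `<=` C;
  pc_dB : forall c c', c != c' -> B c `&` B c' = set0;
  pc_cover : forall x, C x -> exists c, B c x;
  pc_HC : forall f, f \in F -> H f `<=` C `&` act b f @^-1` C;
  pc_bad : forall f, f \in F ->
    pr Q (C `&` act b f @^-1` C `\` H f) + pr Q (C `\` act b f @^-1` C) +
    pr Q (C `\` act b f^-1 @^-1` C) <= 3 * eps * pr Q C;
  pc_stat : forall f, f \in F -> forall c c',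
    pr Q (H f `&` (B c `&` act b f @^-1` B c')) = p f c c' * pr Q (H f) }.

Lemma partial_copy0 : partial_copy set0 (fun=> set0) (fun=> set0).
Proof.
split => //; first by move=> c y [].
- by move=> c c' _; rewrite setI0.
- by move=> f fF; rewrite !set0I !set0D pr0; lra.
- by move=> f fF c c'; rewrite set0I pr0 mulr0.
Qed.

(** * Adding one family of tiles *)

Section extension.
Variables (C : set Y) (B : 'I_k -> set Y) (H : G -> set Y).
Hypothesis pcC : partial_copy C B H.
Variables (I : finType) (t : I -> G) (bd : {set I}).
Hypothesis tinj : injective t.
Hypothesis bdP : forall f i, f \in F -> i \notin bd ->
  (exists j, (f * t i = t j)%g) /\ (exists j, (f^-1 * t i = t j)%g).
Variables (S : {set I}) (P0 : set Y).
Hypothesis towerP0 : tower_base t P0.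
Hypothesis shapeP0 : forall x, P0 x -> forall i, i \in S <-> ~ C (act b (t i) x).
Hypothesis S_bd : #|S :&: bd|%:R <= eps * #|S|%:R :> R.
Notation W := {ffun I -> 'I_k}.
Variables (P : W -> set Y) (al : W -> R) (ms : R).
Hypothesis mP : forall w, measurable (P w).
Hypothesis PP0 : forall w, P w `<=` P0.
Hypothesis dP : forall w w', w != w' -> P w `&` P w' = set0.
Hypothesis prP : forall w, pr Q (P w) = al w * ms.
Hypothesis ms_ge0 : 0 <= ms.
Hypothesis al1 : \sum_w al w = 1.
Hypothesis al_stat : forall f i j c c', (f * t i = t j)%g ->
  \sum_(w : W | (w i == c) && (w j == c')) al w = p f c c'.

(** Level [i] of the tower over [P w]; when [i] is in [S], the level is new and receives the colour
    [w i]. *)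
Let M (u : I * W) : set Y := act b (t u.1)^-1 @^-1` P u.2.
Let U (q : pred (I * W)) : set Y := \big[setU/set0]_(u | q u) M u.

Let mM u : measurable (M u).
Proof. exact: measurable_act. Qed.

Let mU q : measurable (U q).
Proof. by apply: bigsetU_measurable => u _. Qed.

Let UP (q : pred (I * W)) y : U q y <-> exists2 u, q u & M u y.
Proof.
rewrite /U -bigcup_seq_cond; split => [[u /= /andP[_ qu] My]|[u qu My]]; exists u => //=.
by rewrite mem_index_enum qu.
Qed.

Let M_uniq u v y : M u y -> M v y -> u = v.
Proof.
case: u v => [i w] [j w'] Mi Mj.
have ij : i = j.
  apply/eqP; apply: contrapT => /negP/eqP ij.
  by have := towerP0 ij (PP0 Mi) (PP0 Mj); rewrite !actKV.
rewrite -{j}ij in Mj *; congr pair; apply/eqP; apply: contraT => ww'.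
have := congr1 (@^~ (act b (t i)^-1 y)) (dP ww') => /= /propeqP [] /(_ (conj Mi Mj)).
by [].
Qed.

Let prU_sum q : pr Q (U q) = \sum_(u | q u) al u.2 * ms.
Proof.
rewrite /U pr_bigcup//; last first.
  move=> u v uv; apply/seteqP; split => // y [Mu Mv].
  by move/eqP: uv; apply; exact: M_uniq Mu Mv.
by apply: eq_bigr => u _; rewrite -prP /M pr_act.
Qed.

Let prU_base (r : pred I) : pr Q (U (fun u => r u.1)) = #|r|%:R * ms.
Proof.
rewrite prU_sum -mulr_suml; congr (_ * _).
rewrite (eq_bigl (fun u => r u.1 && predT u.2)) => [|u]; last by rewrite andbT.
rewrite -(pair_big r predT (fun i w => al w))/= (eq_bigr (fun=> 1)) => [|i _]; last exact: al1.
by rewrite (eq_bigl (mem r)) ?sumr_const.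
Qed.

Let UC (q : pred (I * W)) : (forall u, q u -> u.1 \in S) -> U q `&` C = set0.
Proof.
move=> qS; apply/seteqP; split => // y [/UP[u qu Mu] Cy].
have := (shapeP0 (PP0 Mu) u.1).1 (qS u qu); rewrite actKV; exact.
Qed.

Let U_sub (q q' : pred (I * W)) : (forall u, q u -> q' u) -> U q `<=` U q'.
Proof. by move=> qq' y /UP[u qu Mu]; apply/UP; exists u => //; exact: qq'. Qed.

Let New := U (fun u => u.1 \in S).
Let NewBd := U (fun u => u.1 \in S :&: bd).
Let good f i := [exists j in S, (f * t i == t j)%g].
Let C' := C `|` New.
Let B' c := B c `|` U (fun u : I * W => (u.1 \in S) && (u.2 u.1 == c)).
Let H' f := H f `|` U (fun u => (u.1 \in S) && good f u.1).

Let NewC : New `&` C = set0. Proof. exact: UC. Qed.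

(* The image of a new point under an element of [F] that stays in the full
   tile [t I x] is either covered already or new. *)
Let M_move f i j w y : M (i, w) y -> (f * t i = t j)%g -> M (j, w) (act b f y).
Proof.
move=> Mi ft; rewrite /M/= -act_mul.
have -> : ((t j)^-1 * f = (t i)^-1)%g by rewrite -ft invgM mulgVK.
exact: Mi.
Qed.

Let M_C_or_New i w y : M (i, w) y -> C y \/ New y.
Proof.
move=> Mi; have [Cy|nCy] := pselect (C y); [by left|right].
apply/UP; exists (i, w) => //=; apply/(shapeP0 (PP0 Mi) i).
by rewrite actKV.
Qed.

(** A point of [C] whose image becomes covered no longer leaves. A new point leaves only from a
    boundary level, since from any other level it moves within the full tile, all of which is now
    covered. The credit from the old points pays for the passages from [C] to [New]. *)
Let leave f : (forall i, i \notin bd -> exists j, (f * t i = t j)%g) ->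
  pr Q (C' `\` act b f @^-1` C') + pr Q (C `&` act b f @^-1` New) <=
  pr Q (C `\` act b f @^-1` C) + pr Q NewBd.
Proof.
move=> fbd; have mC := pc_mC pcC; have mNew : measurable New by exact: mU.
have mNB : measurable NewBd by exact: mU.
have mC' : measurable C' by exact: measurableU.
have mf (A : set Y) : measurable A -> measurable (act b f @^-1` A) by exact: measurable_act.
have := mf _ mC; have := mf _ mNew; have := mf _ mC' => mfC' mfN mfC.
set X := C `\` act b f @^-1` C.
have mX : measurable X by exact: measurableD.
have CX : C `&` act b f @^-1` New `<=` X.
  by move=> y [Cy Ny]; split => // Cfy; have := congr1 (@^~ (act b f y)) NewC => /= /propeqP [] /(_ (conj Ny Cfy)).
have mE : measurable (C `&` act b f @^-1` New) by exact: measurableI.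
have : C' `\` act b f @^-1` C' `<=` (X `\` (C `&` act b f @^-1` New)) `|` NewBd.
  move=> y [[Cy|/UP[[i w] /= iS Mi]] nC'].
    left; split; first by split => // Cfy; apply: nC'; left.
    by move=> [_ Ny]; apply: nC'; right.
  right; apply/UP; exists (i, w) => //=; rewrite inE iS /=; apply: contraT => ibd.
  have [j ft] := fbd i ibd; exfalso; apply: nC'.
  by have [Cfy|Nfy] := M_C_or_New (M_move Mi ft); [left|right].
move=> /(le_pr Q (measurableD mC' mfC') (measurableU _ _ (measurableD mX mE) mNB)).
move=> /le_trans /(_ (le_prU Q (measurableD mX mE) mNB)).
have := prID Q mX mE; rewrite setIidr//; lra.
Qed.

(** On a good level the target level is unique because [t] is injective, so [al_stat] evaluates the
    sum over words level by level. *)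
Let pair_sum f c c' : f \in F ->
  \sum_(u : I * W | [&& u.1 \in S, good f u.1, u.2 u.1 == c &
    [exists j in S, (f * t u.1 == t j)%g && (u.2 j == c')]]) al u.2 * ms =
  p f c c' * pr Q (U (fun u => (u.1 \in S) && good f u.1)).
Proof.
move=> fF; rewrite (prU_base (fun i => (i \in S) && good f i)) -mulr_suml [RHS]mulrA; congr (_ * _).
rewrite (eq_bigl (fun u : I * W => ((u.1 \in S) && good f u.1) &&
   ((u.2 u.1 == c) && [exists j in S, (f * t u.1 == t j)%g && (u.2 j == c')]))); last first.
  by move=> u /=; rewrite -!andbA.
rewrite -(pair_big_dep (fun i => (i \in S) && good f i)
  (fun i (w : W) => (w i == c) && [exists j in S, (f * t i == t j)%g && (w j == c')])
  (fun i w => al w))/= (eq_bigr (fun=> p f c c')).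
  by rewrite (eq_bigl (mem (fun i => (i \in S) && good f i))) ?sumr_const ?mulr_natr.
move=> i /andP[iS /exists_inP[j jS /eqP ft]]; rewrite -(al_stat c c' ft).
apply: eq_bigl => w; congr (_ && _); apply/exists_inP/idP => [[l lS /andP[/eqP fl wl]]|wj].
  by have -> : j = l by apply: tinj; rewrite -ft.
by exists j; rewrite // ft eqxx.
Qed.

Lemma partial_copy_extend : exists C1 B1 H1, partial_copy C1 B1 H1 /\
  pr Q C1 = pr Q C + #|S|%:R * ms.
Proof.
have mC := pc_mC pcC; have mNew : measurable New by exact: mU.
have mNB : measurable NewBd by exact: mU.
have mC' : measurable C' by exact: measurableU.
have mB' c : measurable (B' c) by apply: measurableU; [exact: (pc_mB pcC)|exact: mU].
have mH' f : measurable (H' f) by apply: measurableU; [exact: (pc_mH pcC)|exact: mU].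
have mf f (A : set Y) : measurable A -> measurable (act b f @^-1` A) by exact: measurable_act.
have prNew : pr Q New = #|S|%:R * ms by rewrite /New (prU_base (fun i => i \in S)).
have prC' : pr Q C' = pr Q C + #|S|%:R * ms.
  by rewrite /C' prU// ?prNew// setIC NewC.
have Nd y : New y -> C y -> False.
  by move=> Ny Cy; have := congr1 (@^~ y) NewC => /= /propeqP [] /(_ (conj Ny Cy)).
have SubNew (q : pred (I * W)) : (forall u, q u -> u.1 \in S) -> U q `<=` New by exact: U_sub.
have BN c : U (fun u : I * W => (u.1 \in S) && (u.2 u.1 == c)) `<=` New by apply: SubNew => u /andP[].
have HN f : U (fun u => (u.1 \in S) && good f u.1) `<=` New by apply: SubNew => u /andP[].
exists C', B', H'; split => //; split => //.
- by move=> c y [/(pc_BC pcC)|/BN]; [left|right].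
- move=> c c' cc'; apply/seteqP; split => // y [[Bc|Uc] [Bc'|Uc']].
  + by rewrite -(pc_dB pcC cc').
  + exact: Nd (BN _ _ Uc') (pc_BC pcC Bc).
  + exact: Nd (BN _ _ Uc) (pc_BC pcC Bc').
  + move/UP: Uc => [u /andP[_ /eqP uc] Mu]; move/UP: Uc' => [v /andP[_ /eqP vc] Mv].
    by move: cc'; rewrite -uc -vc (M_uniq Mu Mv) eqxx.
- move=> y [/(pc_cover pcC)[c Bc]|/UP[u uS Mu]]; first by exists c; left.
  by exists (u.2 u.1); right; apply/UP; exists u; rewrite ?uS ?eqxx.
- move=> f fF y [/(pc_HC pcC fF)[Cy Cfy]|Uy]; first by split; left.
  split; first by right; exact: HN Uy.
  move/UP: Uy => [[i w] /= /andP[iS /exists_inP[j jS /eqP ft]] Mi].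
  by right; apply/UP; exists (j, w) => //; exact: M_move Mi ft.
(* Passages from old to new tiles are paid for by [leave] for [f], and those from new to old by
   [leave] for [f^-1]. Each use costs one [NewBd], and passages between new points outside [H'] cost
   a third, whence the constant 3. *)
- move=> f fF; have fbd i : i \notin bd -> exists j, (f * t i = t j)%g by move=> /(bdP fF)[].
  have fbd' i : i \notin bd -> exists j, (f^-1 * t i = t j)%g by move=> /(bdP fF)[].
  have L1 := leave fbd; have L2 := leave fbd'.
  have E2 : pr Q (New `&` act b f @^-1` C) = pr Q (C `&` act b f^-1 @^-1` New).
    rewrite -[RHS](pr_act f); last by apply: measurableI => //; exact: mf.
    by congr (pr Q _); apply/seteqP; split => y /=; rewrite actK => -[].
  have prNB : pr Q NewBd <= eps * pr Q New.
    rewrite prNew /NewBd (prU_base (fun i => i \in S :&: bd)) mulrA.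
    by rewrite ler_wpM2r.
  have bad : C' `&` act b f @^-1` C' `\` H' f `<=`
      ((C `&` act b f @^-1` C `\` H f) `|` (C `&` act b f @^-1` New)) `|`
      ((New `&` act b f @^-1` C) `|` NewBd).
    move=> y [[[Cy|Ny] [Cfy|Nfy]] nH].
    + by left; left; split => // Hy; apply: nH; left.
    + by left; right.
    + by right; left.
    + right; right; move/UP: Ny => [[i w] /= iS Mi]; apply/UP; exists (i, w) => //=.
      rewrite inE iS/=; apply: contraT => ibd; exfalso; apply: nH; right.
      have [j ft] := fbd i ibd; have Mj := M_move Mi ft.
      move/UP: Nfy => [v vS Mv]; have jv := M_uniq Mj Mv.
      apply/UP; exists (i, w) => //=; rewrite iS; apply/exists_inP; exists j; last by rewrite ft.
      by rewrite -jv in vS.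
  have mH := pc_mH pcC f; have mfC := mf f _ mC; have mfN := mf f _ mNew; have mfC' := mf f _ mC'.
  have mb1 : measurable (C `&` act b f @^-1` C `\` H f) by meas.
  have mb2 : measurable (C `&` act b f @^-1` New) by meas.
  have mb3 : measurable (New `&` act b f @^-1` C) by meas.
  have mb : measurable (C' `&` act b f @^-1` C' `\` H' f).
    by apply: measurableD => //; exact: measurableI.
  have := le_pr Q mb (measurableU _ _ (measurableU _ _ mb1 mb2) (measurableU _ _ mb3 mNB)) bad.
  have := le_prU Q (measurableU _ _ mb1 mb2) (measurableU _ _ mb3 mNB).
  have := le_prU Q mb1 mb2; have := le_prU Q mb3 mNB.
  have := pc_bad pcC fF; rewrite prC' -prNew; nra.
move=> f fF c c'.
have mH := pc_mH pcC f; have mB := pc_mB pcC.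
have -> : H' f `&` (B' c `&` act b f @^-1` B' c') =
   (H f `&` (B c `&` act b f @^-1` B c')) `|`
   U (fun u : I * W => [&& u.1 \in S, good f u.1, u.2 u.1 == c &
      [exists j in S, (f * t u.1 == t j)%g && (u.2 j == c')]]).
  apply/seteqP; split => y.
    move=> [[Hy|Uy] [By Bfy]].
      have [Cy Cfy] := pc_HC pcC fF Hy.
      left; split => //; split.
        by case: By => // /BN Ny; exfalso; exact: Nd Ny Cy.
      by case: Bfy => // /BN Ny; exfalso; exact: Nd Ny Cfy.
    have Ny := HN _ _ Uy.
    right; move/UP: Uy => [[i w] /= /andP[iS gi] Mi]; apply/UP; exists (i, w) => //=.
    have wi : w i = c.
      case: By => [/(pc_BC pcC) Cy|/UP[v /andP[_ /eqP vc] Mv]]; first by exfalso; exact: Nd Ny Cy.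
      by rewrite -vc -(M_uniq Mi Mv).
    rewrite iS gi wi eqxx /=.
    have /exists_inP[j jS /eqP ft] := gi; have Mj := M_move Mi ft.
    apply/exists_inP; exists j; rewrite // ft eqxx /=.
    have Nfy : New (act b f y) by apply/UP; exists (j, w).
    case: Bfy => [/(pc_BC pcC) Cy|/UP[v /andP[_ /eqP vc] Mv]]; first by exfalso; exact: Nd Nfy Cy.
    by rewrite -vc -(M_uniq Mj Mv).
  move=> [[Hy [By Bfy]]|/UP[[i w] /= /and4P[iS gi wc /exists_inP[j jS /andP[/eqP ft wj]]] Mi]].
    by split; [left|split; left].
  split; first by right; apply/UP; exists (i, w); rewrite //= iS gi.
  split; first by right; apply/UP; exists (i, w); rewrite //= iS wc.
  right; apply/UP; exists (j, w); rewrite /= ?jS//; exact: M_move Mi ft.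
rewrite prU//; last 2 first.
- by apply: measurableI => //; apply: measurableI => //; exact: mf.
- apply/seteqP; split => // y [[Hy _] Uy]; have [Cy _] := pc_HC pcC fF Hy.
  by apply: (Nd y) => //; apply: SubNew Uy => u /andP[].
rewrite (pc_stat pcC fF) prU_sum pair_sum// /H' prU ?mulrDr//.
apply/seteqP; split => // y [Hy Uy]; have [Cy _] := pc_HC pcC fF Hy.
exact: Nd (HN _ _ Uy) Cy.
Qed.

End extension.
End copying.

(** * Weak containment in free actions of amenable groups *)

(** Averaging. In the sum of [ds S * #|S|], shapes with too much boundary contribute at most half of
    the total, and shapes of measure below the threshold at most a quarter, so some shape is
    neither. *)
Lemma choose_shape (R : realType) (I : finType) (bd : {set I}) (ds : {set I} -> R)
    (eps dl zeta : R) : 0 < eps -> 0 < dl -> dl <= zeta -> (0 < #|I|)%N ->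
  (forall S, 0 <= ds S) -> #|bd|%:R <= eps / 2 * #|I|%:R ->
  \sum_(S : {set I}) ds S * #|S|%:R = #|I|%:R * zeta ->
  \sum_(S : {set I}) ds S * #|S :&: bd|%:R = #|bd|%:R * zeta ->
  exists S : {set I}, [/\ (0 < #|S|)%N, #|S :&: bd|%:R <= eps * #|S|%:R &
    dl / (4 * #|{set I}|%:R) <= ds S].
Proof.
move=> eps0 dl0 dlz I0 ds0 bdI sumS sumbd; apply: contrapT => noS.
set ka := dl / _ in noS.
have I0' : 0 < #|I|%:R :> R by rewrite ltr0n.
have N0 : 0 < #|{set I}|%:R :> R by rewrite ltr0n; apply/card_gt0P; exists (finset.set0 : {set I}).
have ka0 : 0 < ka by rewrite divr_gt0// mulr_gt0.
have term (S : {set I}) : ds S * #|S|%:R <= ka * #|I|%:R + eps^-1 * (ds S * #|S :&: bd|%:R).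
  have c0 : 0 <= ds S * #|S :&: bd|%:R by rewrite mulr_ge0.
  have e0 : 0 <= eps^-1 * (ds S * #|S :&: bd|%:R) by rewrite mulr_ge0// invr_ge0 ltW.
  have SI : #|S|%:R <= #|I|%:R :> R by rewrite ler_nat max_card.
  have [S0|S0] := posnP #|S|.
    by rewrite S0 mulr0 addr_ge0// mulr_ge0// ltW.
  have [Sb|Sb] := leP (#|S :&: bd|%:R : R) (eps * #|S|%:R).
    have dska : ds S <= ka.
      by rewrite leNgt; apply/negP => kads; apply: noS; exists S; split => //; exact: ltW.
    have := ler_pM (ds0 S) (ler0n R #|S|) dska SI; lra.
  have -> : ds S * #|S|%:R = eps^-1 * (ds S * (eps * #|S|%:R)).
    by rewrite mulrCA mulKf// gt_eqF.
  apply: ler_wpDl; first by rewrite mulr_ge0// ltW.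
  by apply: ler_wpM2l; [rewrite invr_ge0 ltW|apply: ler_wpM2l; rewrite // ltW].
have : \sum_(S : {set I}) ds S * #|S|%:R <=
    \sum_(S : {set I}) (ka * #|I|%:R + eps^-1 * (ds S * #|S :&: bd|%:R)).
  by apply: ler_sum.
rewrite big_split/= sumS -[X in _ <= _ + X]mulr_sumr sumbd.
have -> : \sum_(S : {set I}) ka * #|I|%:R = dl / 4 * #|I|%:R.
  transitivity (ka * #|I|%:R * #|{set I}|%:R); first by rewrite sumr_const -(mulr_natr (ka * _)).
  by rewrite /ka; field; rewrite gt_eqF.
have : eps^-1 * (#|bd|%:R * zeta) <= #|I|%:R * zeta / 2.
  rewrite mulrC ler_pdivrMr//; have z0 : 0 <= zeta by lra.
  have := ler_wpM2r z0 bdI; lra.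
have := ler_wpM2l (ltW I0') dlz; have := mulr_gt0 I0' dl0; lra.
Qed.

Section amenable_weak_containment.
Context (R : realType) (G : groupType) (e : nat -> G) (a b : mp_action R G).
Hypotheses (einj : injective e) (free : free_action b).
Notation X := (act_space a).
Notation Y := (act_space b).
Notation P := (act_measure a).
Notation Q := (act_measure b).
Variables (k : nat) (A : 'I_k -> set X).
Hypothesis pA : borel_partition A.

Let mA c : measurable (A c). Proof. by case: pA. Qed.

Let A_ex x : exists c, A c x.
Proof.
have [_ _ cA] := pA; have := congr1 (@^~ x) cA => /= /propeqP [] _ /(_ Logic.I).
by move=> [c _ Ac]; exists c.
Qed.

Let A_uniq c c' x : A c x -> A c' x -> c = c'.
Proof. by have [_ tA _] := pA; move=> Ac Ac'; apply: tA => //; exists x. Qed.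

Definition stat (g : G) c c' : R := pr P (A c `&` act a g @^-1` A c').

Section words.
Variables (I : finType) (t : I -> G).
Notation W := {ffun I -> 'I_k}.

Definition word_set (w : W) : set X := \big[setI/setT]_i (act a (t i) @^-1` A (w i)).

Lemma word_setP w x : word_set w x <-> forall i, A (w i) (act a (t i) x).
Proof.
rewrite /word_set -bigcap_seq; split => [H i|H i _]; last exact: H.
exact: (H i (mem_index_enum _)).
Qed.

Lemma measurable_word_set w : measurable (word_set w).
Proof. by apply: bigsetI_measurable => i _; exact: measurable_act. Qed.

Lemma pr_words (q : pred W) : \sum_(w | q w) pr P (word_set w) =
  pr P [set x | forall w, word_set w x -> q w].
Proof.
rewrite -(pr_bigcup P q measurable_word_set); last first.
  move=> w w' ww'; apply/seteqP; split => // x [/word_setP H1 /word_setP H2].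
  by move/eqP: ww'; apply; apply/ffunP => i; exact: A_uniq (H1 i) (H2 i).
congr pr; apply/seteqP; split => x; rewrite -bigcup_seq_cond.
  move=> [w /= /andP[_ qw] /word_setP H1] w' /word_setP H2.
  by have -> : w' = w by apply/ffunP => i; exact: A_uniq (H2 i) (H1 i).
have /choice[c cP] i := A_ex (act a (t i) x).
have Hw : word_set [ffun i => c i] x by apply/word_setP => i; rewrite ffunE.
by move=> /(_ _ Hw) qw; exists [ffun i => c i]; rewrite //= mem_index_enum.
Qed.

Lemma pr_words_total : \sum_w pr P (word_set w) = 1.
Proof. by rewrite pr_words -(prT P); congr pr; apply/seteqP. Qed.

Lemma pr_words_stat f i j c c' : (f * t i = t j)%g ->
  \sum_(w : W | (w i == c) && (w j == c')) pr P (word_set w) = stat f c c'.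
Proof.
move=> ft; rewrite pr_words /stat.
rewrite -(pr_act (t i) (measurableI _ _ (mA c) (measurable_act f (mA c')))).
congr pr; apply/seteqP; split => x /=; rewrite -act_mul ft.
  move=> H; have /choice[d dP] l := A_ex (act a (t l) x).
  have Hw : word_set [ffun l => d l] x by apply/word_setP => l; rewrite ffunE.
  by have := H _ Hw; rewrite !ffunE => /andP[/eqP <- /eqP <-].
move=> [Ac Ac'] w /word_setP Hw.
by rewrite (A_uniq (Hw i) Ac) (A_uniq (Hw j) Ac') !eqxx.
Qed.

End words.

Variables (F : seq G) (eps : R).
Hypothesis eps0 : 0 < eps.
Variables (I : finType) (t : I -> G) (bd : {set I}).
Hypotheses (tinj : injective t) (I0 : (0 < #|I|)%N).
Hypothesis bdP : forall f i, f \in F -> i \notin bd ->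
  (exists j, (f * t i = t j)%g) /\ (exists j, (f^-1 * t i = t j)%g).
Hypothesis bd_small : #|bd|%:R <= eps / 2 * #|I|%:R :> R.

Notation pcopy := (@partial_copy R G b k stat F eps).

Lemma partial_copy_step (dl : R) : 0 < dl -> exists2 s : R, 0 < s & forall C B H, pcopy C B H ->
  pr Q C <= 1 - dl -> exists C1 B1 H1, pcopy C1 B1 H1 /\ pr Q C + s <= pr Q C1.
Proof.
move=> dl0; pose ka : R := dl / (4 * #|{set I}|%:R).
have ka0 : 0 < ka.
  by rewrite divr_gt0// mulr_gt0// ltr0n; apply/card_gt0P; exists (finset.set0 : {set I}).
have ka20 : 0 < ka / 2 by rewrite divr_gt0.
(* The cells are chosen before [C], which makes the gain [s] the same for all partial copies. *)
have [N [D [mD dD tD cD]]] := free_cells free tinj ka20.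
have N0 : 0 < #|N|.+1%:R :> R by rewrite ltr0n.
exists (ka / 2 / #|N|.+1%:R); first by rewrite divr_gt0.
move=> C B H pcC Csmall; have mC := pc_mC pcC; have mnC : measurable (~` C) by exact: measurableC.
have prnC : pr Q (~` C) = 1 - pr Q C by rewrite prC.
have mCt i : measurable (act b (t i) @^-1` (~` C)) by exact: measurable_act.
pose shape (S : {set I}) : set Y := \big[setI/setT]_i
  (if i \in S then act b (t i) @^-1` (~` C) else ~` (act b (t i) @^-1` (~` C))).
have shapeP S x : shape S x <-> forall i, i \in S <-> ~ C (act b (t i) x).
  rewrite /shape -bigcap_seq; split => [Hx i|Hx i _].
    have := Hx i (mem_index_enum _); by case: ifP => iS h; split.
  have := Hx i; case: ifP => iS h; first exact: h.1.
  by move=> nC; have := h.2 nC.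
have mshape S : measurable (shape S).
  by apply: bigsetI_measurable => i _; case: ifP => _ //; exact: measurableC.
have dshape S S' : S != S' -> shape S `&` shape S' = set0.
  move=> SS'; apply/seteqP; split => // x [/shapeP H1 /shapeP H2]; move/eqP: SS'; apply.
  by apply/setP => i; apply/idP/idP => [/H1/H2|/H2/H1].
have shape_ex x : exists S, shape S x.
  exists [set i | `[< ~ C (act b (t i) x) >]]%SET; apply/shapeP => i; rewrite inE.
  by split => /asboolP.
(* Double counting: for each level [i], invariance makes the set of points with [t i x] uncovered as
   large as the complement of [C]. *)
have count (E : {set I}) : \sum_(S : {set I}) pr Q (shape S) * #|S :&: E|%:R = #|E|%:R * (1 - pr Q C).
  transitivity (\sum_(i in E) \sum_(S : {set I}) pr Q (act b (t i) @^-1` (~` C) `&` shape S)).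
    rewrite exchange_big/=; apply: eq_bigr => S _.
    rewrite (eq_bigr (fun i => (i \in S)%:R * pr Q (shape S))) => [|i iE].
      rewrite -mulr_suml mulrC; congr (_ * _).
      rewrite -sum1_card natr_sum big_mkcond [RHS]big_mkcond/=.
      by apply: eq_bigr => i _; rewrite inE; case: (i \in S); case: (i \in E).
    case: (boolP (i \in S)) => iS; rewrite ?mul1r ?mul0r.
      by congr pr; apply/seteqP; split => [x []//|x Sx]; split => //; exact/(shapeP S x).1.
    rewrite -[RHS](pr0 Q); congr pr; apply/seteqP; split => // x [nC /shapeP Sx].
    by move/negP: iS; apply; apply/Sx.
  rewrite (eq_bigr (fun=> 1 - pr Q C)) ?sumr_const ?mulr_natl// => i _.
  rewrite -prnC -(pr_act (t i) mnC) [RHS](pr_fincover Q mshape dshape)//.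
  by move=> x _; have [S Sx] := shape_ex x; exists S.
have [||S [S0 Sbd Ska]] := @choose_shape R I bd (fun S => pr Q (shape S)) eps dl (1 - pr Q C)
    eps0 dl0 _ I0 (fun S => pr_ge0 Q _) bd_small _ (count bd).
- by lra.
- by rewrite -cardsT -(count [set: I]%SET); apply: eq_bigr => S _; rewrite finset.setIT.
pose DU := \big[setU/set0]_v D v.
have mDU : measurable DU by apply: bigsetU_measurable.
(* Pigeonhole: the cells miss at most [ka / 2], so they share at least [ka / 2] of the chosen shape.
   The successor of [#|N|] makes the contradiction strict. *)
have [v Dv] : exists v, ka / 2 / #|N|.+1%:R <= pr Q (shape S `&` D v).
  apply: contrapT => nov.
  have lt v : pr Q (shape S `&` D v) <= ka / 2 / #|N|.+1%:R.
    by rewrite leNgt; apply/negP => h; apply: nov; exists v; exact: ltW.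
  have : pr Q (shape S `&` DU) <= \sum_(v : N) ka / 2 / #|N|.+1%:R.
    rewrite /DU big_distrr/=; apply: le_trans (le_pr_bigcup Q predT _) _.
      by move=> v; exact: measurableI.
    exact: ler_sum.
  rewrite sumr_const -[_ *+ _]mulr_natr => h0.
  have h1 : pr Q (shape S `&` DU) <= ka / 2 / #|N|.+1%:R * #|N|%:R := h0.
  have := prID Q (mshape S) mDU.
  have : pr Q (shape S `\` DU) <= pr Q (~` DU).
    by apply: le_pr; [exact: measurableD|exact: measurableC|move=> x []].
  rewrite prC// => h2 h3.
  have h4 : ka / 2 / #|N|.+1%:R * #|N|%:R < ka / 2.
    by rewrite mulrAC ltr_pdivrMr// ltr_pM2l// ltr_nat.
  have h5 : ka <= pr Q (shape S) by exact: Ska.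
  have h6 := le_lt_trans h1 h4.
  move: h6 h2 h5 cD; rewrite -/DU h3.
  move: (pr Q (_ `&` _)) (pr Q (_ `\` _)) (pr Q DU) => x y z h6 h2 h5 h7.
  lra.
pose P0 := shape S `&` D v; have mP0 : measurable P0 by exact: measurableI.
have [E [mE sE dE pE]] := @weighted_split R G b free e P0 {ffun I -> 'I_k}
  (fun w => pr P (word_set t w)) einj mP0 (fun w => pr_ge0 P _) (pr_words_total t).
have towP0 : tower_base t P0 by apply: tower_baseS (tD v) => x [].
have shP0 x : P0 x -> forall i, i \in S <-> ~ C (act b (t i) x) by move=> [/shapeP].
have [C1 [B1 [H1 [pc1 prC1]]]] := @partial_copy_extend R G b k stat F eps C B H pcC I t bd tinj bdP
  S P0 towP0 shP0 Sbd E (fun w => pr P (word_set t w)) (pr Q P0) mE sE dE pE (pr_ge0 Q P0)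
  (pr_words_total t) (fun f i j c c' ft => @pr_words_stat I t f i j c c' ft).
exists C1, B1, H1; split => //; rewrite prC1 lerD2l; apply: le_trans Dv _.
by rewrite -/P0 ler_peMl ?pr_ge0// ler1n.
Qed.

(** As long as mass [dl] is uncovered each step gains at least [s], which cannot go on beyond total
    measure 1. *)
Lemma partial_copy_exhaust (dl : R) : 0 < dl -> exists C B H, pcopy C B H /\ 1 - dl < pr Q C.
Proof.
move=> dl0; have [s s0 step] := partial_copy_step dl0; apply: contrapT => noC.
have small C B H : pcopy C B H -> pr Q C <= 1 - dl.
  by move=> pc; rewrite leNgt; apply/negP => h; apply: noC; exists C, B, H.
have grow n : exists C B H, pcopy C B H /\ s *+ n <= pr Q C.
  elim: n => [|n [C [B [H [pc Cn]]]]].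
    exists set0, (fun=> set0), (fun=> set0); split; first exact: partial_copy0.
    by rewrite mulr0n pr0.
  have [C1 [B1 [H1 [pc1 h]]]] := step C B H pc (small _ _ _ pc).
  by exists C1, B1, H1; split => //; rewrite mulrSr; lra.
have [n hn] : exists n, 1 <= s *+ n.
  have := archi_boundP (ltW (divr_gt0 ltr01 s0)); set n := Num.Def.archi_bound _ => nb.
  by exists n; rewrite -mulr_natl -ler_pdivrMr// ltW.
have [C [B [H [pc Cn]]]] := grow n; have := small _ _ _ pc; lra.
Qed.

Lemma copy_partition : exists2 B : 'I_k -> set Y, borel_partition B &
  forall f, f \in F -> forall c c', `|stat f c c' - pr Q (B c `&` act b f @^-1` B c')| <= 4 * eps.
Proof.
have [C [B [H [pc hC]]]] := partial_copy_exhaust eps0.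
(* Uncovered points all receive one colour [c0], which exists because the space is inhabited. *)
have [c0 _] := A_ex point.
pose B' c := B c `|` (if c == c0 then ~` C else set0).
have mC := pc_mC pc; have mnC : measurable (~` C) by exact: measurableC.
have mB' c : measurable (B' c).
  by apply: measurableU; [exact: (pc_mB pc)|case: ifP].
exists B'.
  split => //.
  - apply/trivIsetP => c c' _ _ cc'; apply/seteqP; split => // y.
    move=> [[Bc|+] [Bc'|+]].
    + by rewrite -(pc_dB pc cc').
    + by case: ifP => // _ nC; have := nC (pc_BC pc Bc).
    + by case: ifP => // _ nC; have := nC (pc_BC pc Bc').
    + by case: eqP => // cE _; case: eqP => // c'E; rewrite cE c'E eqxx in cc'.
  - apply/seteqP; split => // y _; have [/(pc_cover pc)[c Bc]|nC] := pselect (C y).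
      by exists c => //; left.
    by exists c0 => //; right; rewrite eqxx.
move=> f fF c c'; have mH := pc_mH pc f.
have mBB : measurable (B' c `&` act b f @^-1` B' c') by apply: measurableI => //; exact: measurable_act.
have E1 : pr Q (H f `&` (B' c `&` act b f @^-1` B' c')) = stat f c c' * pr Q (H f).
  rewrite -(pc_stat pc fF); congr pr; apply/seteqP; split => y [Hy [By Bfy]]; have [Cy Cfy] := pc_HC pc fF Hy.
    split => //; split.
      by case: By => //; case: ifP => // _ nC; have := nC Cy.
    by case: Bfy => //; case: ifP => // _ nC; have := nC Cfy.
  by split => //; split; left.
have := prID Q mBB mH; rewrite (setIC _ (H f)) E1.
have mnH : measurable (~` H f) by exact: measurableC.
have : pr Q (B' c `&` act b f @^-1` B' c' `\` H f) <= pr Q (~` H f).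
  by apply: le_pr => //; exact: measurableD.
(* One [eps] for the uncovered points and three from [pc_bad]. *)
have nH : pr Q (~` H f) <= 4 * eps.
  have mfC : measurable (act b f @^-1` C) by exact: measurable_act.
  have mCC : measurable (C `&` act b f @^-1` C `\` H f) by meas.
  have mCC' : measurable (C `\` act b f @^-1` C) by meas.
  have sub : ~` H f `<=` ~` C `|` ((C `&` act b f @^-1` C `\` H f) `|` (C `\` act b f @^-1` C)).
    move=> y nHy; have [Cy|nC] := pselect (C y); last by left.
    by right; have [Cfy|nC] := pselect (C (act b f y)); [left|right].
  have := le_pr Q mnH (measurableU _ _ mnC (measurableU _ _ mCC mCC')) sub.
  have := le_prU Q mnC (measurableU _ _ mCC mCC'); have := le_prU Q mCC mCC'.
  have := pc_bad pc fF; have := pr_ge0 Q (C `\` act b f^-1 @^-1` C).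
  have := pr_le1 Q mC; rewrite prC//; nra.
have s0 : 0 <= stat f c c' by exact: pr_ge0.
have s1 : stat f c c' <= 1 by apply: pr_le1; apply: measurableI => //; exact: measurable_act.
have := prC Q mH; have := pr_ge0 Q (B' c `&` act b f @^-1` B' c' `\` H f).
move: (pr Q (H f)) (pr Q (~` H f)) nH (stat f c c') s0 s1 => h nh nH s s0 s1 d0 hC' dn ->.
have : 0 <= s * nh by apply: mulr_ge0 => //; lra.
have : s * nh <= nh by rewrite ler_piMl//; lra.
rewrite hC' ler_norml in nH dn *; move=> u1 u2; apply/andP; split; lra.
Qed.

End amenable_weak_containment.

Lemma amenable_weakly_contained (R : realType) (G : groupType) (e : nat -> G) (a b : mp_action R G) :
  injective e -> (forall g, exists n, e n = g) -> amenable R G -> free_action b ->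
  weakly_contained a b.
Proof.
move=> einj esurj am free; apply/weakly_containedP => k A pA F eps eps0.
(* [copy_partition] loses a factor 4, so [eps / 8] leaves a strict margin; the further factor 2 is
   the one required by [choose_shape]. Inverses join [F] because escapes under both [f] and [f^-1]
   are charged to the boundary. *)
have e80 : 0 < eps / 8 by rewrite divr_gt0.
have e160 : 0 < eps / 8 / 2 by rewrite divr_gt0.
have [T T0 Tbd] := @folner R G e (F ++ map (fun f => f^-1)%g F) _ esurj am e160.
pose t (i : T) : G := val i.
pose bd : {set T} := [set i | val i \in boundary (F ++ map (fun f => f^-1)%g F) T]%SET.
have bdP f i : f \in F -> i \notin bd ->
    (exists j, (f * t i = t j)%g) /\ (exists j, (f^-1 * t i = t j)%g).
  move=> fF; rewrite inE !inE /= (valP i) /= => /hasPn nbd.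
  have inT g : g \in F ++ map (fun f => f^-1)%g F -> exists j, (g * t i = t j)%g.
    by move=> /nbd; rewrite negbK => gT; exists [` gT]%fset.
  by split; apply: inT; rewrite mem_cat ?fF// map_f ?orbT.
have cbd : #|bd|%:R <= eps / 8 / 2 * #|{: T}|%:R :> R.
  rewrite -cardfE; apply: le_trans Tbd; rewrite ler_nat.
  rewrite cardE -(size_map val); apply: uniq_leq_size.
    by rewrite (map_inj_uniq val_inj) enum_uniq.
  by move=> g /mapP[i]; rewrite mem_enum inE => ib ->.
have T0' : (0 < #|{: T}|)%N by rewrite -cardfE cardfs_gt0.
have [B pB HB] := copy_partition einj free pA e80 (val_inj : injective t) T0' bdP cbd.
by exists B => // f fF i j; apply: le_lt_trans (HB f fF i j) _; lra.
Qed.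

(** * The Bernoulli shift as a free ergodic action *)

Section bernoulli_shift.
Context (R : realType) (G : groupType) (e : G -> nat) (e' : nat -> G).
Hypotheses (eK : cancel e e') (eK' : cancel e' e).

Definition shift (g : G) (n : nat) : nat := e (g * e' n)%g.

Lemma shift1 n : shift 1%g n = n.
Proof. by rewrite /shift mul1g eK'. Qed.

Lemma shiftM g h n : shift (g * h)%g n = shift g (shift h n).
Proof. by rewrite /shift eK mulgA. Qed.

Definition shift_action : mp_action R G := coin_action R shift1 shiftM.

Lemma shift_action_free : free_action shift_action.
Proof.
apply: (@coin_action_free R G _ _ _ e') => [g|g g1 V]; first by exists (e g).
have [N VN] := seq_nat_bound V; exists N; first by apply/negP => /VN; rewrite ltnn.
apply: contra g1 => /eqP egN; apply/eqP; apply: (mulIg (e' N)).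
by rewrite mul1g; apply: (can_inj eK); rewrite -[LHS]/(shift g N) egN eK'.
Qed.

Lemma shift_action_ergodic : ergodic shift_action.
Proof.
apply: coin_action_ergodic => V.
(* An element sending coordinate [u] to coordinate [v] is the quotient of their group elements, so
   any element outside this finite list moves [V] off itself. *)
have [N VN] := seq_nat_bound [seq e (e' v * (e' u)^-1)%g | v <- V, u <- V].
exists (e' N) => n nV; apply/negP => sV.
have /VN : N \in [seq e (e' v * (e' u)^-1)%g | v <- V, u <- V]; last by rewrite ltnn.
apply/allpairsP; exists (shift (e' N) n, n); split => //=.
by rewrite /shift eK mulgK eK'.
Qed.

End bernoulli_shift.

Theorem corollary4p2 (R : realType) (G : groupType)
    (G_countably_infinite : [set: G] #= [set: nat]) :
  ~ amenable R G <->
  exists a : mp_action R G,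
    free_action a /\
    forall b : mp_action R G, ergodic b -> ~ weakly_equivalent a b.
Proof.
have /card_set_bijP[e] := G_countably_infinite.
rewrite setTT_bijective => -[e' eK eK']; split.
  exact: (nonamenable_witness eK eK').
move=> [a [afree na]] am.
have e'_inj : injective e' := can_inj eK'.
have e'_surj g : exists n, e' n = g by exists (e g).
apply: (na (shift_action R eK eK')); first exact: shift_action_ergodic.
split; apply: (amenable_weakly_contained e'_inj e'_surj am) => //.
exact: shift_action_free.
Qed.
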